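(* Let $n\ge2$. For metric connections on $n$-dimensional manifolds, considered as pairs $(g,T)$ with the staggered jet-filtration, the numbers $h_k$ of pure order $k$ differential invariants are: $$h_0=\tfrac{n}{2}(n-1)^2,$$ $$h_k=\frac{n(n+1)}2\binom{n+k}{k+1}+\frac{n^2(n-1)}2\binom{n+k-1}{k}-n\binom{n+k+1}{k+2}\qquad\text{for }k>0.$$
   Context: Let $M$ be a manifold of dimension $n$. A metric connection is a pair $(g,\nabla)$ where $g$ is a (pseudo-)Riemannian metric on $M$ and $\nabla$ a linear connection on $M$ with $\nabla g=0$. Given $g$, such $\nabla$ are in bijection with their torsions $T=T_\nabla\in\Gamma(\Lambda^2T^*M\otimes TM)$, so the structure is equivalent to the pair $(g,T)$, with $T$ arbitrary. Jets are staggered: the $0$-jet of the structure consists of the values of $g$ and $T$ at the point, and for $k>0$ the $k$-jet of the structure consists of the $(k+1)$-jet of $g$ and the $k$-jet of $T$ (this corresponds to the $k$-jet of $(g,\nabla)$). Let $\mathcal{E}^k$ be the space of such $k$-jets. The pseudogroup $G=\mathrm{Diff}_{\mathrm{loc}}(M)$ of all local diffeomorphisms of $M$ acts naturally on $\mathcal{E}^k$. Let $s_k$ be the codimension of a generic $G$-orbit in $\mathcal{E}^k$ (equivalently, the transcendence degree of the field of $G$-invariant rational functions on $\mathcal{E}^k$), and put $h_k=s_k-s_{k-1}$, $s_{-1}=0$. *)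

(* Defs.v *)
From HB Require Import structures.
From mathcomp Require Import all_boot all_order all_algebra.
From mathcomp Require Import all_classical all_reals all_analysis.
Import Order.TTheory GRing.Theory Num.Theory.
Import numFieldNormedType.Exports.

Set Implicit Arguments.
Unset Strict Implicit.
Unset Printing Implicit Defensive.

Local Open Scope classical_set_scope.
Local Open Scope ring_scope.

(** * Smooth functions on open subsets of R^n *)

Definition partial (R : realType) (n : nat) (i : 'I_n) (f : 'rV[R]_n -> R) :
    'rV[R]_n -> R :=
  fun x => 'D_(delta_mx 0 i : 'rV[R]_n) f x.

(* The order in which the partial derivatives are taken is fixed; it is
   irrelevant for the smooth functions to which this is applied. *)
Definition mpartial (R : realType) (n : nat) (a : 'I_n -> nat)
    (f : 'rV[R]_n -> R) : 'rV[R]_n -> R :=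
  foldr (fun i h => iter (a i) (partial i) h) f (enum 'I_n).

Fixpoint Cm_on (R : realType) (n : nat) (m : nat) (U : set 'rV[R]_n)
    (f : 'rV[R]_n -> R) : Prop :=
  (forall x, U x -> {for x, continuous f}) /\
  match m with
  | 0 => True
  | m'.+1 => forall i : 'I_n,
      (forall x, U x -> derivable f x (delta_mx 0 i)) /\
      Cm_on m' U (partial i f)
  end.

Definition smooth_on (R : realType) (n : nat) (U : set 'rV[R]_n)
    (f : 'rV[R]_n -> R) : Prop := forall m, Cm_on m U f.

(** * Manifolds and their local diffeomorphisms *)

(* [coord] and [point] are total functions, meaningful only on [dom] and on
   [coord @` dom] respectively. *)
Record chart (R : realType) (n : nat) (M : topologicalType) := Chart {
  dom : set M;
  coord : M -> 'rV[R]_n;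
  point : 'rV[R]_n -> M;
  dom_open : open dom;
  image_open : open (coord @` dom);
  coord_continuous : forall p, dom p -> {for p, continuous coord};
  point_continuous :
    forall x, (coord @` dom) x -> {for x, continuous point};
  coordK : forall p, dom p -> point (coord p) = p }.

(* The coordinate expression of a map. *)
Definition read (R : realType) (n : nat) (M : topologicalType)
    (c c' : chart R n M) (f : M -> M) : 'rV[R]_n -> 'rV[R]_n :=
  fun x => coord c' (f (point c x)).

Definition smooth_read (R : realType) (n : nat) (M : topologicalType)
    (c c' : chart R n M) (W : set M) (f : M -> M) : Prop :=
  forall j : 'I_n,
    smooth_on (coord c @` (W `&` dom c `&` f @^-1` dom c'))
              (fun x => read c c' f x 0 j).

Record manifold (R : realType) (n : nat) := Manifold {
  carrier :> topologicalType;
  atlas : set (chart R n carrier);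
  manifold_hausdorff : hausdorff_space carrier;
  manifold_second_countable : @second_countable carrier;
  atlas_cover : forall p : carrier, exists2 c, atlas c & dom c p;
  atlas_compatible : forall c c', atlas c -> atlas c' ->
    smooth_read c c' setT id }.
Arguments atlas {R n} m _.

Definition smooth_map (R : realType) (n : nat) (M : manifold R n)
    (W : set M) (f : M -> M) : Prop :=
  (forall p, W p -> {for p, continuous f}) /\
  (forall c c', atlas M c -> atlas M c' -> smooth_read c c' W f).

(* [f] restricts to a diffeomorphism from the open set [W] onto the open set
   [f @` W]. *)
Definition local_diffeo (R : realType) (n : nat) (M : manifold R n)
    (W : set M) (f : M -> M) : Prop :=
  [/\ open W, open (f @` W), smooth_map W f &
      exists2 h : M -> M, smooth_map (f @` W) h &
        forall p, W p -> h (f p) = p].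

(** * Metric connections, as pairs (g, T), in coordinates *)

(* [metric s x i j] is g_ij(x); [torsion s x a i j] is T^a_ij(x). *)
Record structure (R : realType) (n : nat) := Structure {
  metric : 'rV[R]_n -> 'M[R]_n;
  torsion : 'rV[R]_n -> 'I_n -> 'I_n -> 'I_n -> R }.

(* The metric may have any signature. *)
Definition metric_connection_near (R : realType) (n : nat)
    (x : 'rV[R]_n) (s : structure R n) : Prop :=
  exists U : set 'rV[R]_n,
  [/\ open U, U x,
      (forall i j, smooth_on U (fun y => metric s y i j)),
      (forall a i j, smooth_on U (fun y => torsion s y a i j)) &
      forall y, U y ->
        [/\ (metric s y)^T = metric s y,
            metric s y \in unitmx &
            forall a i j, torsion s y a i j = - torsion s y a j i]].

Definition jacobian (R : realType) (n : nat) (F : 'rV[R]_n -> 'rV[R]_n)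
    (x : 'rV[R]_n) : 'M[R]_n :=
  \matrix_(a, i) partial i (fun y => F y 0 a) x.

(* At [y], the differential of [F] maps the tensors (g, T) of [s] to those
   of [s'] at [F y]: g = F^* g' and F_* (T(u, v)) = T'(F_* u, F_* v). *)
Definition transports (R : realType) (n : nat) (F : 'rV[R]_n -> 'rV[R]_n)
    (y : 'rV[R]_n) (s s' : structure R n) : Prop :=
  let J := jacobian F y in
  metric s y = J^T *m metric s' (F y) *m J /\
  forall a i j : 'I_n,
    \sum_(c < n) J a c * torsion s y c i j =
    \sum_(b < n) \sum_(d < n) torsion s' (F y) a b d * J b i * J d j.

(** * Jets *)

Definition multi_index (n m : nat) : finType :=
  {a : {ffun 'I_n -> 'I_m.+1} | (\sum_i a i <= m)%N}.

Definition mi_val (n m : nat) (a : multi_index n m) : 'I_n -> nat :=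
  fun i => val a i.

(* Staggering: order of the jet of g contained in the k-jet of (g, T). *)
Definition metric_order (k : nat) : nat := if k is 0 then 0 else k.+1.

(* Coordinates on the space of k-jets: base point, derivatives of the
   g_ij, derivatives of the T^a_ij. The coordinates are redundant, jets
   lie in the linear subspace given by g_ij = g_ji and T^a_ij = - T^a_ji. *)
Definition jet_index (n k : nat) : finType :=
  ('I_n + (multi_index n (metric_order k) * ('I_n * 'I_n) +
           multi_index n k * ('I_n * 'I_n * 'I_n)))%type.

Notation jet R n k := 'rV[R]_#|jet_index n k|.

Definition jet_at (R : realType) (n k : nat) (x : 'rV[R]_n)
    (s : structure R n) : jet R n k :=
  \row_u match enum_val u with
         | inl i => x 0 i
         | inr (inl (a, (i, j))) =>
             mpartial (mi_val a) (fun y => metric s y i j) x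
         | inr (inr (a, (b, i, j))) =>
             mpartial (mi_val a) (fun y => torsion s y b i j) x
         end.

(* The space of k-jets over the domain of a chart. *)
Definition jet_space (R : realType) (n : nat) (M : topologicalType)
    (c : chart R n M) (k : nat) : set (jet R n k) :=
  [set theta | exists x s,
    [/\ (coord c @` dom c) x, metric_connection_near x s &
        theta = jet_at k x s]].
Arguments jet_space {R n M} c k _.

(* In the charts [c] and [c'], the local diffeomorphism [f], defined near [p],
   maps the jet [theta] at [p] to the jet [theta'] at [f p]. *)
Definition acts (R : realType) (n k : nat) (M : manifold R n)
    (c c' : chart R n M) (f : M -> M) (p : M) (theta theta' : jet R n k) :
    Prop :=
  [/\ (exists2 W, local_diffeo W f & W p), dom c p, dom c' (f p) &
      exists s s' : structure R n,
      [/\ metric_connection_near (coord c p) s,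
          metric_connection_near (coord c' (f p)) s',
          (\forall y \near coord c p, transports (read c c' f) y s s'),
          theta = jet_at k (coord c p) s &
          theta' = jet_at k (coord c' (f p)) s']].

(** * Codimension of the orbits *)

Definition jet_space_tangent (R : realType) (n k : nat) (M : topologicalType)
    (c : chart R n M) (theta : jet R n k) : set (jet R n k) :=
  [set v | exists gamma : R -> jet R n k,
    [/\ gamma 0 = theta,
        (\forall t \near (0 : R), jet_space c k (gamma t)) &
        is_derive (0 : R) (1 : R) gamma v]].

(* Tangent space at [theta] of its orbit under the local diffeomorphisms: the
   image of the differential at the identity of the orbit map, i.e. the
   velocities at t = 0 of the curves f_t . theta, where f_0 = id and
   the jets of f_t at the base point of [theta] depend differentiably on t
   at t = 0. *)
Definition orbit_tangent (R : realType) (n k : nat) (M : manifold R n)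
    (c : chart R n M) (theta : jet R n k) : set (jet R n k) :=
  [set v | exists (p : M) (f : R -> M -> M) (gamma : R -> jet R n k),
    [/\ f 0 = id /\ gamma 0 = theta,
        (\forall t \near (0 : R), acts c c (f t) p theta (gamma t)),
        (forall (a : 'I_n -> nat) (j : 'I_n),
          derivable
            (fun t : R =>
               mpartial a (fun y => read c c (f t) y 0 j) (coord c p) : R)
            0 1) &
        is_derive (0 : R) (1 : R) gamma v]].

Definition orbit_codim (R : realType) (n k : nat) (M : manifold R n)
    (c : chart R n M) (theta : jet R n k) (s : nat) : Prop :=
  exists E O : {vspace jet R n k},
  [/\ (forall v, jet_space_tangent c theta v <-> v \in E),
      (forall v, orbit_tangent c theta v <-> v \in O),
      (O <= E)%VS &
      \dim E = (\dim O + s)%N].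

(* The orbits through an open dense subset of the space of k-jets have
   codimension [s]; this can be checked over each chart domain. *)
Definition generic_orbit_codim (R : realType) (n : nat) (M : manifold R n)
    (k s : nat) : Prop :=
  forall c, atlas M c ->
  exists Omega : set (jet R n k),
  [/\ open Omega,
      jet_space c k `<=` closure (jet_space c k `&` Omega) &
      forall theta, (jet_space c k `&` Omega) theta ->
        orbit_codim c theta s].

(* h_k = s_k - s_(k-1), with s_(-1) = 0. *)
Definition pure_order (s : nat -> nat) (k : nat) : int :=
  (s k)%:Z - (if k is j.+1 then (s j)%:Z else 0).

(* Main.v *)
(* A vector field X moves the k-jet of (g, T) at x with velocity
   (X(x), - jets of the Lie derivatives of g and T), which only involves the jet
   of X of order N = metric_order k + 1; pushing forward along id + t X shows that
   all these velocities are tangent to the orbit. Where no nonzero element of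
   gl(n) annihilates the values of both g and T, this linear map of jets of X is
   injective: X(x) is part of the velocity, the first derivatives of X vanish by
   assumption, and higher derivatives by the Killing argument, since
   partial_w X_i is symmetric in the letters of w and antisymmetric in i and the
   last letter. This freeness condition is the nonvanishing of a Gram
   determinant, hence open; it holds for the Euclidean metric with a suitable
   torsion, hence, along the pencil joining any structure to that one, for
   arbitrarily close structures. So the generic codimension s_k is the dimension
   of the space of k-jets minus n * 'C(n + N, N). *)

From HB Require Import structures.
From mathcomp Require Import all_boot all_order all_algebra.
From mathcomp Require Import all_classical all_reals all_analysis.
From mathcomp Require Import ring lra.
Require Import Defs.
Import Order.TTheory GRing.Theory Num.Theory.
Import numFieldNormedType.Exports.
Set Implicit Arguments.
Unset Strict Implicit.
Unset Printing Implicit Defensive.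
Local Open Scope classical_set_scope.
Local Open Scope ring_scope.

(** * Differential calculus in coordinates *)

(** Orbit tangent vectors are velocities of curves of genuine local diffeomorphisms acting on germs
    of structures, so both inclusions between them and the Lie velocities cost analysis. From curves
    to Lie velocities, the transport identities are differentiated at t = 0; the representatives of
    the jets may change with t, hence a calculus ([jderiv]) that tracks only jets of finite order,
    at a base point that may move. Conversely, id + t X must be inverted near x, with open image and
    smooth inverse: hence an inverse function theorem, after which the image structure is an
    explicit pushforward. Its jet at the moving point is shown to be differentiable in t without
    computing the derivative ([jderivable]); the velocity is then forced by the differentiated
    transport identities. Only a jet of X matters, so X may be polynomial: both tangent spaces
    become injective linear images of coordinate spaces, and the codimension is a difference of two
    cardinalities. *)

Lemma continuous_bigsum (R : realType) (T : topologicalType) (I : Type)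
    (r : seq I) (F : I -> T -> R) (x : T) :
  (forall i, {for x, continuous (F i)}) ->
  {for x, continuous (fun y => \sum_(i <- r) F i y)}.
Proof.
move=> Fc; elim: r => [|i r IH].
  have -> : (fun y => \sum_(i <- [::]) F i y) = cst 0.
    by apply/funext => y; rewrite big_nil.
  exact: cst_continuous.
have -> : (fun y => \sum_(j <- i :: r) F j y) =
          (fun y => F i y + \sum_(j <- r) F j y).
  by apply/funext => y; rewrite big_cons.
by apply: continuousD; [exact: Fc|exact: IH].
Qed.

Lemma differentiable_of_linear (K : realType) (V W : normedModType K)
    (f : V -> W) (L : {linear V -> W}) (x : V) :
  continuous L ->
  (forall e : K, 0 < e ->
     \forall v \near (0 : V), `|f (v + x) - f x - L v| <= e * `|v|) ->
  differentiable f x.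
Proof.
move=> cL H.
have key : f \o shift x = cst (f x) + L +o_ (0 : V) id.
  apply/eqaddoP => e e0; apply: filterS (H e e0) => v /=.
  by rewrite !fctE opprD addrA.
apply/diff_locallyP.
have -> : 'd f x = L :> (_ -> _) by apply: diff_unique.
by split.
Qed.

Section Calculus.
Variables (R : realType) (n : nat).
Implicit Types (f g : 'rV[R]_n -> R) (x y z u v : 'rV[R]_n).

Lemma rV_coord_le u i : `|u 0 i| <= `|u|.
Proof.
rewrite [leRHS]/Num.Def.normr /= mx_normrE.
by apply: le_trans (le_bigmax _ _ (ord0, i)) => //=.
Qed.

Lemma rV_norm_le u (c : R) : 0 <= c -> (forall i, `|u 0 i| <= c) -> `|u| <= c.
Proof.
move=> c0 uc; rewrite [leLHS]/Num.Def.normr /= mx_normrE.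
by apply: bigmax_le => // -[i j] _ /=; rewrite ord1.
Qed.

Lemma MVT_le (g dg : R -> R) (a b c : R) :
  (forall s, s \in `[Num.min a b, Num.max a b] ->
     is_derive s 1 g (dg s) /\ `|dg s| <= c) ->
  `|g b - g a| <= c * `|b - a|.
Proof.
wlog ab : a b / a <= b => [hw|].
  case/orP: (le_total a b) => ab; first exact: hw.
  by rewrite distrC (distrC b) minC maxC; apply: hw.
rewrite (min_l ab) (max_r ab) => H.
have [||t tab ->] := @MVT_segment R g dg a b ab.
- by move=> s /subset_itv_oo_cc /H [].
- apply: derivable_within_continuous => s sab.
  by have [[]] := H s sab.
- by rewrite normrM ler_wpM2r //; case: (H t tab).
Qed.

(** One coordinate is changed at a time: [p k] has its first k coordinates from z and the others
    from y. The norm is the sup norm, so these intermediate points and the segments joining them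
    stay in the ball, and each of the n steps is a one-variable mean value estimate. *)
Lemma lipschitz_ball f x r (c : R) y z : 0 <= c ->
  (forall w, ball x r w -> forall i,
     derivable f w (delta_mx 0 i) /\ `|partial i f w| <= c) ->
  ball x r y -> ball x r z -> `|f z - f y| <= n%:R * c * `|z - y|.
Proof.
move=> c0 H [r0 xy] [_ xz].
pose p k : 'rV[R]_n := \row_j (if (j < k)%N then z 0 j else y 0 j).
have pn : p n = z by apply/rowP => j; rewrite mxE ltn_ord.
have p0 : p 0%N = y by apply/rowP => j; rewrite mxE.
suff Hk k : (k <= n)%N -> `|f (p k) - f y| <= k%:R * c * `|z - y|.
  by rewrite -{1}pn; exact: Hk.
elim: k => [|k IH] kn; first by rewrite p0 subrr normr0 !mul0r.
rewrite -(subrKA (f (p k))) (le_trans (ler_normD _ _)) //.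
rewrite -natr1 mulrDl mul1r mulrDl addrC lerD ?IH ?(ltnW kn) //.
pose i := Ordinal kn.
pose q s : 'rV[R]_n := \row_j (if j == i then s else p k 0 j).
have qz : q (z 0 i) = p k.+1.
  apply/rowP => j; rewrite !mxE ltnS [(j <= k)%N]leq_eqVlt -val_eqE /=.
  by case: eqP => //= jk; congr (z 0 _); apply: val_inj.
have qy : q (y 0 i) = p k.
  apply/rowP => j; rewrite !mxE -val_eqE /=; case: eqP => // jk.
  by rewrite jk ltnn; congr (y 0 _); apply: val_inj.
have qh s h : q (h + s) = h *: delta_mx 0 i + q s.
  apply/rowP => j; rewrite !mxE eqxx /=; case: eqP => _.
    by rewrite mulr1.
  by rewrite mulr0 add0r.
rewrite -qz -qy.
apply: (@le_trans _ _ (c * `|z 0 i - y 0 i|)); last first.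
  by rewrite ler_wpM2l //; have := rV_coord_le (z - y) i; rewrite !mxE.
apply: (@MVT_le (f \o q) (fun s => partial i f (q s))) => s.
rewrite in_itv /= => /andP[s1 s2].
have bq : ball x r (q s).
  split=> // a b; rewrite ord1 mxE; case: eqP => [->|_]; last first.
    by rewrite mxE; case: ifP => _; [exact: xz|exact: xy].
  have := xy 0 i; have := xz 0 i; rewrite /ball /= => h1 h2.
  move: s1 s2; rewrite ge_min le_max => s1 s2.
  move: h1 h2; rewrite !ltr_norml => /andP[h1 h2] /andP[h3 h4].
  by apply/andP; case/orP: s1; case/orP: s2; lra.
have [df dc] := H _ bq i; split; last exact: dc.
have e : (fun h => h^-1 *: ((f \o q) (h *: (1 : R) + s) - (f \o q) s)) =
         (fun h => h^-1 *: (f (h *: delta_mx 0 i + q s) - f (q s))).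
  by apply/funext => h /=; rewrite qh [h *: 1]mulr1.
by split; rewrite /derivable /derive e.
Qed.

Lemma lin_coord_is_derive (a : 'I_n -> R) x i :
  is_derive x (delta_mx 0 i) (fun y : 'rV[R]_n => \sum_j y 0 j * a j) (a i).
Proof.
have e : (fun h => h^-1 *: ((\sum_j (h *: delta_mx 0 i + x : 'rV[R]_n) 0 j * a j) - \sum_j x 0 j * a j))
   @ 0^' --> a i.
  apply: cvg_near_cst; near=> h.
  rewrite -sumrB (bigD1 i) //= big1 ?addr0.
    rewrite !mxE !eqxx mulr1 mulrDl addrK.
    by rewrite [_ *: _]mulrA mulVf ?mul1r //; near: h; exact: nbhs_dnbhs_neq.
  move=> j ji; rewrite !mxE eqxx (negbTE ji) /= mulr0 add0r.
  by rewrite subrr.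
split; first by apply/cvg_ex; exists (a i).
by rewrite /derive; apply/cvg_lim.
Unshelve. all: by end_near.
Qed.

Lemma coord_is_derive x i j :
  is_derive x (delta_mx 0 i) (fun y : 'rV[R]_n => y 0 j) (j == i)%:R.
Proof.
have := @lin_coord_is_derive (fun k => (j == k)%:R) x i.
congr (is_derive _ _ _ _); apply/funext => y.
by rewrite (bigD1 j) //= eqxx mulr1 big1 ?addr0 // => k kj;
   rewrite eq_sym (negbTE kj) mulr0.
Qed.

(** The candidate differential L is the linear form given by the partial derivatives at x. The
    partial derivatives of f - L are small near x, so the coordinatewise Lipschitz estimate makes f
    - L vary by at most e times the displacement. *)
Lemma C1_differentiable f x :
  (\forall y \near x, forall i, derivable f y (delta_mx 0 i)) ->
  (forall i, {for x, continuous (partial i f)}) -> differentiable f x.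
Proof.
move=> fd fc.
pose L (v : 'rV[R]_n) := \sum_j v 0 j * partial j f x.
have lL : linear L.
  move=> a u v; rewrite /L scaler_sumr -big_split; apply: eq_bigr => j _ /=.
  by rewrite !mxE mulrDl -mulrA.
pose LM := GRing.isLinear.Build _ _ _ _ L lL.
pose LL : {linear 'rV[R]_n -> R^o} := HB.pack L LM.
have cL : continuous LL.
  move=> v; rewrite /LL /= /L.
  apply: continuous_bigsum => j; 
  have cj := @matrix_normedtype.coord_continuous R 1 n 0 j v; exact: (cvgMr_tmp cj).
apply: (@differentiable_of_linear _ _ _ f LL) => // _/posnumP[e].
  (* The Lipschitz estimate loses a factor n; n + 1 is used to keep the denominator positive. *)
  pose c := e%:num / (n%:R + 1).
  have n1 : 0 < n%:R + 1 :> R by rewrite ltr_wpDl.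
  have c0 : 0 < c by rewrite divr_gt0.
  have [d d0 dx] : exists2 d, 0 < d & forall w, ball x d w -> forall i,
      derivable f w (delta_mx 0 i) /\ `|partial i f w - partial i f x| <= c.
    have : \forall w \near x, forall i,
      derivable f w (delta_mx 0 i) /\ `|partial i f w - partial i f x| <= c.
      near=> w => i; split.
        by move: i; near: w.
      rewrite distrC.
      move: i; near: w; apply: filter_forall => i.
      by have /cvgrPdist_le /(_ _ c0) := fc i.
    by move=> /nbhs_ballP[d /= d0 H]; exists d.
  apply/nbhs_ballP; exists d => // v.
  rewrite -ball_normE /= sub0r normrN => vd.
  have bx : ball x d x by exact: ballxx.
  have bv : ball x d (v + x).
    by rewrite -ball_normE /= opprD addrA addrAC subrr add0r normrN.
  have LD : L (v + x) = L v + L x by have := linearD LL v x.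
  have := @lipschitz_ball (fun w => f w - L w) x d c x (v + x) (ltW c0) _ bx bv.
  have -> : f (v + x) - L (v + x) - (f x - L x) = f (v + x) - f x - LL v.
    by rewrite LD -[LL v]/(L v); ring.
  move=> /(_ _) /le_trans; apply.
    move=> w /dx Hw i; have [w1 w2] := Hw i.
    have L1 := @lin_coord_is_derive (fun j => partial j f x) w i.
    have dL : derivable L w (delta_mx 0 i) by case: L1.
    split; first exact: derivableB.
    by rewrite /partial deriveB // (@derive_val _ _ _ _ _ _ _ L1).
  rewrite addrK ler_wpM2r // /c mulrA ler_pdivrMr // mulrC ler_wpM2l //.
  by rewrite lerDl.
Unshelve. all: by end_near.
Qed.

Lemma diff_partial f x v : differentiable f x ->
  'd f x v = \sum_i v 0 i * partial i f x.
Proof.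
move=> df; rewrite {1}(row_sum_delta v) linear_sum; apply: eq_bigr => i _.
by rewrite linearZ /= /partial deriveE.
Qed.

End Calculus.

(** * Algebra of functions of class C^m on open sets *)

Section Smooth.
Variables (R : realType) (n : nat).
Implicit Types (f g : 'rV[R]_n -> R) (x y z u v : 'rV[R]_n) (U : set 'rV[R]_n).

Lemma open_near U x : open U -> U x -> \forall y \near x, U y.
Proof. by move=> oU Ux; apply: open_nbhs_nbhs; split. Qed.

Lemma near_eq_continuous f g x : {near x, f =1 g} ->
  {for x, continuous f} -> {for x, continuous g}.
Proof.
move=> fg; rewrite /prop_for /continuous_at -(nbhs_singleton fg) => fc.
exact: cvg_trans (near_eq_cvg fg) fc.
Qed.

Lemma partial_near f g x i : {near x, f =1 g} -> partial i f x = partial i g x.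
Proof. exact: near_eq_derive. Qed.

Lemma partialD f g x i : derivable f x (delta_mx 0 i) ->
  derivable g x (delta_mx 0 i) ->
  partial i (fun y => f y + g y) x = partial i f x + partial i g x.
Proof. exact: deriveD. Qed.

Lemma partialM f g x i : derivable f x (delta_mx 0 i) ->
  derivable g x (delta_mx 0 i) ->
  partial i (fun y => f y * g y) x = partial i f x * g x + f x * partial i g x.
Proof.
move=> df dg; rewrite /partial (deriveM df dg) addrC.
by congr (_ + _); rewrite [LHS]mulrC.
Qed.

Lemma Cm_on_cont m U f x : Cm_on m U f -> U x -> {for x, continuous f}.
Proof. by case: m => [|m] [fc _]; exact: fc. Qed.

Lemma Cm_on_derivable m U f x i :
  Cm_on m.+1 U f -> U x -> derivable f x (delta_mx 0 i).
Proof. by move=> [_ /(_ i)[fd _]]; exact: fd. Qed.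

Lemma Cm_on_partial m U f i : Cm_on m.+1 U f -> Cm_on m U (partial i f).
Proof. by move=> [_ /(_ i)[]]. Qed.

Lemma Cm_onW m U f : Cm_on m.+1 U f -> Cm_on m U f.
Proof.
elim: m f => [|m IH] f [fc fd]; first by split.
split=> // i; have [fdi fi] := fd i; split=> //; exact: IH.
Qed.

Lemma Cm_on_sub m U V f : U `<=` V -> Cm_on m V f -> Cm_on m U f.
Proof.
elim: m f => [|m IH] f UV [fc fd]; split; try by move=> x /UV; exact: fc.
  by [].
move=> i; have [fdi fi] := fd i; split; last exact: IH.
by move=> x /UV; exact: fdi.
Qed.

Lemma Cm_on_ext m U f g : open U -> {in U, f =1 g} ->
  Cm_on m U f -> Cm_on m U g.
Proof.
move=> oU; elim: m f g => [|m IH] f g fg [fc fd].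
  split=> // x Ux; apply: near_eq_continuous (fc _ Ux).
  by apply: filterS (open_near oU Ux) => y Uy; apply: fg; rewrite inE.
have nfg x : U x -> {near x, f =1 g}.
  by move=> Ux; apply: filterS (open_near oU Ux) => y Uy; apply: fg; rewrite inE.
split=> [x Ux|i]; first exact: near_eq_continuous (nfg _ Ux) (fc _ Ux).
have [fdi fi] := fd i; split=> [x Ux|].
  exact: near_eq_derivable (nfg _ Ux) (fdi _ Ux).
apply: IH fi => x; rewrite inE => Ux; exact: partial_near (nfg _ Ux).
Qed.

Lemma Cm_on_cst m U c : Cm_on m U (cst c).
Proof.
elim: m c => [|m IH] c; (split; first by move=> x _; exact: cst_continuous) => // i.
split; first by move=> x _; exact: derivable_cst.
have -> : partial i (cst c) = cst 0.
  by apply/funext => x; rewrite /partial derive_cst.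
exact: IH.
Qed.

Lemma Cm_onD m U f g : open U -> Cm_on m U f -> Cm_on m U g ->
  Cm_on m U (fun y => f y + g y).
Proof.
move=> oU; elim: m f g => [|m IH] f g Cf Cg;
  (split; first by move=> x Ux;
     exact: (continuousD (Cm_on_cont Cf Ux) (Cm_on_cont Cg Ux))) => // i.
split=> [x Ux|].
  exact: (derivableD (Cm_on_derivable Cf Ux) (Cm_on_derivable Cg Ux)).
apply: (Cm_on_ext oU _ (IH _ _ (Cm_on_partial i Cf) (Cm_on_partial i Cg))) => x.
rewrite inE => Ux; symmetry.
exact: (partialD (Cm_on_derivable Cf Ux) (Cm_on_derivable Cg Ux)).
Qed.

Lemma Cm_onM m U f g : open U -> Cm_on m U f -> Cm_on m U g ->
  Cm_on m U (fun y => f y * g y).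
Proof.
move=> oU; elim: m f g => [|m IH] f g Cf Cg;
  (split; first by move=> x Ux;
     exact: (cvgM (Cm_on_cont Cf Ux) (Cm_on_cont Cg Ux))) => // i.
split=> [x Ux|].
  exact: (derivableM (Cm_on_derivable Cf Ux) (Cm_on_derivable Cg Ux)).
have := Cm_onD oU (IH _ _ (Cm_on_partial i Cf) (Cm_onW Cg))
                  (IH _ _ (Cm_onW Cf) (Cm_on_partial i Cg)).
apply: Cm_on_ext => // x.
rewrite inE => Ux; symmetry.
exact: (partialM (Cm_on_derivable Cf Ux) (Cm_on_derivable Cg Ux)).
Qed.

Lemma Cm_onV m U f : open U -> (forall y, U y -> f y != 0) -> Cm_on m U f ->
  Cm_on m U (fun y => (f y)^-1).
Proof.
move=> oU f0; elim: m => [|m IH] Cf;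
  (split; first by move=> x Ux;
     exact: (cvgV (f0 x Ux) (Cm_on_cont Cf Ux))) => // i.
split=> [x Ux|].
  exact: (derivableV (f0 x Ux) (Cm_on_derivable Cf Ux)).
have CV := IH (Cm_onW Cf).
have := Cm_onM oU (Cm_on_cst m U (-1)) (Cm_onM oU (Cm_on_partial i Cf) (Cm_onM oU CV CV)).
apply: Cm_on_ext => // x; rewrite inE => Ux.
rewrite /partial (deriveV (f0 x Ux) (Cm_on_derivable Cf Ux)).
by rewrite /cst mulN1r expr2 invfM scaleNr; congr (- _); rewrite mulrC.
Qed.

Lemma Cm_on_sum m U (I : Type) (r : seq I) (P : pred I)
    (F : I -> 'rV[R]_n -> R) : open U ->
  (forall i, Cm_on m U (F i)) -> Cm_on m U (fun y => \sum_(i <- r | P i) F i y).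
Proof.
move=> oU CF; elim: r => [|i r IH].
  by under eq_fun do rewrite big_nil; exact: Cm_on_cst.
have [Pi|Pi] := boolP (P i).
  under eq_fun do rewrite big_cons Pi.
  exact: Cm_onD.
by under eq_fun do rewrite big_cons (negbTE Pi).
Qed.

Lemma Cm_on_coord m U j : Cm_on m U (fun y => y 0 j).
Proof.
have cc x : {for x, continuous (fun y : 'rV[R]_n => y 0 j)}.
  exact: matrix_normedtype.coord_continuous.
case: m => [|m]; (split; first by move=> x _; exact: cc) => // i.
split; first by move=> x _; have [] := coord_is_derive x i j.
have -> : partial i (fun y : 'rV[R]_n => y 0 j) = cst (j == i)%:R.
  apply/funext => x; exact: (@derive_val _ _ _ _ _ _ _ (coord_is_derive x i j)).
exact: Cm_on_cst.
Qed.

Lemma Cm_on_differentiable m U f x : open U -> Cm_on m.+1 U f -> U x ->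
  differentiable f x.
Proof.
move=> oU Cf Ux; apply: C1_differentiable => [|i].
  by apply: filterS (open_near oU Ux) => y Uy i; exact: (Cm_on_derivable Cf Uy).
exact: (Cm_on_cont (Cm_on_partial i Cf)).
Qed.

End Smooth.

(** * The chain rule *)

Section Composition.
Variables (R : realType) (n : nat).
Implicit Types (f : 'rV[R]_n -> R) (F : 'rV[R]_n -> 'rV[R]_n) (x y : 'rV[R]_n).

(** F is only assumed derivable along v. On the line x + h v it becomes a function g of one
    variable, for which derivable and differentiable coincide, and the chain rule for differentials
    applies to f o g. *)
Lemma is_derive_comp_diff (K : realType) (V W : normedModType K)
    (f : V -> W) (F : V -> V) (x v : V) :
  differentiable f (F x) -> derivable F x v ->
  is_derive x v (f \o F) ('d f (F x) ('D_v F x)).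
Proof.
move=> df dF.
pose g (h : K) := F (h *: v + x).
have g0 : g 0 = F x by rewrite /g scale0r add0r.
have dg : differentiable g 0 by apply/derivable1_diffP; move/derivable1P: dF.
have dfg : differentiable (f \o g) 0.
  by apply: differentiable_comp => //; rewrite g0.
have Dg : 'D_1 g 0 = 'D_v F x.
  rewrite /derive; have -> // : (fun h : K => h^-1 *: (g (h *: 1 + 0) - g 0)) =
      (fun h => h^-1 *: (F (h *: v + x) - F x)).
  by apply/funext => h; rewrite /g addr0 scale0r add0r [h *: 1]mulr1.
have E : (fun h => h^-1 *: ((f \o F) (h *: v + x) - (f \o F) x)) =
         (fun h : K => h^-1 *: ((f \o g) (h *: 1 + 0) - (f \o g) 0)).
  by apply/funext => h; rewrite /= /g addr0 scale0r add0r [h *: 1]mulr1.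
have dd : derivable (f \o g) 0 1 by exact/derivable1_diffP.
split; first by rewrite /derivable E.
have -> : 'D_v (f \o F) x = 'D_1 (f \o g) 0 by rewrite /derive E.
rewrite deriveE // diff_comp //; last by rewrite g0.
by rewrite /= g0 -Dg deriveE.
Qed.

Lemma derivable_coords F x v :
  (forall l, derivable (fun y => F y 0 l) x v) -> derivable F x v.
Proof. by move=> dF; apply/derivable_mxP => i j; rewrite ord1; exact: dF. Qed.

Lemma is_partial_comp f F x i : differentiable f (F x) ->
  (forall l, derivable (fun y => F y 0 l) x (delta_mx 0 i)) ->
  is_derive x (delta_mx 0 i) (fun y => f (F y))
    (\sum_l partial l f (F x) * partial i (fun y => F y 0 l) x).
Proof.
move=> df dF; have dF' := derivable_coords dF.
have := is_derive_comp_diff df dF'.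
rewrite diff_partial // derive_mx //.
by under eq_bigr do rewrite mxE mulrC.
Qed.

Lemma continuous_coords F x :
  (forall l, {for x, continuous (fun y => F y 0 l)}) -> {for x, continuous F}.
Proof.
move=> cF; rewrite /prop_for /continuous_at; apply/(@cvgrPdist_le R _ _ (nbhs x) (nbhs_filter x) F (F x)) => e e0; near=> y.
apply: rV_norm_le; first exact: ltW.
move=> l; rewrite !mxE; move: l; near: y; apply: filter_forall => l.
by have /cvgrPdist_le /(_ _ e0) := cF l.
Unshelve. all: by end_near.
Qed.

Lemma Cm_on_comp m (U V : set 'rV[R]_n) f F : open U -> open V ->
  (forall y, U y -> V (F y)) -> Cm_on m V f ->
  (forall l, Cm_on m U (fun y => F y 0 l)) -> Cm_on m U (fun y => f (F y)).
Proof.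
move=> oU oV UV; move=> Cf CF; have cc k g x : Cm_on k V g -> (forall l, Cm_on k U (fun y => F y 0 l)) ->
    U x -> {for x, continuous (fun y => g (F y))}.
  move=> Cg CF' Ux; apply: continuous_comp; last exact: (Cm_on_cont Cg (UV _ Ux)).
  by apply: continuous_coords => l; exact: (Cm_on_cont (CF' l)).
move: Cf CF; elim: m f => [|m IH] f Cf CF; (split; first by move=> x Ux; exact: (cc _ _ _ Cf CF Ux)) => // i.
have H x : U x -> is_derive x (delta_mx 0 i) (fun y => f (F y))
    (\sum_l partial l f (F x) * partial i (fun y => F y 0 l) x).
  move=> Ux; apply: is_partial_comp.
    exact: (Cm_on_differentiable oV Cf (UV _ Ux)).
  by move=> l; exact: (Cm_on_derivable (CF l) Ux).
split=> [x Ux|]; first by have [] := H x Ux.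
have : Cm_on m U (fun x => \sum_l partial l f (F x) * partial i (fun y => F y 0 l) x).
  apply: Cm_on_sum => // l; apply: Cm_onM => //.
    by apply: IH => [|k]; [exact: Cm_on_partial|exact/Cm_onW/CF].
  exact: Cm_on_partial.
apply: Cm_on_ext => // x; rewrite inE => Ux.
by rewrite /partial (@derive_val _ _ _ _ _ _ _ (H x Ux)).
Qed.

End Composition.

(** * Symmetry of second derivatives *)

Section Schwarz.
Variables (R : realType) (n : nat).
Implicit Types (f g : 'rV[R]_n -> R) (x y z u v : 'rV[R]_n) (U : set 'rV[R]_n).

Lemma MVT_line f q v (h : R) : 0 <= h ->
  (forall s, 0 <= s <= h -> derivable f (q + s *: v) v) ->
  exists2 s, 0 <= s <= h & f (q + h *: v) - f q = 'D_v f (q + s *: v) * h.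
Proof.
move=> h0 fd.
have e s : (fun k : R => k^-1 *: (f (q + (k *: (1 : R) + s) *: v) - f (q + s *: v))) =
           (fun k : R => k^-1 *: (f (k *: v + (q + s *: v)) - f (q + s *: v))).
  apply/funext => k; congr (_ *: (f _ - _)).
  by rewrite [k *: 1]mulr1 scalerDl addrCA.
have H s : 0 <= s <= h ->
    is_derive s 1 (fun s => f (q + s *: v)) ('D_v f (q + s *: v)).
  by move=> /fd d; split; rewrite /derivable /derive e.
have [||s sab E] := @MVT_segment R (fun s => f (q + s *: v))
   (fun s => 'D_v f (q + s *: v)) 0 h h0.
- move=> s; by rewrite in_itv /= => /andP[s0 sh]; apply: H; rewrite !ltW.
- apply: derivable_within_continuous => s; rewrite in_itv /= => sab.
  by have [] := H s sab.
- exists s; first by move: sab; rewrite in_itv.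
  by move: E; rewrite scale0r addr0 subr0.
Qed.

(** Two mean value theorems: along e_i for y |-> f(y + h e_j) - f(y), then along e_j for the i-th
    partial derivative. The resulting mixed derivative is evaluated within distance 2h of x, where
    continuity makes it e-close to its value at x. *)
Lemma second_difference U f x (i j : 'I_n) : open U -> Cm_on 2 U f -> U x ->
  forall e : R, 0 < e -> \forall h \near 0^'+,
    `|f (x + h *: delta_mx 0 i + h *: delta_mx 0 j) - f (x + h *: delta_mx 0 i)
      - (f (x + h *: delta_mx 0 j) - f x)
      - partial j (partial i f) x * h ^+ 2| <= e * h ^+ 2.
Proof.
move=> oU Cf Ux e e0.
have [r r0 [rU rc]] : exists2 r, 0 < r & ball x r `<=` U /\
    forall y, ball x r y ->
      `|partial j (partial i f) y - partial j (partial i f) x| <= e.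
  have : \forall y \near x, U y /\
      `|partial j (partial i f) y - partial j (partial i f) x| <= e.
    near=> y; split; first by near: y; exact: open_near.
    rewrite distrC; near: y.
    have := Cm_on_cont (Cm_on_partial j (Cm_on_partial i Cf)) Ux.
    by move=> /cvgrPdist_le /(_ e e0).
  move=> /nbhs_ballP[r /= r0 H]; exists r => //.
  by split=> y /H [].
pose ei : 'rV[R]_n := delta_mx 0 i; pose ej : 'rV[R]_n := delta_mx 0 j.
have n1 k : `|delta_mx 0 k : 'rV[R]_n| <= 1.
  apply: rV_norm_le => // l; rewrite mxE eqxx /=.
  by case: (l == k); rewrite ?normr1 ?normr0.
near=> h.
have h0 : 0 < h by near: h; exact: nbhs_right_gt.
have hr : h + h < r.
  have : h < r / 2 by near: h; apply: nbhs_right_lt; rewrite divr_gt0.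
  lra.
have inb (s t : R) : 0 <= s <= h -> 0 <= t <= h -> ball x r (x + s *: ei + t *: ej).
  move=> /andP[s0 sh] /andP[u0 uh]; rewrite -ball_normE /= -addrA opprD addNKr normrN.
  apply: le_lt_trans hr; apply: le_trans (ler_normD _ _) _.
  rewrite !normrZ !ger0_norm //; apply: lerD.
    by apply: le_trans sh; rewrite ler_piMr // n1.
  by apply: le_trans uh; rewrite ler_piMr // n1.
have h00 : 0 <= (0 : R) <= h by rewrite lexx ltW.
have hh : 0 <= h <= h by rewrite lexx ltW.
pose g y := f (y + h *: ej) - f y.
have dg s : 0 <= s <= h -> is_derive (x + s *: ei) ei g
   (partial i f (x + s *: ei + h *: ej) - partial i f (x + s *: ei)).
  move=> sh; have b1 := rU _ (inb _ _ sh hh); have b0 := rU _ (inb _ _ sh h00).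
  rewrite scale0r addr0 in b0.
  have d1 := Cm_on_derivable (i := i) Cf b1.
  have d0 := Cm_on_derivable (i := i) Cf b0.
  have e1 : (fun k : R => k^-1 *: (f (k *: ei + (x + s *: ei) + h *: ej) - f (x + s *: ei + h *: ej)))
    = (fun k : R => k^-1 *: (f (k *: ei + (x + s *: ei + h *: ej)) - f (x + s *: ei + h *: ej))).
    by apply/funext => k; rewrite -/ei -/ej !addrA.
  have D1 : is_derive (x + s *: ei) ei (fun y => f (y + h *: ej))
      (partial i f (x + s *: ei + h *: ej)).
    split; first by rewrite /derivable e1; exact: d1.
    by rewrite /partial /derive e1.
  have D0 : is_derive (x + s *: ei) ei f (partial i f (x + s *: ei)).
    exact: derivableP.
  exact: is_deriveB.
have [s sh] := @MVT_line g x ei h (ltW h0) (fun s sh => @ex_derive _ _ _ _ _ _ _ (dg s sh)).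
rewrite (@derive_val _ _ _ _ _ _ _ (dg s sh)) /g => ->.
have [|u uh ->] := @MVT_line (partial i f) (x + s *: ei) ej h (ltW h0).
  move=> u uh; exact: (Cm_on_derivable (Cm_on_partial i Cf) (rU _ (inb _ _ sh uh))).
have := rc _ (inb _ _ sh uh).
rewrite -[X in `|X - _|]/('D_ej (partial i f) _) => H.
rewrite -mulrA -expr2 -mulrBl normrM [`|h ^+ 2|]ger0_norm ?sqr_ge0 //.
by rewrite ler_wpM2r ?sqr_ge0.
Unshelve. all: by end_near.
Qed.

(** The second difference is symmetric in i and j, so it approximates both mixed derivatives times
    h^2; dividing by h^2 leaves a gap of at most e. *)
Lemma partialC U f x i j : open U -> Cm_on 2 U f -> U x ->
  partial i (partial j f) x = partial j (partial i f) x.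
Proof.
move=> oU Cf Ux; apply/eqP; rewrite -subr_eq0 -normr_le0.
apply/ler_addgt0Pr => e e0; rewrite add0r.
have e2 : 0 < e / 2 by rewrite divr_gt0.
have S1 := second_difference i j oU Cf Ux e2.
have S2 := second_difference j i oU Cf Ux e2.
have S0 := nbhs_right_gt (0 : R).
have FI := filterI (filterI S0 S1) S2.
have [h [[h0 H1] H2]] := @filter_ex _ _ _ _ (FI _ _).
have h2 : 0 < h ^+ 2 by rewrite exprn_gt0.
rewrite -(ler_pM2r h2) -[X in _ * X <= _]gtr0_norm // -normrM.
move: H1 H2.
rewrite (addrAC x (h *: delta_mx 0 j)).
set a := f _; set b := f _; set c := f _; set d := f _.
set A := (a - b - _ - _); set B := (a - c - _ - _) => HA HB.
have -> : (partial i (partial j f) x - partial j (partial i f) x) * h ^+ 2 = A - B.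
  rewrite /A /B; move: (partial i _ x) (partial j _ x) => p q.
  clearbody a b c d; clear; ring.
have -> : e * h ^+ 2 = e / 2 * h ^+ 2 + e / 2 * h ^+ 2 by field.
exact: (le_trans (ler_normB A B) (lerD HA HB)).
Qed.

End Schwarz.

(** * Iterated partial derivatives along words of indices *)

Section Words.
Variables (R : realType) (n : nat).
Implicit Types (f g : 'rV[R]_n -> R) (x y z u v : 'rV[R]_n) (U : set 'rV[R]_n).
Implicit Types (w : seq 'I_n).

(** Words allow inductions that peel off a letter at either end, which the fixed order of [mpartial]
    does not; the symmetry of derivatives gives the way back to multi-indices. *)
Definition wpartial w f : 'rV[R]_n -> R := foldr (@partial R n) f w.

Lemma wpartial_cat w1 w2 f : wpartial (w1 ++ w2) f = wpartial w1 (wpartial w2 f).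
Proof. exact: foldr_cat. Qed.

Lemma wpartial_rcons w i f : wpartial (rcons w i) f = wpartial w (partial i f).
Proof. by rewrite -cats1 wpartial_cat. Qed.

Definition word (a : 'I_n -> nat) := flatten [seq nseq (a i) i | i <- enum 'I_n].

Lemma mpartialE a f : mpartial a f = wpartial (word a) f.
Proof.
rewrite /mpartial /word; elim: (enum 'I_n) => //= i s ->.
rewrite wpartial_cat; elim: (a i) => //= k ->; by [].
Qed.

Lemma count_word a i : count_mem i (word a) = a i.
Proof.
rewrite /word count_flatten -map_comp.
have -> : [seq (count_mem i \o (fun j => nseq (a j) j)) j | j <- enum 'I_n]
        = [seq (if j == i then a i else 0%N) | j <- enum 'I_n].
  by apply: eq_map => j /=; rewrite count_nseq /=; case: eqP => [->|]; rewrite ?mul1n.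
rewrite sumnE big_map big_enum /= (bigD1 i) //= eqxx big1 ?addn0 // => j /negbTE ->.
by [].
Qed.

Lemma size_word a : size (word a) = (\sum_i a i)%N.
Proof.
rewrite /word size_flatten /shape -map_comp sumnE big_map big_enum /=.
by apply: eq_bigr => i _; rewrite size_nseq.
Qed.

Lemma perm_word w : perm_eq w (word (fun i => count_mem i w)).
Proof. by apply/allP => i _ /=; rewrite count_word. Qed.

Definition smooth_at x f := exists U, [/\ open U, U x & smooth_on U f].

Lemma smooth_at_near x f : smooth_at x f -> \forall y \near x, smooth_at y f.
Proof.
move=> [U [oU Ux sf]]; apply: filterS (open_near oU Ux) => y Uy.
by exists U.
Qed.

Lemma smooth_at_cont x f : smooth_at x f -> {for x, continuous f}.
Proof. by move=> [U [oU Ux /(_ 0%N)]] sf; exact: (Cm_on_cont sf). Qed.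

Lemma smooth_at_derivable x f i : smooth_at x f -> derivable f x (delta_mx 0 i).
Proof. by move=> [U [oU Ux /(_ 1%N)]] sf; exact: (Cm_on_derivable sf Ux). Qed.

Lemma smooth_at_differentiable x f : smooth_at x f -> differentiable f x.
Proof. by move=> [U [oU Ux /(_ 1%N)]] sf; exact: (Cm_on_differentiable oU sf). Qed.

Lemma smooth_at_ext x f g : {near x, f =1 g} -> smooth_at x f -> smooth_at x g.
Proof.
move=> /nbhs_ballP[r /= r0 fg] [U [oU Ux sf]].
have oV : open ((ball x r)° `&` U) by apply: openI => //; exact: open_interior.
exists ((ball x r)° `&` U); split => //.
  by split=> //; exact: nbhsx_ballx.
move=> m; apply: (Cm_on_ext oV) (Cm_on_sub _ (sf m)) => [y|y []//].
by rewrite inE => -[/interior_subset/fg].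
Qed.

Lemma smooth_at_partial x f i : smooth_at x f -> smooth_at x (partial i f).
Proof.
move=> [U [oU Ux sf]]; exists U; split=> // m.
exact: (Cm_on_partial i (sf m.+1)).
Qed.

Lemma smooth_at_wpartial x f w : smooth_at x f -> smooth_at x (wpartial w f).
Proof. by move=> sf; elim: w => //= i w; exact: smooth_at_partial. Qed.

Lemma smooth_at_cst x c : smooth_at x (cst c).
Proof. by exists setT; split=> // [|m]; [exact: openT|exact: Cm_on_cst]. Qed.

Lemma smooth_at_coord x j : smooth_at x (fun y => y 0 j).
Proof. by exists setT; split=> // [|m]; [exact: openT|exact: Cm_on_coord]. Qed.

Lemma smooth_at2 (op : ('rV[R]_n -> R) -> ('rV[R]_n -> R) -> ('rV[R]_n -> R)) x f g :
  (forall m U f g, open U -> Cm_on m U f -> Cm_on m U g -> Cm_on m U (op f g)) ->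
  smooth_at x f -> smooth_at x g -> smooth_at x (op f g).
Proof.
move=> H [U [oU Ux sf]] [V [oV Vx sg]].
have oUV := openI oU oV.
exists (U `&` V); split=> // m; apply: H => //.
  by apply: Cm_on_sub (sf m) => y [].
by apply: Cm_on_sub (sg m) => y [].
Qed.

Lemma smooth_atD x f g : smooth_at x f -> smooth_at x g ->
  smooth_at x (fun y => f y + g y).
Proof. by apply: (smooth_at2 (op := fun f g y => f y + g y)) => *; exact: Cm_onD. Qed.

Lemma smooth_atM x f g : smooth_at x f -> smooth_at x g ->
  smooth_at x (fun y => f y * g y).
Proof. by apply: (smooth_at2 (op := fun f g y => f y * g y)) => *; exact: Cm_onM. Qed.

Lemma smooth_atZ x c f : smooth_at x f -> smooth_at x (fun y => c * f y).
Proof. by move=> sf; exact: (smooth_atM (smooth_at_cst x c) sf). Qed.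

Lemma smooth_atN x f : smooth_at x f -> smooth_at x (fun y => - f y).
Proof.
move=> /(smooth_atZ (-1)).
by under eq_fun do rewrite mulN1r.
Qed.

Lemma smooth_atB x f g : smooth_at x f -> smooth_at x g ->
  smooth_at x (fun y => f y - g y).
Proof. by move=> sf sg; exact: (smooth_atD sf (smooth_atN sg)). Qed.

Lemma smooth_at_sum x (I : Type) (r : seq I) (P : pred I) (F : I -> 'rV[R]_n -> R) :
  (forall i, smooth_at x (F i)) -> smooth_at x (fun y => \sum_(i <- r | P i) F i y).
Proof.
move=> sF; elim: r => [|i r IH].
  by under eq_fun do rewrite big_nil; exact: smooth_at_cst.
have [Pi|Pi] := boolP (P i).
  by under eq_fun do rewrite big_cons Pi; exact: smooth_atD.
by under eq_fun do rewrite big_cons (negbTE Pi).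
Qed.

Lemma smooth_at_prod x (I : Type) (r : seq I) (P : pred I) (F : I -> 'rV[R]_n -> R) :
  (forall i, smooth_at x (F i)) -> smooth_at x (fun y => \prod_(i <- r | P i) F i y).
Proof.
move=> sF; elim: r => [|i r IH].
  by under eq_fun do rewrite big_nil; exact: smooth_at_cst.
have [Pi|Pi] := boolP (P i).
  by under eq_fun do rewrite big_cons Pi; exact: smooth_atM.
by under eq_fun do rewrite big_cons (negbTE Pi).
Qed.

Lemma smooth_atV x f : f x != 0 -> smooth_at x f -> smooth_at x (fun y => (f y)^-1).
Proof.
move=> f0 sf; have cf := smooth_at_cont sf.
have : \forall y \near x, f y != 0 by exact: (cvgr_neq0 _ cf f0).
move: sf => [U [oU Ux sf]] /nbhs_ballP[r /= r0 fr].
have oV : open ((ball x r)° `&` U) by apply: openI => //; exact: open_interior.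
exists ((ball x r)° `&` U); split => //.
  by split=> //; exact: nbhsx_ballx.
move=> m; apply: Cm_onV => // [y [/interior_subset/fr//]|].
by apply: Cm_on_sub (sf m) => y [].
Qed.

Lemma smooth_at_comp x f (F : 'rV[R]_n -> 'rV[R]_n) : smooth_at (F x) f ->
  (forall l, smooth_at x (fun y => F y 0 l)) -> smooth_at x (fun y => f (F y)).
Proof.
move=> [V [oV VF sf]] sF.
have [U [oU Ux UF]] : exists U, [/\ open U, U x & forall l, smooth_on U (fun y => F y 0 l)].
  have /choice[U HU] := sF.
  exists ((\bigcap_(l in [set: 'I_n]) U l)°); split.
  - exact: open_interior.
  - have : \forall y \near x, forall l, U l y.
      by apply: (@filter_forall 'rV[R]_n 'I_n U (nbhs x) (nbhs_filter x)) => l; have [oU Ux _] := HU l; exact: open_near.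
    by apply: filterS => y Uy l _; exact: Uy.
  - move=> l m; have [_ _ /(_ m)] := HU l.
    by apply: Cm_on_sub => y /interior_subset; apply.
have cF y : U y -> {for y, continuous F}.
  by move=> Uy; apply: continuous_coords => l; exact: (Cm_on_cont (UF l 0%N)).
have oW : open (U `&` F @^-1` V).
  rewrite openE => y [Uy VFy]; apply: filterI; first exact: open_near.
  by apply: cF => //; exact: open_near.
exists (U `&` F @^-1` V); split=> // m.
apply: (@Cm_on_comp _ _ m _ V) => // [y []//|l].
by apply: Cm_on_sub (UF l m) => y [].
Qed.

Lemma wpartial_near w f g x : {near x, f =1 g} ->
  wpartial w f x = wpartial w g x.
Proof.
move=> fg; have {fg} : \near x, {near x, f =1 g} by exact: near_join.
move: x; elim: w => [|i w IH] x fg; first exact: nbhs_singleton (nbhs_singleton fg).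
rewrite /=; apply: partial_near; apply: filterS (near_join fg) => y; exact: IH.
Qed.

Lemma wpartialC x f i j w : smooth_at x f ->
  wpartial (i :: j :: w) f x = wpartial (j :: i :: w) f x.
Proof.
move=> /(smooth_at_wpartial w)[U [oU Ux /(_ 2%N)]] sf /=.
exact: (partialC i j oU sf Ux).
Qed.

(** The head letter i of the first word occurs in the second. By induction the tail may be replaced
    near x by the second word without that i, and i is then carried to its place by adjacent swaps,
    each an instance of Schwarz's theorem. *)
Lemma wpartial_perm x f w1 w2 : smooth_at x f -> perm_eq w1 w2 ->
  wpartial w1 f x = wpartial w2 f x.
Proof.
elim: w1 w2 x => [|i w1 IH] w2 x sf pw.
  by move: pw; rewrite perm_sym => /perm_nilP ->.
have iw2 : i \in w2 by rewrite -(perm_mem pw) mem_head.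
case/splitPr: iw2 pw => u v.
rewrite perm_sym -cat1s perm_catCA /= perm_cons perm_sym => pw.
rewrite -[LHS]/(wpartial (i :: w1) f x).
have -> : wpartial (i :: w1) f x = wpartial (i :: u ++ v) f x.
  apply: partial_near.
  by apply: filterS (smooth_at_near sf) => y sy; exact: IH.
elim: u {pw IH w1 w2} x sf => [|j u IH] x sf //.
rewrite cat_cons wpartialC //= -cat1s.
apply: partial_near; apply: filterS (smooth_at_near sf) => y sy.
exact: IH.
Qed.

Lemma wpartial_mpartial x f w : smooth_at x f ->
  wpartial w f x = mpartial (fun i => count_mem i w) f x.
Proof. by move=> sf; rewrite mpartialE; apply: wpartial_perm => //; exact: perm_word. Qed.

Lemma wpartialD x f g w : smooth_at x f -> smooth_at x g ->
  wpartial w (fun y => f y + g y) x = wpartial w f x + wpartial w g x.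
Proof.
elim: w x => //= i w IH x sf sg.
rewrite -partialD; [|exact/smooth_at_derivable/smooth_at_wpartial..].
apply: partial_near; near=> y; apply: IH; near: y; exact: smooth_at_near.
Unshelve. all: by end_near.
Qed.

Lemma wpartialZ x c f w : smooth_at x f ->
  wpartial w (fun y => c * f y) x = c * wpartial w f x.
Proof.
elim: w x => //= i w IH x sf.
rewrite -[c * _]/(c *: _) -deriveZ; last exact/smooth_at_derivable/smooth_at_wpartial.
apply: partial_near; near=> y; apply: IH; near: y; exact: smooth_at_near.
Unshelve. all: by end_near.
Qed.

Lemma wpartial0 x w : wpartial w (cst 0) x = 0.
Proof.
have -> : cst (0 : R) = (fun y : 'rV[R]_n => 0 * (cst 0) y).
  by apply/funext => y; rewrite mul0r.
by rewrite wpartialZ ?mul0r //; exact: smooth_at_cst.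
Qed.

Lemma wpartialN x f w : smooth_at x f ->
  wpartial w (fun y => - f y) x = - wpartial w f x.
Proof.
move=> sf; rewrite -mulN1r -wpartialZ //; congr (wpartial w _ x).
by apply/funext => y; rewrite mulN1r.
Qed.

Lemma wpartial_sum x w (I : Type) (r : seq I) (P : pred I) (F : I -> 'rV[R]_n -> R) :
  (forall i, smooth_at x (F i)) ->
  wpartial w (fun y => \sum_(i <- r | P i) F i y) x = \sum_(i <- r | P i) wpartial w (F i) x.
Proof.
move=> sF; elim: r => [|i r IH].
  by under eq_fun do rewrite big_nil; rewrite big_nil wpartial0.
rewrite big_cons; have [Pi|Pi] := boolP (P i).
  under eq_fun do rewrite big_cons Pi.
  by rewrite wpartialD ?IH //; exact: smooth_at_sum.
by under eq_fun do rewrite big_cons (negbTE Pi).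
Qed.

End Words.

(** * Polynomials with prescribed jets *)

Section Realization.
Variables (R : realType) (n : nat).
Implicit Types (x y : 'rV[R]_n) (b : 'I_n -> nat).

(** The factorials make the derivatives at x dual to the multi-indices, so that coefficients of
    polynomials are jet coordinates. *)
Definition monomial x b y : R := \prod_i ((y 0 i - x 0 i) ^+ b i / (b i)`!%:R).

Lemma smooth_at_monomial x b y : smooth_at y (monomial x b).
Proof.
apply: smooth_at_prod => i; rewrite /=.
apply: (@smooth_atM _ _ y (fun y => (y 0 i - x 0 i) ^+ b i) (cst _)); last exact: smooth_at_cst.
elim: (b i) => [|k IH]; first exact: smooth_at_cst.
under eq_fun do rewrite exprS.
apply: smooth_atM => //; apply: smooth_atB; first exact: smooth_at_coord.
exact: smooth_at_cst.
Qed.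

Lemma power_is_derive (k : nat) (c s : R) :
  is_derive s 1 (fun s => (s - c) ^+ k / k`!%:R)
    (if k is k'.+1 then (s - c) ^+ k' / k'`!%:R else 0).
Proof.
have dl : is_derive s 1 (fun s => s - c) 1.
  have := is_deriveB (is_derive_id s (1 : R)) (is_derive_cst c s (1 : R)).
  by rewrite subr0.
case: k => [|k].
  have -> : (fun s : R => (s - c) ^+ 0 / 0`!%:R) = cst 1.
    by apply/funext => u; rewrite fact0 divr1.
  exact: is_derive_cst.
have dX : is_derive s 1 (fun s => (s - c) ^+ k.+1) ((k.+1)%:R * (s - c) ^+ k).
  have := is_deriveX k.+1 dl.
  rewrite -pred_Sn.
  have -> : (fun s : R => (s - c) ^+ k.+1) = (fun s : R => s - c) ^+ k.+1.
    by apply/funext => u; rewrite exprfctE.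
  by rewrite [_%:A]mulr1.
have -> : (fun s : R => (s - c) ^+ k.+1 / (k.+1)`!%:R) = (k.+1)`!%:R^-1 *: (fun s => (s - c) ^+ k.+1).
  by apply/funext => u; rewrite mulrC.
apply: is_derive_eq (is_deriveZ _ dX) _.
rewrite factS natrM invfM [LHS]mulrA mulrAC -[(_^-1 * _^-1) * _]mulrA.
by rewrite [k.+1%:R^-1 * _]mulrC -mulrA mulVf ?mulr1 1?mulrC // pnatr_eq0.
Qed.

Lemma partial_monomial x b i :
  partial i (monomial x b) =
  (if (b i == 0)%N then cst 0 else monomial x (fun j => (b j - (j == i))%N)).
Proof.
apply/funext => y.
pose c : R := \prod_(j | j != i) ((y 0 j - x 0 j) ^+ b j / (b j)`!%:R).
pose p (s : R) := (s - x 0 i) ^+ b i / (b i)`!%:R.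
(* The difference quotient along e_i is that of a one-variable power, the remaining factors being a
   constant c. *)
have E : (fun h : R => h^-1 *: (monomial x b (h *: delta_mx 0 i + y) - monomial x b y)) =
  (fun h : R => h^-1 *: ((c *: p) (h *: (1 : R) + y 0 i) - (c *: p) (y 0 i))).
  apply/funext => h; congr (_ *: _); rewrite /monomial.
  rewrite (bigD1 i) //= [X in _ - X](bigD1 i) //= !mxE !eqxx mulr1.
  rewrite [h *: 1]mulr1 mulrC; congr (_ * _ - _).
    rewrite /c; apply: eq_bigr => j ji.
    by rewrite !mxE eqxx (negbTE ji) mulr0 add0r.
  by rewrite mulrC.
have D := is_deriveZ c (power_is_derive (b i) (x 0 i) (y 0 i)).
rewrite /partial /derive E -/(derive (c *: p) (y 0 i) 1) (@derive_val _ _ _ _ _ _ _ D).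
case bi: (b i) => [|k] /=; first by rewrite scaler0.
rewrite /monomial (bigD1 i) //= eqxx bi subn1 /= [LHS]mulrC; congr (_ * _).
by rewrite /c; apply: eq_bigr => j /negbTE ->; rewrite subn0.
Qed.

Lemma wpartial_monomial x b w :
  wpartial w (monomial x b) x = [forall i, count_mem i w == b i]%:R.
Proof.
elim/last_ind: w b => [|w i IH] b.
  rewrite /= /monomial.
  have [b0|/forallPn[i bi]] := boolP [forall i, count_mem i [::] == b i].
    rewrite big1 // => i _; have /eqP <- /= := forallP b0 i.
    by rewrite expr0 divr1.
  by rewrite (bigD1 i) //= subrr expr0n eq_sym (negbTE bi) mul0r mul0r.
rewrite wpartial_rcons partial_monomial; case: eqP => [b0|/eqP b0].
  rewrite wpartial0; case: forallP => // /(_ i).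
  by rewrite b0 -cats1 count_cat /= eqxx addn1.
rewrite IH; congr (nat_of_bool _)%:R; apply: eq_forallb => j.
rewrite -cats1 count_cat /= addn0 eq_sym.
case: (eqVneq i j) => [<-|ij]; rewrite ?eqxx ?subn0 ?addn0 1?eq_sym //=.
  by move: b0; case: (b i) => // k _; rewrite subn1 /= addn1 eqSS.
Qed.

Lemma mi_val_inj m : injective (fun a : multi_index n m => mi_val a).
Proof.
move=> a a' E; apply/val_inj/ffunP => i; apply/val_inj.
by have := congr1 (fun f => f i) E.
Qed.

Lemma mi_of_word m (w : seq 'I_n) : (size w <= m)%N ->
  exists a : multi_index n m, forall i, mi_val a i = count_mem i w.
Proof.
move=> wm.
have cm i : (count_mem i w < m.+1)%N by rewrite ltnS (leq_trans _ wm) // count_size.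
pose a : {ffun 'I_n -> 'I_m.+1} := [ffun i => Ordinal (cm i)].
have sa : (\sum_i a i <= m)%N.
  rewrite (eq_bigr (fun i => count_mem i w)) => [|i _]; last by rewrite ffunE.
  by rewrite -size_word -(perm_size (perm_word w)).
by exists (Sub a sa) => i; rewrite /mi_val SubK ffunE.
Qed.

Lemma size_mi_word m (a : multi_index n m) : (size (word (mi_val a)) <= m)%N.
Proof. by rewrite size_word; exact: (valP a). Qed.

Lemma mpartial_monomial m x (a b : multi_index n m) :
  mpartial (mi_val a) (monomial x (mi_val b)) x = (a == b)%:R.
Proof.
rewrite mpartialE wpartial_monomial; congr (nat_of_bool _)%:R.
apply/forallP/eqP => [H|-> i]; last by rewrite count_word.
by apply: mi_val_inj; apply/funext => i; rewrite -(count_word (mi_val a)); exact/eqP.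
Qed.

Definition taylor m x (c : multi_index n m -> R) y : R :=
  \sum_a c a * monomial x (mi_val a) y.

Lemma smooth_at_taylor m x c y : smooth_at y (@taylor m x c).
Proof. by apply: smooth_at_sum => a; apply: smooth_atZ; exact: smooth_at_monomial. Qed.

Lemma mpartial_taylor m x c (a : multi_index n m) :
  mpartial (mi_val a) (taylor x c) x = c a.
Proof.
rewrite mpartialE wpartial_sum => [|b]; last by apply: smooth_atZ; exact: smooth_at_monomial.
have E (b : multi_index n m) : wpartial (word (mi_val a)) (fun y => c b * monomial x (mi_val b) y) x =
    c b * (a == b)%:R.
  by rewrite wpartialZ -?mpartialE ?mpartial_monomial //; exact: smooth_at_monomial.
rewrite (bigD1 a) //= big1 ?addr0 => [|b ba]; rewrite E ?eqxx ?mulr1 //.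
by rewrite eq_sym (negbTE ba) mulr0.
Qed.

Lemma eq_jet_words m x x' (f g : 'rV[R]_n -> R) : smooth_at x f -> smooth_at x' g ->
  (forall a : multi_index n m, mpartial (mi_val a) f x = mpartial (mi_val a) g x') ->
  forall w, (size w <= m)%N -> wpartial w f x = wpartial w g x'.
Proof.
move=> sf sg E w wm; have [a aw] := mi_of_word wm.
rewrite !wpartial_mpartial //.
have -> : (fun i => count_mem i w) = mi_val a by apply/funext => i; rewrite aw.
exact: E.
Qed.

Lemma smooth_on_all (U : set 'rV[R]_n) f : (forall y, smooth_at y f) -> smooth_on U f.
Proof.
move=> sf m.
elim: m f sf => [|m IH] f sf; (split; first by move=> y _; exact: smooth_at_cont) => // i.
split; first by move=> y _; exact: smooth_at_derivable.
by apply: IH => y; exact: smooth_at_partial.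
Qed.

Lemma smooth_on_near (U : set 'rV[R]_n) f : (forall y, U y -> smooth_at y f) -> smooth_on U f.
Proof.
move=> sf m.
elim: m f sf => [|m IH] f sf; (split; first by move=> y Uy; exact: smooth_at_cont (sf _ Uy)) => // i.
split; first by move=> y Uy; exact: smooth_at_derivable (sf _ Uy).
by apply: IH => y Uy; exact: smooth_at_partial (sf _ Uy).
Qed.

End Realization.

(** * Derivatives of curves of jets *)

Section JetDerivative.
Variables (R : realType) (n : nat).
Implicit Types (x y : 'rV[R]_n) (xs : R -> 'rV[R]_n).
Implicit Types (phi psi : R -> 'rV[R]_n -> R) (f g : 'rV[R]_n -> R).

(** First-order variation at t = 0 of the m-jet of phi_t at the moving point [xs t]: the m-jet of f
    is its value and the m-jet of g its velocity. Representing both by functions, rather than by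
    families of numbers, lets the product and chain rules be written as ordinary formulas on
    functions. *)
Definition jderiv xs m phi f g : Prop :=
  [/\ \forall t \near (0 : R), smooth_at (xs t) (phi t),
      smooth_at (xs 0) f, smooth_at (xs 0) g &
      forall w, (size w <= m)%N ->
        is_derive (0 : R) (1 : R) (fun t => wpartial w (phi t) (xs t)) (wpartial w g (xs 0))
        /\ wpartial w (phi 0) (xs 0) = wpartial w f (xs 0)].

Lemma jderivW xs m m' phi f g : (m' <= m)%N -> jderiv xs m phi f g -> jderiv xs m' phi f g.
Proof. by move=> mm [? ? ? H]; split=> // w wm; apply: H; exact: leq_trans mm. Qed.

Lemma wpartial_rcons_fun xs phi w i :
  (fun t => wpartial (rcons w i) (phi t) (xs t)) =
  (fun t => wpartial w (partial i (phi t)) (xs t)).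
Proof. by apply/funext => t; rewrite wpartial_rcons. Qed.

Lemma jderiv_partial xs m phi f g i : jderiv xs m.+1 phi f g ->
  jderiv xs m (fun t => partial i (phi t)) (partial i f) (partial i g).
Proof.
move=> [sp sf sg H]; split; try exact: smooth_at_partial.
  by apply: filterS sp => t; exact: smooth_at_partial.
move=> w wm; have := H (rcons w i); rewrite size_rcons wpartial_rcons_fun !wpartial_rcons.
by apply.
Qed.

Lemma jderivS xs m phi f g : jderiv xs 0 phi f g ->
  (forall i, jderiv xs m (fun t => partial i (phi t)) (partial i f) (partial i g)) ->
  jderiv xs m.+1 phi f g.
Proof.
move=> [sp sf sg H0] H; split=> // w; case/lastP: w => [_|w i]; first exact: H0.
rewrite size_rcons ltnS => wm; have [_ _ _ /(_ w wm)] := H i.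
by rewrite wpartial_rcons_fun !wpartial_rcons.
Qed.

Lemma near_is_derive (u v : R -> R) (d : R) : {near 0, u =1 v} ->
  is_derive (0 : R) (1 : R) u d -> is_derive (0 : R) (1 : R) v d.
Proof. exact: near_eq_is_derive. Qed.

Lemma jderiv_ext xs m phi psi f f' g g' :
  (\forall t \near (0 : R), {near xs t, phi t =1 psi t}) ->
  {near xs 0, f =1 f'} -> {near xs 0, g =1 g'} ->
  jderiv xs m phi f g -> jderiv xs m psi f' g'.
Proof.
move=> Ep Ef Eg [sp sf sg H]; split.
- near=> t; apply: (@smooth_at_ext _ _ _ (phi t)); first by near: t.
  by near: t.
- exact: smooth_at_ext Ef sf.
- exact: smooth_at_ext Eg sg.
- move=> w wm; have [H1 H2] := H w wm; rewrite -(wpartial_near w Eg) -(wpartial_near w Ef) -H2.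
  split; last by rewrite (wpartial_near w (nbhs_singleton Ep)).
  apply: near_is_derive H1; near=> t.
  by apply: wpartial_near; near: t.
Unshelve. all: by end_near.
Qed.

Lemma jderivD xs m phi psi f f' g g' :
  jderiv xs m phi f g -> jderiv xs m psi f' g' ->
  jderiv xs m (fun t y => phi t y + psi t y) (fun y => f y + f' y) (fun y => g y + g' y).
Proof.
move=> [sp sf sg H] [sp' sf' sg' H']; split; try exact: smooth_atD.
  by near=> t; apply: smooth_atD; near: t.
move=> w wm; have [H1 H2] := H w wm; have [H1' H2'] := H' w wm.
rewrite !wpartialD ?H2 ?H2' //; try exact: nbhs_singleton sp; try exact: nbhs_singleton sp'.
split=> //.
apply: near_is_derive (is_deriveD H1 H1'); near=> t.
by rewrite wpartialD //; near: t.
Unshelve. all: by end_near.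
Qed.

Lemma jderiv_cst xs m : jderiv xs m (fun _ => cst 0) (cst 0) (cst 0).
Proof.
split; try exact: smooth_at_cst; first by exists 1 => //= t _; exact: smooth_at_cst.
move=> w wm; split=> //; rewrite wpartial0.
have -> : (fun t => wpartial w (cst 0) (xs t)) = cst (0 : R).
  by apply/funext => t; rewrite wpartial0.
exact: is_derive_cst.
Qed.

Lemma jderiv_sum xs m (I : Type) (r : seq I) (phi : I -> R -> 'rV[R]_n -> R)
    (f g : I -> 'rV[R]_n -> R) :
  (forall i, jderiv xs m (phi i) (f i) (g i)) ->
  jderiv xs m (fun t y => \sum_(i <- r) phi i t y) (fun y => \sum_(i <- r) f i y)
    (fun y => \sum_(i <- r) g i y).
Proof.
move=> H; elim: r => [|i r IH].
  have := jderiv_cst xs m; congr (jderiv _ _ _ _ _).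
  - by apply/funext => t; apply/funext => y; rewrite big_nil.
  - by apply/funext => y; rewrite big_nil.
  - by apply/funext => y; rewrite big_nil.
have := jderivD (H i) IH; congr (jderiv _ _ _ _ _).
- by apply/funext => t; apply/funext => y; rewrite big_cons.
- by apply/funext => y; rewrite big_cons.
- by apply/funext => y; rewrite big_cons.
Qed.

Lemma partialM_near x f g i : smooth_at x f -> smooth_at x g ->
  {near x, partial i (fun y => f y * g y) =1 (fun y => partial i f y * g y + f y * partial i g y)}.
Proof.
move=> sf sg; near=> y; rewrite partialM //; apply: smooth_at_derivable; near: y; exact: smooth_at_near.
Unshelve. all: by end_near.
Qed.

Lemma partialD_near x f g i : smooth_at x f -> smooth_at x g ->
  {near x, partial i (fun y => f y + g y) =1 (fun y => partial i f y + partial i g y)}.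
Proof.
move=> sf sg; near=> y; rewrite partialD //; apply: smooth_at_derivable; near: y; exact: smooth_at_near.
Unshelve. all: by end_near.
Qed.

(** Induction on the order: one partial derivative of a product is, by Leibniz's rule, a sum of
    products of families controlled to the previous order. *)
Lemma jderivM xs m phi psi f f' g g' :
  jderiv xs m phi f g -> jderiv xs m psi f' g' ->
  jderiv xs m (fun t y => phi t y * psi t y) (fun y => f y * f' y)
    (fun y => g y * f' y + f y * g' y).
Proof.
elim: m phi psi f f' g g' => [|m IH] phi psi f f' g g' Hp Hq.
  have [sp sf sg H] := Hp; have [sp' sf' sg' H'] := Hq.
  split; [|exact: smooth_atM|by apply: smooth_atD; exact: smooth_atM|].
    by near=> t; apply: smooth_atM; near: t.
  case=> // _; have [/= H1 H2] := H [::] isT; have [/= H1' H2'] := H' [::] isT.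
  split; last by rewrite H2 H2'.
  apply: is_derive_eq (is_deriveM H1 H1') _ => /=.
  by rewrite -H2 -H2' addrC; congr (_ + _); rewrite [LHS]mulrC.
apply: jderivS.
  by have := IH _ _ _ _ _ _ (jderivW (leqnSn m) Hp) (jderivW (leqnSn m) Hq); apply: jderivW.
move=> i.
have Dp := jderiv_partial i Hp; have Dq := jderiv_partial i Hq.
have Wp := jderivW (leqnSn m) Hp; have Wq := jderivW (leqnSn m) Hq.
have [sp sf sg _] := Hp; have [sp' sf' sg' _] := Hq.
apply: jderiv_ext (jderivD (IH _ _ _ _ _ _ Dp Wq) (IH _ _ _ _ _ _ Wp Dq)).
- near=> t.
  have s1 : smooth_at (xs t) (phi t) by near: t.
  have s2 : smooth_at (xs t) (psi t) by near: t.
  by apply: filterS (partialM_near i s1 s2) => y ->.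
- by apply: filterS (partialM_near i sf sf') => y ->.
- have := partialD_near i (smooth_atM sg sf') (smooth_atM sf sg').
  move=> E; near=> y; rewrite (near E y) //.
  rewrite (near (partialM_near i sg sf') y) // (near (partialM_near i sf sg') y) //.
  ring.
Unshelve. all: by end_near.
Qed.

Lemma smooth_at_const_ext x (F : 'rV[R]_n -> 'rV[R]_n) :
  (forall l, smooth_at x (fun y => F y 0 l)) -> {for x, continuous F}.
Proof. by move=> sF; apply: continuous_coords => l; exact: smooth_at_cont (sF l). Qed.

Lemma partial_comp_near x f (F : 'rV[R]_n -> 'rV[R]_n) i : smooth_at (F x) f ->
  (forall l, smooth_at x (fun y => F y 0 l)) ->
  {near x, partial i (fun y => f (F y)) =1
    (fun y => \sum_l partial l f (F y) * partial i (fun z => F z 0 l) y)}.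
Proof.
move=> sf sF; have cF := smooth_at_const_ext sF.
have nF : \forall y \near x, forall l, smooth_at y (fun z => F z 0 l).
  by apply: (@filter_forall 'rV[R]_n 'I_n (fun l y => smooth_at y (fun z => F z 0 l)) (nbhs x) (nbhs_filter x)) => l;
     exact: smooth_at_near.
have nf : \forall y \near x, smooth_at (F y) f := cF _ (smooth_at_near sf).
near=> y.
have s1 : smooth_at (F y) f by near: y.
have s2 : forall l, smooth_at y (fun z => F z 0 l) by near: y.
have := is_partial_comp (smooth_at_differentiable s1) (fun l => smooth_at_derivable (s2 l)).
by move=> D; rewrite /partial (@derive_val _ _ _ _ _ _ _ (D i)).
Unshelve. all: by end_near.
Qed.

Lemma partialC_at x f i j : smooth_at x f ->
  partial i (partial j f) x = partial j (partial i f) x.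
Proof. by move=> sf; have := wpartialC i j [::] sf. Qed.

Lemma partial_coord i l : partial i (fun y : 'rV[R]_n => y 0 l) = cst (l == i)%:R.
Proof.
apply/funext => x; exact: (@derive_val _ _ _ _ _ _ _ (coord_is_derive x i l)).
Qed.

Lemma sum_partial_coord i (A : 'I_n -> R) y :
  \sum_l A l * partial i (fun z : 'rV[R]_n => z 0 l) y = A i.
Proof.
rewrite (bigD1 i) // partial_coord /cst eqxx mulr1 big1 => [|l li]; first exact: addr0.
by rewrite partial_coord /cst (negbTE li) mulr0.
Qed.

(* The differential of (phi, F) |-> phi o F at F = id; the base point of phi
   moves along F_t(x), whence the translation by X(x). *)
Lemma jderiv_comp x m (F : R -> 'rV[R]_n -> 'rV[R]_n) (X : 'I_n -> 'rV[R]_n -> R)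
    xs phi f g : (forall t, xs t = F t x) -> xs 0 = x ->
  (forall l, jderiv (fun=> x) m (fun t y => F t y 0 l) (fun y => y 0 l) (X l)) ->
  jderiv xs m phi f g ->
  jderiv (fun=> x) m (fun t y => phi t (F t y)) f
    (fun y => g y + \sum_l (X l y - X l x) * partial l f y).
Proof.
move=> xsF xs0 JF.
have sX l : smooth_at x (X l) by have [] := JF l.
have sXx l : smooth_at x (fun y => X l y - X l x).
  by apply: smooth_atB => //; exact: smooth_at_cst.
have nF : \forall t \near (0 : R), forall l, smooth_at x (fun z => F t z 0 l).
  by apply: (@filter_forall R 'I_n (fun l t => smooth_at x (fun z => F t z 0 l)) (nbhs (0 : R)) (nbhs_filter _)) => l;
     have [] := JF l.
elim: m phi f g JF => [|m IH] phi f g JF Hp.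
  have [sp sf sg H] := Hp; rewrite xs0 in sf sg.
  split=> //.
  - near=> t; apply: smooth_at_comp; first by rewrite -xsF; near: t.
    by near: t.
  - apply: smooth_atD => //; apply: smooth_at_sum => l.
    by apply: smooth_atM => //; exact: smooth_at_partial.
  case=> // _; have [/= H1 H2] := H [::] isT.
  (* At order 0 the correction is evaluated at x itself, where X_l - X_l(x) vanishes. *)
  rewrite big1 ?addr0; last by move=> l _; rewrite subrr mul0r.
  rewrite -xsF H2 xs0; split=> //; rewrite -{2}xs0.
  by congr (is_derive _ _ _ _) : H1; apply/funext => t; rewrite -xsF.
have JF' l := jderivW (leqnSn m) (JF l).
have [sp sf sg _] := Hp; rewrite xs0 in sf sg.
apply: jderivS.
  exact: jderivW (IH _ _ _ JF' (jderivW (leqnSn m) Hp)).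
move=> i.
(* By the chain rule the i-th derivative of phi o F is a sum of products of (d_l phi) o F, covered
   by the induction, with d_i F^l, whose jet is controlled to order m. *)
have HS := jderiv_sum (index_enum 'I_n) (fun l =>
  jderivM (IH _ _ _ JF' (jderiv_partial l Hp)) (jderiv_partial i (JF l))).
apply: jderiv_ext HS.
- near=> t.
  have s1 : smooth_at (F t x) (phi t) by rewrite -xsF; near: t.
  have s2 : forall l, smooth_at x (fun y => F t y 0 l) by near: t.
  by apply: filterS (partial_comp_near i s1 s2) => y ->.
- near=> y; exact: sum_partial_coord.
- have sfl l : smooth_at x (partial l f) by exact: smooth_at_partial.
  have nsX : \forall y \near x, forall l, smooth_at y (fun y => X l y - X l x).
    by apply: (@filter_forall 'rV[R]_n 'I_n (fun l y => smooth_at y (fun z => X l z - X l x)) (nbhs x) (nbhs_filter _)) => l;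
      exact: smooth_at_near.
  have nsX' : \forall y \near x, forall l, smooth_at y (X l).
    by apply: (@filter_forall 'rV[R]_n 'I_n (fun l y => smooth_at y (X l)) (nbhs x) (nbhs_filter _)) => l;
      exact: smooth_at_near.
  near=> y.
  have sfy : smooth_at y f by near: y; exact: smooth_at_near.
  have sgy : smooth_at y g by near: y; exact: smooth_at_near.
  have sXxy : forall l, smooth_at y (fun y => X l y - X l x) by near: y.
  have sXy : forall l, smooth_at y (X l) by near: y.
  rewrite partialD; [|exact: smooth_at_derivable|]; last first.
    apply: smooth_at_derivable; apply: smooth_at_sum => l.
    by apply: smooth_atM => //; exact: smooth_at_partial.
  rewrite -[partial i (fun y => \sum_l _) y]/(wpartial [:: i] _ y) wpartial_sum /=; last first.
    by move=> l; apply: smooth_atM => //; exact: smooth_at_partial.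
  have addS (A B : 'I_n -> R) : \sum_l (A l + B l) = \sum_l A l + \sum_l B l.
    exact: big_split.
  rewrite addS sum_partial_coord -addrA -addS.
  congr (_ + _); apply: eq_bigr => l _.
  rewrite partialM; [|exact: smooth_at_derivable|exact/smooth_at_derivable/smooth_at_partial].
  rewrite partialD; [|exact: smooth_at_derivable|exact/derivable_cst].
  have -> : partial i (fun=> - X l x) y = 0 by exact: derive_cst.
  (* The two sums agree term by term because second derivatives of f commute. *)
  by rewrite addr0 (partialC_at i l sfy) addrC [_ * partial l f y]mulrC.
Unshelve. all: by end_near.
Qed.

End JetDerivative.

(** * The inverse function theorem *)

Section ClosedClass.
Variables (R : realType) (T : Type) (P : (T -> R) -> Prop).
Hypothesis Pcst : forall c, P (cst c).
Hypothesis PD : forall f g, P f -> P g -> P (fun y => f y + g y).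
Hypothesis PM : forall f g, P f -> P g -> P (fun y => f y * g y).

Lemma closed_sum (I : Type) (r : seq I) (F : I -> T -> R) :
  (forall i, P (F i)) -> P (fun y => \sum_(i <- r) F i y).
Proof.
move=> PF; elim: r => [|i r IH].
  by under eq_fun do rewrite big_nil; exact: Pcst.
by under eq_fun do rewrite big_cons; exact: PD.
Qed.

Lemma closed_prod (I : Type) (r : seq I) (F : I -> T -> R) :
  (forall i, P (F i)) -> P (fun y => \prod_(i <- r) F i y).
Proof.
move=> PF; elim: r => [|i r IH].
  by under eq_fun do rewrite big_nil; exact: Pcst.
by under eq_fun do rewrite big_cons; exact: PM.
Qed.

(** Determinants and cofactors are polynomials in the entries, so they belong to any class of
    functions containing the constants and closed under sums and products. The classes used are:
    functions of class C^m, smooth germs, families with jets differentiable in t, and continuous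
    functions. *)
Lemma closed_det p (A : T -> 'M[R]_p) : (forall i j, P (fun y => A y i j)) ->
  P (fun y => \det (A y)).
Proof.
move=> PA; apply: closed_sum => s.
by apply: PM; [exact: Pcst|apply: closed_prod => i; exact: PA].
Qed.

Lemma closed_adj p (A : T -> 'M[R]_p) : (forall i j, P (fun y => A y i j)) ->
  forall i j, P (fun y => (\adj (A y)) i j).
Proof.
move=> PA i j; under eq_fun do rewrite mxE.
apply: PM; first exact: Pcst.
by apply: closed_det => k l; under eq_fun do rewrite !mxE; exact: PA.
Qed.

End ClosedClass.

(* Agrees with [invmx] on invertible matrices, with entries given by Cramer's
   formulas everywhere. *)
Definition cramer_inv (R : realType) p (A : 'M[R]_p) : 'M[R]_p :=
  (\det A)^-1 *: \adj A.

Lemma cramer_invE (R : realType) p (A : 'M[R]_p) : A \in unitmx -> cramer_inv A = invmx A.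
Proof. by rewrite /invmx => ->. Qed.

(** Completeness of spaces of real matrices is what the Banach fixed point theorem asks for in
    [open_image]. *)
HB.instance Definition _ (R : realType) (m n : nat) :=
  Uniform_isComplete.Build 'M[R]_(m, n) cauchy_cvg.

Section InverseFunction.
Variables (R : realType) (n : nat).
Implicit Types (x y z u v : 'rV[R]_n).

Lemma differentiable_near (f : 'rV[R]_n -> R) x : differentiable f x ->
  forall e : R, 0 < e -> \forall v \near (0 : 'rV[R]_n),
    `|f (v + x) - f x - \sum_i v 0 i * partial i f x| <= e * `|v|.
Proof.
move=> df e e0; have /eqaddoP /(_ e e0) := diff_locally df.
apply: filterS => v /=; rewrite !fctE opprD addrA.
by rewrite -diff_partial.
Qed.

Variables (F : 'rV[R]_n -> 'rV[R]_n) (x : 'rV[R]_n) (r : R).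
Let B := ball x r.
Hypothesis r0 : 0 < r.
Hypothesis sF : forall l, smooth_on B (fun y => F y 0 l).
Hypothesis FB : forall y z, B y -> B z -> `|F y - y - (F z - z)| <= 2^-1 * `|y - z|.

(** [FB] says that F - id is 1/2-Lipschitz, the quantitative closeness to the identity enjoyed by id
    + t X for small t. Hence F cannot shrink distances by more than a factor 2; injectivity and the
    Lipschitz continuity of the inverse both come from this. *)
Lemma expansion y z : B y -> B z -> `|y - z| <= 2 * `|F y - F z|.
Proof.
move=> By Bz; have := FB By Bz.
have -> : F y - y - (F z - z) = (F y - F z) - (y - z).
  by apply/rowP => j; rewrite !mxE; ring.
move=> H; have := ler_normB (F y - F z) (F y - F z - (y - z)).
by rewrite opprB [_ + (y - z - _)]addrC subrK; lra.
Qed.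

Let oB : open B. Proof. exact: ball_open. Qed.

(** For z near F(y0), the equation F(y) = z is the fixed point equation of y |-> z - (F(y) - y), a
    1/2-contraction of a small closed ball around y0. *)
Lemma open_image : open (F @` B).
Proof.
rewrite openE => _ [y0 By0 <-].
have /nbhs_ballP[d /= d0 dB] : nbhs y0 B by exact: open_near.
pose rho := d / 2; have rho0 : 0 < rho by rewrite divr_gt0.
pose U := closed_ball_ (fun y : 'rV[R]_n => `|y|) y0 rho.
have UB : U `<=` B.
  move=> y; rewrite /U /closed_ball_ /= => yU; apply: dB; rewrite -ball_normE /=.
  by apply: le_lt_trans yU _; rewrite /rho; lra.
(* With z at distance less than rho/2 from F(y0), the image of the closed ball lies within rho/2 +
   rho/2 of y0. *)
apply/nbhs_ballP; exists (rho / 2) => /=; first by rewrite divr_gt0.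
move=> z; rewrite -ball_normE /= => zF.
pose g y := z - (F y - y).
have gU : {homo g : y / U y >-> U y}.
  move=> y Uy; rewrite /U /closed_ball_ /= /g.
  have -> : y0 - (z - (F y - y)) = (F y0 - z) + (F y - y - (F y0 - y0)).
    by apply/rowP => j; rewrite !mxE; ring.
  apply: le_trans (ler_normD _ _) _.
  have := FB (UB _ Uy) By0; move: Uy; rewrite /U /closed_ball_ /= distrC.
  by lra.
have cg : is_contraction (mkfun gU).
  exists (2^-1)%:nng; split; first by rewrite /= invf_lt1 ?ltr1n.
  move=> [y y'] [/= Uy Uy']; rewrite /mkfun /g.
  have -> : z - (F y - y) - (z - (F y' - y')) = (F y' - y') - (F y - y).
    by apply/rowP => j; rewrite !mxE; ring.
  by rewrite distrC; exact: FB (UB _ Uy) (UB _ Uy').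
have [||y Uy yE] := banach_fixed_point cg.
- exact: closed_closed_ball_.
- by exists y0; rewrite /U /closed_ball_ /= subrr normr0 ltW.
exists y; first exact: UB.
have {}yE : y = z - (F y - y) := yE.
by apply/rowP => j; have := congr1 (fun w : 'rV[R]_n => w 0 j) yE; rewrite !mxE; lra.
Qed.

(** If v is in the kernel of the Jacobian, F(y + h v) - F(y) is o(h), whereas it differs from h v by
    at most |h v|/2. Hence |v| <= |v|/2 and v = 0. *)
Lemma jacobian_unit y : B y -> Defs.jacobian F y \in unitmx.
Proof.
move=> By; rewrite -unitmx_tr -row_free_unit -kermx_eq0.
apply/eqP/row_matrixP => k; rewrite row0.
set v := row k _.
have vJ : v *m (Defs.jacobian F y)^T = 0.
  by apply/sub_kermxP; exact: row_sub.
clearbody v.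
have dF l : differentiable (fun y => F y 0 l) y.
  by apply: smooth_at_differentiable; exists B.
have Dv l : 'D_v (fun y => F y 0 l) y = 0.
  rewrite deriveE // diff_partial //.
  have := congr1 (fun w : 'rV[R]_n => w 0 l) vJ; rewrite mxE [RHS]mxE => E.
  by rewrite -[RHS]E; apply: eq_bigr => i _; rewrite !mxE.
have nB : \forall h \near (0 : R), B (h *: v + y).
  have : h *: v + y @[h --> (0 : R)] --> y.
    rewrite -[X in _ --> X]add0r -(scale0r v).
    apply: cvgD; last exact: cvg_cst.
    exact: scalel_continuous.
  by apply; exact: open_near.
have vl l (e : R) : 0 < e -> `|v 0 l| <= 2^-1 * `|v| + e.
  move=> e0.
  have dl : derivable (fun y => F y 0 l) y v by exact: diff_derivable.
  have cD : h^-1 *: (F (h *: v + y) 0 l - F y 0 l) @[h --> 0^'] --> (0 : R).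
    by have cD : h^-1 *: (F (h *: v + y) 0 l - F y 0 l) @[h --> 0^'] -->
      'D_v (fun y => F y 0 l) y by []; rewrite Dv in cD.
  have /cvgrPdist_le /(_ e e0) := cD.
  move=> nq.
  have /filter_ex[h [[h0 hB] hq]] : \forall h \near 0^', (h != 0 /\ B (h *: v + y)) /\
     `|0 - h^-1 *: (F (h *: v + y) 0 l - F y 0 l)| <= e.
    near=> h; split; last by near: h.
    split; first by near: h; exact: nbhs_dnbhs_neq.
    by near: h; apply: nbhs_dnbhs.
  have := FB hB By; rewrite addrK normrZ.
  have := rV_coord_le (F (h *: v + y) - (h *: v + y) - (F y - y)) l.
  rewrite !mxE => H1 H2.
  have hp : 0 < `|h| by rewrite normr_gt0.
  have H3 : `|F (h *: v + y) 0 l - F y 0 l| <= e * `|h|.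
    move: hq; rewrite sub0r normrN [_ *: _]mulrC normrM normfV.
    by rewrite ler_pdivrMr.
  have {H1 H2} H4 := le_trans H1 H2.
  have := ler_normB (F (h *: v + y) 0 l - F y 0 l)
    (F (h *: v + y) 0 l - (h * v 0 l + y 0 l) - (F y 0 l - y 0 l)).
  have -> : F (h *: v + y) 0 l - F y 0 l -
    (F (h *: v + y) 0 l - (h * v 0 l + y 0 l) - (F y 0 l - y 0 l)) = h * v 0 l.
    by ring.
  move=> /le_trans /(_ (lerD H3 H4)); rewrite normrM => H5.
  rewrite -(ler_pM2l hp); apply: le_trans H5 _.
  by lra.
apply/eqP; rewrite -normr_le0.
have : `|v| <= 2^-1 * `|v|.
  apply: rV_norm_le => [|l]; first by rewrite mulr_ge0 ?invr_ge0.
  by apply/ler_addgt0Pr => e; exact: vl.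
by lra.
Unshelve. all: by end_near.
Qed.

(** H is any choice of preimage in the ball, with default x off the image. It is 2-Lipschitz, its
    derivative at z is the inverse of the Jacobian of F at H(z), and this formula bootstraps its
    regularity. *)
Lemma inverse_function : exists H : 'rV[R]_n -> 'rV[R]_n,
  (forall y, B y -> H (F y) = y) /\
  forall l, smooth_on (F @` B) (fun z => H z 0 l).
Proof.
pose H z := xget x [set y | B y /\ F y = z].
have BH z : (F @` B) z -> B (H z) /\ F (H z) = z.
  by move=> [y By yz]; apply: (@xgetPex _ x [set y | B y /\ F y = z]); exists y.
have HF y : B y -> H (F y) = y.
  move=> By; have [|By' E] := BH (F y); first by exists y.
  have := expansion By' By; rewrite E subrr normr0 mulr0 normr_le0 subr_eq0.
  by move/eqP.
exists H; split=> // l0.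
have HL z z' : (F @` B) z -> (F @` B) z' -> `|H z - H z'| <= 2 * `|z - z'|.
  move=> /BH[By Ey] /BH[By' Ey'].
  by have := expansion By By'; rewrite Ey Ey'.
have oV := open_image.
have cH z : (F @` B) z -> {for z, continuous H}.
  move=> Vz; apply/(@cvgrPdist_le R _ _ (nbhs z) (nbhs_filter z) H (H z)) => e e0.
  near=> z'; apply: le_trans (HL _ _ Vz _) _; first by near: z'; exact: open_near.
  rewrite -ler_pdivlMl // mulrC.
  near: z'; apply/nbhs_ballP; exists (e / 2); first by rewrite /= divr_gt0.
  by move=> z'; rewrite -ball_normE /= => /ltW.
pose K y := cramer_inv (Defs.jacobian F y).
have dH z i j : (F @` B) z -> is_derive z (delta_mx 0 i) (fun z => H z 0 j) (K (H z) j i).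
  move=> Vz; have [By Ey] := BH z Vz; set y := H z in By Ey *.
  have JK : K y *m Defs.jacobian F y = 1%:M.
    by rewrite /K cramer_invE ?mulVmx ?jacobian_unit.
  have dF l : differentiable (fun y => F y 0 l) y.
    by apply: smooth_at_differentiable; exists B.
  suff cD : h^-1 *: (H (h *: delta_mx 0 i + z) 0 j - H z 0 j) @[h --> 0^'] --> K y j i.
    by split; [apply/cvg_ex; exists (K y j i)|apply/cvg_lim].
  apply/cvgrPdist_le => e e0.
  (* C dominates row j of the inverse Jacobian, the 1 making it positive; e' compensates C and the
     Lipschitz constant 2 of H. *)
  pose C := 1 + \sum_a `|K y j a|.
  have C0 : 0 < C by rewrite ltr_pwDl // sumr_ge0.
  pose e' := e / (2 * C).
  have e'0 : 0 < e' by rewrite divr_gt0 ?mulr_gt0.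
  have nF : \forall u \near (0 : 'rV[R]_n), forall a,
      `|F (u + y) 0 a - F y 0 a - \sum_i u 0 i * partial i (fun y => F y 0 a) y| <= e' * `|u|.
    by apply: (@filter_forall 'rV[R]_n 'I_n (fun a u => `|F (u + y) 0 a - F y 0 a - \sum_i u 0 i * partial i (fun y => F y 0 a) y| <= e' * `|u|) (nbhs (0 : 'rV[R]_n)) (nbhs_filter _)) => a; exact: differentiable_near.
  have cl : h *: delta_mx 0 i + z @[h --> (0 : R)] --> z.
    rewrite -[X in _ --> X]add0r -(scale0r (delta_mx 0 i : 'rV[R]_n)).
    apply: cvgD; last exact: cvg_cst.
    exact: scalel_continuous.
  have cu : H (h *: delta_mx 0 i + z) - y @[h --> (0 : R)] --> (0 : 'rV[R]_n).
    rewrite -(subrr y); apply: cvgB; last exact: cvg_cst.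
    exact: (cvg_comp _ _ cl (cH z Vz)).
  have nFh : \forall h \near 0^', forall a,
      `|F (H (h *: delta_mx 0 i + z) - y + y) 0 a - F y 0 a -
        \sum_k (H (h *: delta_mx 0 i + z) - y) 0 k * partial k (fun y => F y 0 a) y|
      <= e' * `|H (h *: delta_mx 0 i + z) - y|.
    by apply: nbhs_dnbhs; exact: cu nF.
  near=> h.
  have h0 : h != 0 by near: h; exact: nbhs_dnbhs_neq.
  have Vh : (F @` B) (h *: delta_mx 0 i + z).
    by near: h; apply: nbhs_dnbhs; apply: cl; exact: open_near.
  have [Bh Eh] := BH _ Vh.
  pose u := H (h *: delta_mx 0 i + z) - y.
  have hu a : `|F (u + y) 0 a - F y 0 a - \sum_i u 0 i * partial i (fun y => F y 0 a) y| <= e' * `|u|.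
    by rewrite /u; move: a; near: h; exact: nFh.
  have uh : `|u| <= 2 * `|h|.
    have := HL _ _ Vh Vz; rewrite addrK normrZ => /le_trans; apply.
    rewrite ler_wpM2l // ler_piMr //.
    apply: rV_norm_le => // l; rewrite mxE eqxx /=.
    by case: (l == i); rewrite ?normr1 ?normr0.
  (* For u the increment of H, the increment of F from y to y + u is exactly h e_i, so rho is the
     remainder of the linearization of F at y. Multiplying by the inverse Jacobian turns it into the
     remainder of the linearization of H. *)
  pose rho a := h * (a == i)%:R - \sum_k u 0 k * partial k (fun y => F y 0 a) y.
  have rhoE a : `|rho a| <= e' * (2 * `|h|).
    apply: le_trans (_ : _ <= e' * `|u|) _; last by rewrite ler_wpM2l // ltW.
    have := hu a; rewrite /u subrK Eh Ey !mxE eqxx /= addrK.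
    by [].
  have key : K y j i * h - u 0 j = \sum_a K y j a * rho a.
    rewrite /rho; under eq_bigr do rewrite mulrBr; rewrite sumrB; congr (_ - _).
      rewrite (bigD1 i) //= eqxx mulr1 big1 ?addr0 // => a /negbTE ->.
      by rewrite !mulr0.
    under eq_bigr do rewrite mulr_sumr; rewrite exchange_big /=.
    transitivity (\sum_k u 0 k * (K y *m Defs.jacobian F y) j k).
      rewrite JK (bigD1 j) //= [1%:M _ _]mxE eqxx mulr1 big1 ?addr0 // => k kj.
      by rewrite [1%:M _ _]mxE eq_sym (negbTE kj) mulr0.
    apply: eq_bigr => k _; rewrite [(K y *m _) j k]mxE mulr_sumr; apply: eq_bigr => a _.
    by rewrite [Defs.jacobian F y a k]mxE mulrCA.
  have -> : K y j i - h^-1 *: (H (h *: delta_mx 0 i + z) 0 j - H z 0 j) =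
    h^-1 * (K y j i * h - u 0 j).
    have -> : u 0 j = H (h *: delta_mx 0 i + z) 0 j - H z 0 j.
      by rewrite /u mxE [X in _ + X]mxE.
    by rewrite mulrBr [K y j i * h]mulrC mulKf.
  rewrite normrM normfV ler_pdivrMl ?normr_gt0 // key.
  apply: le_trans (ler_norm_sum _ _ _) _.
  apply: (@le_trans _ _ (\sum_a `|K y j a| * (e' * (2 * `|h|)))).
    by apply: ler_sum => a _; rewrite normrM ler_wpM2l.
  rewrite -mulr_suml.
  apply: (@le_trans _ _ (C * (e' * (2 * `|h|)))).
    apply: ler_wpM2r; first exact: (mulr_ge0 (ltW e'0) (mulr_ge0 (ler0n _ 2) (normr_ge0 h))).
    by rewrite /C lerDr.
  have -> // : C * (e' * (2 * `|h|)) = `|h| * e.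
  rewrite /e'; field; by rewrite gt_eqF.
have sK m j i : Cm_on m B (fun y => K y j i).
  have sJ a b : Cm_on m B (fun y => Defs.jacobian F y a b).
    under eq_fun do rewrite mxE.
    exact: (Cm_on_partial b (sF a m.+1)).
  have D f g := @Cm_onD R n m B f g oB; have M f g := @Cm_onM R n m B f g oB.
  rewrite /K /cramer_inv; under eq_fun do rewrite mxE.
  apply: (Cm_onM oB); last exact: (closed_adj (@Cm_on_cst R n m B) D M).
  apply: Cm_onV => //; last exact: (closed_det (@Cm_on_cst R n m B) D M).
  by move=> y By; rewrite -unitfE -unitmxE jacobian_unit.
(* Bootstrap: if H is of class C^m, its partial derivatives, the entries of K o H, are of class C^m,
   so H is of class C^(m+1). *)
move=> m; elim: m l0 => [|m IH] l0.
  split=> // z Vz; have cz := cH z Vz.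
  exact: (continuous_comp cz (@matrix_normedtype.coord_continuous R 1 n 0 l0 (H z))).
split=> [z Vz|i].
  have cz := cH z Vz.
  exact: (continuous_comp cz (@matrix_normedtype.coord_continuous R 1 n 0 l0 (H z))).
split=> [z Vz|]; first by have [] := dH z i l0 Vz.
have : Cm_on m (F @` B) (fun z => K (H z) l0 i).
  apply: (@Cm_on_comp R n m _ B (fun y => K y l0 i) H oV oB _ (sK m l0 i) IH).
  by move=> z /BH[].
apply: Cm_on_ext => // z; rewrite inE => Vz.
by rewrite /partial (@derive_val _ _ _ _ _ _ _ (dH z i l0 Vz)).
Unshelve. all: by end_near.
Qed.

End InverseFunction.

(** * Tangent vectors to the orbits are Lie derivatives *)

Section Charts.
Variables (R : realType) (n : nat).

Lemma chart_image_open (M : topologicalType) (c : chart R n M) (A : set M) :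
  open A -> A `<=` dom c -> open (coord c @` A).
Proof.
move=> oA AD; rewrite openE => _ [q Aq <-].
have iq : (coord c @` dom c) (coord c q) by exists q => //; exact: AD.
have H1 : \forall y \near coord c q, (coord c @` dom c) y.
  exact: (open_near (@image_open _ _ _ c) iq).
have H2 : \forall y \near coord c q, A (point c y).
  apply: (point_continuous iq); rewrite coordK; last exact: AD.
  by apply: open_nbhs_nbhs; split.
apply: filterS2 H1 H2 => _ [q' Dq' <-].
by rewrite coordK // => Aq'; exists q'.
Qed.

Lemma coordKr (M : topologicalType) (c : chart R n M) y :
  (coord c @` dom c) y -> coord c (point c y) = y.
Proof. by move=> [q Dq <-]; rewrite coordK. Qed.

Lemma dom_point (M : topologicalType) (c : chart R n M) y :
  (coord c @` dom c) y -> dom c (point c y).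
Proof. by move=> [q Dq <-]; rewrite coordK. Qed.

Lemma open_preimage_on (T U : topologicalType) (W : set T) (V : set U) (f : T -> U) :
  open W -> (forall p, W p -> {for p, continuous f}) -> open V ->
  open (W `&` f @^-1` V).
Proof.
move=> oW cf oV; rewrite openE => p [Wp Vfp]; apply: filterI.
  by apply: open_nbhs_nbhs; split.
by apply: (cf p Wp); apply: open_nbhs_nbhs; split.
Qed.

Variable M : manifold R n.

Lemma smooth_map_read (W : set M) (f : M -> M) (c c' : chart R n M) p :
  open W -> smooth_map W f -> atlas M c -> atlas M c' -> W p -> dom c p -> dom c' (f p) ->
  forall j, smooth_at (coord c p) (fun y => read c c' f y 0 j).
Proof.
move=> oW [cf sf] Ac Ac' Wp Dp Dfp j.
exists (coord c @` (W `&` dom c `&` f @^-1` dom c')); split.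
- apply: chart_image_open; last by move=> q [[]].
  apply: open_preimage_on (dom_open c'); first exact: openI (dom_open c).
  by move=> q [Wq _]; exact: cf.
- by exists p.
- exact: sf.
Qed.

(** Between two other charts, the map reads as F preceded and followed by transition maps of the
    atlas. *)
Lemma smooth_map_chart (c : chart R n M) (U : set 'rV[R]_n) (F : 'rV[R]_n -> 'rV[R]_n) :
  atlas M c -> open U -> U `<=` coord c @` dom c -> F @` U `<=` coord c @` dom c ->
  (forall j, smooth_on U (fun y => F y 0 j)) ->
  smooth_map (dom c `&` coord c @^-1` U) (fun q => point c (F (coord c q))).
Proof.
move=> Ac oU UI FI sF.
have cF y : U y -> {for y, continuous F}.
  by move=> Uy; apply: continuous_coords => l; exact: (Cm_on_cont (sF l 0%N)).
have cfq q : (dom c `&` coord c @^-1` U) q ->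
    {for q, continuous (fun q => point c (F (coord c q)))}.
  move=> [Dq Uq]; apply: (@continuous_comp _ _ _ (coord c) (fun y => point c (F y))).
    exact: coord_continuous.
  apply: continuous_comp; first exact: cF.
  by apply: point_continuous; apply: FI; exists (coord c q).
split=> // c1 c2 Ac1 Ac2 j.
apply: smooth_on_near => _ [q [[[Dq Uq] D1q] D2q] <-].
have sid1 l : smooth_at (coord c1 q) (fun y => read c1 c id y 0 l).
  exists (coord c1 @` (setT `&` dom c1 `&` id @^-1` dom c)); split.
  - apply: chart_image_open; last by move=> p [[]].
    by apply: openI (dom_open c); apply: openI (dom_open c1); exact: openT.
  - by exists q.
  - exact: (atlas_compatible Ac1 Ac).
have Fq : (coord c @` dom c) (F (coord c q)) by apply: FI; exists (coord c q).
have sid2 : smooth_at (F (coord c q)) (fun y => read c c2 id y 0 j).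
  exists (coord c @` (setT `&` dom c `&` id @^-1` dom c2)); split.
  - apply: chart_image_open; last by move=> p [[]].
    by apply: openI (dom_open c2); apply: openI (dom_open c); exact: openT.
  - exists (point c (F (coord c q))); last exact: coordKr.
    by split=> //; split=> //; exact: dom_point.
  - exact: (atlas_compatible Ac Ac2).
have r1 : read c1 c id (coord c1 q) = coord c q by rewrite /read coordK.
have sF1 l : smooth_at (coord c1 q) (fun y => F (read c1 c id y) 0 l).
  apply: (@smooth_at_comp _ _ _ (fun y => F y 0 l)) => //.
  by rewrite r1; exists U.
have : smooth_at (coord c1 q) (fun y => read c c2 id (F (read c1 c id y)) 0 j).
  apply: (@smooth_at_comp _ _ _ (fun y => read c c2 id y 0 j) (fun y => F (read c1 c id y))) => //.
  by rewrite r1.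
by apply: smooth_at_ext; near=> y.
Unshelve. all: by end_near.
Qed.

Lemma local_diffeo_chart (c : chart R n M) (U : set 'rV[R]_n) (F H : 'rV[R]_n -> 'rV[R]_n) :
  atlas M c -> open U -> open (F @` U) ->
  U `<=` coord c @` dom c -> F @` U `<=` coord c @` dom c ->
  (forall j, smooth_on U (fun y => F y 0 j)) ->
  (forall j, smooth_on (F @` U) (fun y => H y 0 j)) ->
  (forall y, U y -> H (F y) = y) ->
  local_diffeo (dom c `&` coord c @^-1` U) (fun q => point c (F (coord c q))).
Proof.
move=> Ac oU oFU UI FI sF sH HF.
have oW V : open V -> open (dom c `&` coord c @^-1` V).
  by apply: open_preimage_on; [exact: dom_open|exact: coord_continuous].
have imW : (fun q => point c (F (coord c q))) @` (dom c `&` coord c @^-1` U) =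
           dom c `&` coord c @^-1` (F @` U).
  apply/seteqP; split=> [_ [q [Dq Uq] <-]|q [Dq [y Uy yq]]].
    have Fq : (coord c @` dom c) (F (coord c q)) by apply: FI; exists (coord c q).
    split; first exact: dom_point.
    by rewrite /preimage /= coordKr //; exists (coord c q).
  have Iy := UI y Uy; exists (point c y).
    by split; [exact: dom_point|rewrite /preimage /= coordKr].
  by rewrite coordKr // yq coordK.
split.
- exact: oW.
- by rewrite imW; exact: oW.
- exact: smooth_map_chart.
- exists (fun q => point c (H (coord c q))).
    rewrite imW; apply: smooth_map_chart => //.
    by move=> _ [_ [y Uy <-] <-]; rewrite HF //; exact: UI.
  move=> q [Dq Uq] /=; rewrite coordKr; last by apply: FI; exists (coord c q).
  by rewrite HF // coordK.
Qed.

End Charts.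

(** * Jets as families of coordinates *)

Section Jets.
Variables (R : realType) (n k : nat).
Local Notation mo := (metric_order k).

(** With the three projections below, this hides the enumeration of [jet_index]: equalities and
    derivatives of jets are checked family by family. *)
Definition mkjet (b : 'I_n -> R) (G : multi_index n mo -> 'I_n -> 'I_n -> R)
    (T : multi_index n k -> 'I_n -> 'I_n -> 'I_n -> R) : jet R n k :=
  \row_u match enum_val u with
         | inl i => b i
         | inr (inl (a, (i, j))) => G a i j
         | inr (inr (a, (b, i, j))) => T a b i j
         end.

Definition jet_base (th : jet R n k) i := th 0 (enum_rank (inl i : jet_index n k)).
Definition jet_metric (th : jet R n k) a i j :=
  th 0 (enum_rank (inr (inl (a, (i, j))) : jet_index n k)).
Definition jet_torsion (th : jet R n k) a b i j :=
  th 0 (enum_rank (inr (inr (a, (b, i, j))) : jet_index n k)).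

Lemma mkjet_base b G T i : jet_base (mkjet b G T) i = b i.
Proof. by rewrite /jet_base mxE enum_rankK. Qed.
Lemma mkjet_metric b G T a i j : jet_metric (mkjet b G T) a i j = G a i j.
Proof. by rewrite /jet_metric mxE enum_rankK. Qed.
Lemma mkjet_torsion b G T a d i j : jet_torsion (mkjet b G T) a d i j = T a d i j.
Proof. by rewrite /jet_torsion mxE enum_rankK. Qed.

Lemma jetP (th th' : jet R n k) :
  (forall i, jet_base th i = jet_base th' i) ->
  (forall a i j, jet_metric th a i j = jet_metric th' a i j) ->
  (forall a b i j, jet_torsion th a b i j = jet_torsion th' a b i j) -> th = th'.
Proof.
move=> E1 E2 E3; apply/rowP => u; rewrite -(enum_valK u).
by case: (enum_val u) => [i|[[a [i j]]|[a [[b i] j]]]]; [exact: E1|exact: E2|exact: E3].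
Qed.

Lemma jet_atE x s : jet_at k x s = mkjet (x 0)
  (fun a i j => mpartial (mi_val a) (fun y => metric s y i j) x)
  (fun a b i j => mpartial (mi_val a) (fun y => torsion s y b i j) x).
Proof. by []. Qed.

Lemma is_derive_jet (gamma : R -> jet R n k) v :
  is_derive (0 : R) (1 : R) gamma v <->
  [/\ (forall i, is_derive (0 : R) (1 : R) (fun t => jet_base (gamma t) i) (jet_base v i)),
      (forall a i j, is_derive (0 : R) (1 : R) (fun t => jet_metric (gamma t) a i j) (jet_metric v a i j)) &
      (forall a b i j, is_derive (0 : R) (1 : R) (fun t => jet_torsion (gamma t) a b i j) (jet_torsion v a b i j))].
Proof.
have key : is_derive (0 : R) (1 : R) gamma v <->
    forall u, is_derive (0 : R) (1 : R) (fun t => gamma t 0 u) (v 0 u).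
  split=> [[dg <-] u|H].
    rewrite derive_mx // mxE; apply: derivableP.
    by move/derivable_mxP: dg; apply.
  have dg : derivable gamma 0 1.
    by apply/derivable_mxP => i u; rewrite ord1; have [] := H u.
  split=> //; rewrite derive_mx //; apply/rowP => u; rewrite mxE.
  exact: (@derive_val _ _ _ _ _ _ _ (H u)).
rewrite key; split=> [H|[H1 H2 H3] u]; first by split=> *; exact: H.
rewrite -(enum_valK u).
by case: (enum_val u) => [i|[[a [i j]]|[a [[b i] j]]]]; [exact: H1|exact: H2|exact: H3].
Qed.

End Jets.

(** * First variation of the transport identities *)

Section Infinitesimal.
Variables (R : realType) (n : nat).
Implicit Types (x y : 'rV[R]_n) (s : structure R n) (X : 'I_n -> 'rV[R]_n -> R).

Definition smooth_structure x s :=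
  (forall i j, smooth_at x (fun y => metric s y i j)) /\
  (forall a i j, smooth_at x (fun y => torsion s y a i j)).

Lemma metric_connection_smooth x s : metric_connection_near x s -> smooth_structure x s.
Proof. by move=> [U [oU Ux sg sT _]]; split=> *; exists U; split. Qed.

(* The Lie derivatives of g and T along X - X(x). *)
Definition lie_metric x s X (i j : 'I_n) y : R :=
  \sum_l (X l y - X l x) * partial l (fun z => metric s z i j) y
  + \sum_a partial i (X a) y * metric s y a j
  + \sum_b metric s y i b * partial j (X b) y.

Definition lie_torsion x s X (a i j : 'I_n) y : R :=
  \sum_l (X l y - X l x) * partial l (fun z => torsion s z a i j) y
  + \sum_b partial i (X b) y * torsion s y a b j
  + \sum_d torsion s y a i d * partial j (X d) y
  - \sum_c partial c (X a) y * torsion s y c i j.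

Lemma jderiv_of_jets (xs : R -> 'rV[R]_n) m phi f g :
  (\forall t \near (0 : R), smooth_at (xs t) (phi t)) ->
  smooth_at (xs 0) f -> smooth_at (xs 0) g ->
  (forall a : multi_index n m,
     is_derive (0 : R) (1 : R) (fun t => mpartial (mi_val a) (phi t) (xs t))
       (mpartial (mi_val a) g (xs 0)) /\
     mpartial (mi_val a) (phi 0) (xs 0) = mpartial (mi_val a) f (xs 0)) ->
  jderiv xs m phi f g.
Proof.
move=> sp sf sg H; split=> // w wm; have [a aw] := mi_of_word wm.
have E h z : smooth_at z h -> wpartial w h z = mpartial (mi_val a) h z.
  move=> sh; rewrite wpartial_mpartial //; congr (mpartial _ h z).
  by apply/funext => i; rewrite aw.
have [H1 H2] := H a; rewrite !E //; last exact: nbhs_singleton sp.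
split=> //; apply: near_is_derive H1; near=> t.
by rewrite E //; near: t.
Unshelve. all: by end_near.
Qed.

Variables (x : 'rV[R]_n) (F : R -> 'rV[R]_n -> 'rV[R]_n) (X : 'I_n -> 'rV[R]_n -> R).
Variable (s0 : structure R n).
Hypothesis F0 : F 0 x = x.
Hypothesis ss0 : smooth_structure x s0.

Let xs t := F t x.

(** Product and chain rules applied at t = 0 to g_t = J_t^T (g'_t o F_t) J_t, where F_0 has the jet
    of the identity. The Jacobian costs one order, whence [m.+1] for F. *)
Lemma jderiv_transport_metric m (s s' : R -> structure R n) (G : 'I_n -> 'I_n -> 'rV[R]_n -> R) :
  (forall l, jderiv (fun=> x) m.+1 (fun t y => F t y 0 l) (fun y => y 0 l) (X l)) ->
  (\forall t \near (0 : R), \forall y \near x,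
     metric (s t) y = (Defs.jacobian (F t) y)^T *m metric (s' t) (F t y) *m Defs.jacobian (F t) y) ->
  (forall i j, jderiv xs m (fun t y => metric (s' t) y i j) (fun y => metric s0 y i j) (G i j)) ->
  forall i j, jderiv (fun=> x) m (fun t y => metric (s t) y i j) (fun y => metric s0 y i j)
     (fun y => G i j y + lie_metric x s0 X i j y).
Proof.
move=> JF tr Js' i j.
have JFm l := jderivW (leqnSn m) (JF l).
have Jc a b := jderiv_comp (fun t => erefl) F0 JFm (Js' a b).
have HS := jderiv_sum (index_enum 'I_n) (fun b => jderivM
  (jderiv_sum (index_enum 'I_n) (fun a => jderivM (jderiv_partial i (JF a)) (Jc a b)))
  (jderiv_partial j (JF b))).
apply: jderiv_ext HS.
- apply: filterS tr => t; apply: filterS => y -> ; rewrite mxE.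
  apply: eq_bigr => b _; rewrite [Defs.jacobian _ _ _ _]mxE mxE; congr (_ * _).
  by apply: eq_bigr => a _; rewrite !mxE.
- near=> y; rewrite sum_partial_coord.
  under eq_bigr do rewrite mulrC; exact: sum_partial_coord.
- near=> y.
  have addS (A B : 'I_n -> R) : \sum_l (A l + B l) = \sum_l A l + \sum_l B l.
    exact: big_split.
  rewrite addS sum_partial_coord addS.
  have E1 : \sum_l partial i (fun z : 'rV[R]_n => z 0 l) y *
     (G l j y + \sum_l0 (X l0 y - X l0 x) * partial l0 (fun z => metric s0 z l j) y)
     = G i j y + \sum_l0 (X l0 y - X l0 x) * partial l0 (fun z => metric s0 z i j) y.
    by under eq_bigr do rewrite mulrC; exact: sum_partial_coord.
  rewrite E1 /lie_metric.
  have E2 : \sum_b (\sum_a partial i (fun z : 'rV[R]_n => z 0 a) y * metric s0 y a b) * partial j (X b) y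
     = \sum_b metric s0 y i b * partial j (X b) y.
    apply: eq_bigr => b _; congr (_ * _).
    by under eq_bigr do rewrite mulrC; exact: sum_partial_coord.
  rewrite E2; ring.
Unshelve. all: by end_near.
Qed.

(** The upper index of T leaves a Jacobian on the left of the transport identity. Rather than
    solving for T, both sides are differentiated and their velocities compared. *)
Lemma jderiv_transport_torsion m (s s' : R -> structure R n)
    (T T' : 'I_n -> 'I_n -> 'I_n -> 'rV[R]_n -> R) :
  (forall l, jderiv (fun=> x) m.+1 (fun t y => F t y 0 l) (fun y => y 0 l) (X l)) ->
  (\forall t \near (0 : R), \forall y \near x, forall a i j : 'I_n,
    \sum_(c < n) Defs.jacobian (F t) y a c * torsion (s t) y c i j =
    \sum_(b < n) \sum_(d < n) torsion (s' t) (F t y) a b d * Defs.jacobian (F t) y b i * Defs.jacobian (F t) y d j) ->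
  (forall a i j, jderiv (fun=> x) m (fun t y => torsion (s t) y a i j) (fun y => torsion s0 y a i j) (T a i j)) ->
  (forall a i j, jderiv xs m (fun t y => torsion (s' t) y a i j) (fun y => torsion s0 y a i j) (T' a i j)) ->
  forall a i j w, (size w <= m)%N ->
    wpartial w (T a i j) x = wpartial w (fun y => T' a i j y + lie_torsion x s0 X a i j y) x.
Proof.
move=> JF tr Js Js' a i j w wm.
have JFm l := jderivW (leqnSn m) (JF l).
have Jc b d := jderiv_comp (fun t => erefl) F0 JFm (Js' a b d).
have HL := jderiv_sum (index_enum 'I_n) (fun c => jderivM (jderiv_partial c (JF a)) (Js c i j)).
have HR := jderiv_sum (index_enum 'I_n) (fun b => jderiv_sum (index_enum 'I_n) (fun d =>
  jderivM (jderivM (Jc b d) (jderiv_partial i (JF b))) (jderiv_partial j (JF d)))).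
(* A and B are the velocities of the two sides. The sum over c in A comes from the Jacobian on the
   left; in B it cancels the last term of [lie_torsion], which is that same contribution moved to
   the right. *)
pose A y := T a i j y + \sum_c partial c (X a) y * torsion s0 y c i j.
pose B y := T' a i j y + (lie_torsion x s0 X a i j y + \sum_c partial c (X a) y * torsion s0 y c i j).
have addS (I J : 'I_n -> R) : \sum_l (I l + J l) = \sum_l I l + \sum_l J l.
  exact: big_split.
have {}HL : jderiv (fun=> x) m
    (fun t y => \sum_c Defs.jacobian (F t) y a c * torsion (s t) y c i j)
    (fun y => torsion s0 y a i j) A.
  apply: jderiv_ext HL.
  - near=> t; near=> y; apply: eq_bigr => c _; by rewrite mxE.
  - near=> y; rewrite (bigD1 a) //= partial_coord /cst eqxx mul1r big1 ?addr0 // => c ca.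
    by rewrite partial_coord /cst eq_sym (negbTE ca) mul0r.
  - near=> y; rewrite addS addrC /A; congr (_ + _).
    rewrite (bigD1 a) //= partial_coord /cst eqxx mul1r big1 ?addr0 // => c ca.
    by rewrite partial_coord /cst eq_sym (negbTE ca) mul0r.
have {}HR : jderiv (fun=> x) m
    (fun t y => \sum_c Defs.jacobian (F t) y a c * torsion (s t) y c i j)
    (fun y => torsion s0 y a i j) B.
  apply: jderiv_ext HR.
  - apply: filterS tr => t; apply: filterS => y ->.
    by apply: eq_bigr => b _; apply: eq_bigr => d _; rewrite !mxE.
  - near=> y; under eq_bigr do rewrite sum_partial_coord.
    exact: sum_partial_coord.
  - near=> y; under eq_bigr do rewrite addS sum_partial_coord.
    rewrite addS addS sum_partial_coord.
    have E1 : \sum_b \sum_d torsion s0 y a b d * partial i (fun z : 'rV[R]_n => z 0 b) y * partial j (X d) y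
      = \sum_d torsion s0 y a i d * partial j (X d) y.
      rewrite exchange_big; apply: eq_bigr => d _.
      by rewrite -mulr_suml sum_partial_coord.
    rewrite E1 /B /lie_torsion.
    have -> : \sum_b partial i (X b) y * torsion s0 y a b j
      = \sum_b torsion s0 y a b j * partial i (X b) y.
      by apply: eq_bigr => b _; rewrite mulrC.
    ring.
have EAB : wpartial w A x = wpartial w B x.
  have [_ sA _ H1] := HL; have [_ _ _ H2] := HR.
  have [D1 _] := H1 w wm; have [D2 _] := H2 w wm.
  by rewrite -(@derive_val _ _ _ _ _ _ _ D1) (@derive_val _ _ _ _ _ _ _ D2).
have sX l : smooth_at x (X l) by have [] := JF l.
have sTT b c d : smooth_at x (fun y => torsion s0 y b c d) := ss0.2 b c d.
have sT : smooth_at x (T a i j) by have [] := Js a i j.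
have sT' : smooth_at x (T' a i j) by have [_ _] := Js' a i j; rewrite /xs F0.
pose C y := \sum_c partial c (X a) y * torsion s0 y c i j.
have sC : smooth_at x C.
  by apply: smooth_at_sum => c; apply: smooth_atM => //; exact: smooth_at_partial.
have sB : smooth_at x B by have [] := HR.
have sL : smooth_at x (fun y => B y - C y) by exact: smooth_atB.
have -> : (fun y => T' a i j y + lie_torsion x s0 X a i j y) = (fun y => B y - C y).
  by apply/funext => y; rewrite /B /C; ring.
have EA : wpartial w (T a i j) x = wpartial w A x - wpartial w C x.
  by rewrite /A wpartialD // addrK.
by rewrite EA EAB wpartialD ?wpartialN //; exact: smooth_atN.
Unshelve. all: by end_near.
Qed.

End Infinitesimal.

(** * Velocities of curves in an orbit *)

Section OrbitTangent.
Variables (R : realType) (n k : nat).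
Local Notation mo := (metric_order k).
Implicit Types (x y : 'rV[R]_n) (s : structure R n) (X : 'I_n -> 'rV[R]_n -> R).

Lemma leq_metric_order : (k <= mo)%N. Proof. by case: k => //= k'. Qed.

(** Jet coordinates are read at the moving point, which has velocity X(x). This replaces X by X -
    X(x) in the Lie derivatives: moving the base point contributes the derivative along the constant
    field X(x). *)
Definition lie_jet x s X : jet R n k :=
  mkjet (fun i => X i x)
    (fun a i j => - mpartial (mi_val a) (lie_metric x s X i j) x)
    (fun a b i j => - mpartial (mi_val a) (lie_torsion x s X b i j) x).

Lemma jet_metric_at x s a i j :
  jet_metric (jet_at k x s) a i j = mpartial (mi_val a) (fun y => metric s y i j) x.
Proof. by rewrite jet_atE mkjet_metric. Qed.

Lemma jet_torsion_at x s a b i j :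
  jet_torsion (jet_at k x s) a b i j = mpartial (mi_val a) (fun y => torsion s y b i j) x.
Proof. by rewrite jet_atE mkjet_torsion. Qed.

Lemma jet_base_at x s i : jet_base (jet_at k x s) i = x 0 i.
Proof. by rewrite jet_atE mkjet_base. Qed.

Lemma smooth_lie_metric x s X i j : smooth_structure x s -> (forall l, smooth_at x (X l)) ->
  smooth_at x (lie_metric x s X i j).
Proof.
move=> [sg sT] sX; apply: smooth_atD; first apply: smooth_atD.
- apply: smooth_at_sum => l; apply: smooth_atM; last exact: smooth_at_partial.
  by apply: smooth_atB => //; exact: smooth_at_cst.
- by apply: smooth_at_sum => l; apply: smooth_atM => //; exact: smooth_at_partial.
- by apply: smooth_at_sum => l; apply: smooth_atM => //; exact: smooth_at_partial.
Qed.

Lemma smooth_lie_torsion x s X a i j : smooth_structure x s -> (forall l, smooth_at x (X l)) ->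
  smooth_at x (lie_torsion x s X a i j).
Proof.
move=> [sg sT] sX; apply: smooth_atB; first apply: smooth_atD; first apply: smooth_atD.
- apply: smooth_at_sum => l; apply: smooth_atM; last exact: smooth_at_partial.
  by apply: smooth_atB => //; exact: smooth_at_cst.
- by apply: smooth_at_sum => l; apply: smooth_atM => //; exact: smooth_at_partial.
- by apply: smooth_at_sum => l; apply: smooth_atM => //; exact: smooth_at_partial.
- by apply: smooth_at_sum => l; apply: smooth_atM => //; exact: smooth_at_partial.
Qed.

Lemma wpartial_taylor m x (d : multi_index n m -> R) a :
  wpartial (word (mi_val a)) (taylor x d) x = d a.
Proof. by rewrite -mpartialE mpartial_taylor. Qed.

(** Serves both inclusions. The sources [s t] may vary with t, but their k-jet at x is constant, so
    their velocity is zero and the differentiated transport identity says that the velocity of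
    [s' t] is minus the Lie derivative. The unknown velocity v is represented by Taylor polynomials
    so that [jderiv] applies to it. The torsion part uses the jet of F only to order k + 1, at most
    the available [mo.+1]. *)
Lemma lie_jet_of_transport x s0 X (F : R -> 'rV[R]_n -> 'rV[R]_n) (s s' : R -> structure R n)
    (v : jet R n k) :
  F 0 x = x -> smooth_structure x s0 ->
  (forall l, jderiv (fun=> x) mo.+1 (fun t y => F t y 0 l) (fun y => y 0 l) (X l)) ->
  (\forall t \near (0 : R), [/\ smooth_structure x (s t), smooth_structure (F t x) (s' t),
      (\forall y \near x, transports (F t) y (s t) (s' t)) & jet_at k x (s t) = jet_at k x s0]) ->
  jet_at k x (s' 0) = jet_at k x s0 ->
  is_derive (0 : R) (1 : R) (fun t => jet_at k (F t x) (s' t)) v ->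
  v = lie_jet x s0 X.
Proof.
move=> F0 ss0 JF ns s'0 /is_derive_jet[Db Dg DT].
have [sg0 sT0] := ss0.
have sX l : smooth_at x (X l) by have [] := JF l.
have Js' i j : jderiv (fun t => F t x) mo (fun t y => metric (s' t) y i j)
    (fun y => metric s0 y i j) (taylor x (fun a => jet_metric v a i j)).
  apply: jderiv_of_jets; rewrite ?F0.
  - by near=> t; have [|_ [+ _] _ _] := near ns t.
  - exact: sg0.
  - exact: smooth_at_taylor.
  - move=> a; rewrite mpartial_taylor; split.
      by have := Dg a i j; under eq_fun do rewrite jet_metric_at.
    by have := congr1 (fun th => jet_metric th a i j) s'0; rewrite /= !jet_metric_at.
have Jt' a i j : jderiv (fun t => F t x) k (fun t y => torsion (s' t) y a i j)
    (fun y => torsion s0 y a i j) (taylor x (fun b => jet_torsion v b a i j)).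
  apply: jderiv_of_jets; rewrite ?F0.
  - by near=> t; have [|_ [_ +] _ _] := near ns t.
  - exact: sT0.
  - exact: smooth_at_taylor.
  - move=> b; rewrite mpartial_taylor; split.
      by have := DT b a i j; under eq_fun do rewrite jet_torsion_at.
    by have := congr1 (fun th => jet_torsion th b a i j) s'0; rewrite /= !jet_torsion_at.
have JT a i j : jderiv (fun=> x) k (fun t y => torsion (s t) y a i j)
    (fun y => torsion s0 y a i j) (cst 0).
  apply: jderiv_of_jets.
  - by near=> t; have [|[_ +] _ _ _] := near ns t.
  - exact: sT0.
  - exact: smooth_at_cst.
  - have E t (b : multi_index n k) : jet_at k x (s t) = jet_at k x s0 -> mpartial (mi_val b) (fun y => torsion (s t) y a i j) x =
      mpartial (mi_val b) (fun y => torsion s0 y a i j) x.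
      by move=> /(congr1 (fun th => jet_torsion th b a i j)); rewrite /= !jet_torsion_at.
    move=> b; split; last by have [_ _ _] := nbhs_singleton ns; exact: E.
    rewrite mpartialE wpartial0.
    apply: (@near_is_derive R (cst (mpartial (mi_val b) (fun y => torsion s0 y a i j) x))).
      by near=> t; rewrite /cst -(E t) //; have [] := near ns t.
have ntm : \forall t \near (0 : R), \forall y \near x,
     metric (s t) y = (Defs.jacobian (F t) y)^T *m metric (s' t) (F t y) *m Defs.jacobian (F t) y.
  by apply: filterS ns => t [_ _ + _]; apply: filterS => y [].
have ntt : \forall t \near (0 : R), \forall y \near x, forall a i j : 'I_n,
    \sum_(c < n) Defs.jacobian (F t) y a c * torsion (s t) y c i j =
    \sum_(b < n) \sum_(d < n) torsion (s' t) (F t y) a b d * Defs.jacobian (F t) y b i * Defs.jacobian (F t) y d j.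
  by apply: filterS ns => t [_ _ + _]; apply: filterS => y [].
apply: jetP => [i|a i j|a b i j].
- rewrite mkjet_base.
  have [_ _ _ /(_ [::] isT)[/= D _]] := JF i.
  have D' : is_derive (0 : R) (1 : R) (fun t => F t x 0 i) (jet_base v i).
    by have := Db i; under eq_fun do rewrite jet_base_at.
  by rewrite -(@derive_val _ _ _ _ _ _ _ D) (@derive_val _ _ _ _ _ _ _ D').
- rewrite mkjet_metric mpartialE.
  have sa := size_mi_word a.
  have [_ _ _ /(_ _ sa)[D _]] := jderiv_transport_metric F0 JF ntm Js' i j.
  have D0 : is_derive (0 : R) (1 : R) (fun t => wpartial (word (mi_val a)) (fun y => metric (s t) y i j) x) 0.
    apply: (@near_is_derive R (cst (wpartial (word (mi_val a)) (fun y => metric s0 y i j) x))).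
      near=> t; have [|_ _ _ Et] := near ns t; first by [].
      have := congr1 (fun th => jet_metric th a i j) Et; rewrite /= !jet_metric_at.
      by rewrite !mpartialE.
  have := @derive_val _ _ _ _ _ _ _ D; rewrite (@derive_val _ _ _ _ _ _ _ D0).
  have sL := smooth_lie_metric i j ss0 sX.
  rewrite (wpartialD _ _ sL); last exact: smooth_at_taylor.
  rewrite wpartial_taylor => /eqP.
  by rewrite eq_sym addr_eq0 => /eqP.
- rewrite mkjet_torsion mpartialE.
  have sa := size_mi_word a.
  have JFk l := jderivW (leq_metric_order : (k < mo.+1)%N) (JF l).
  have := jderiv_transport_torsion F0 ss0 JFk ntt JT Jt' b i j sa.
  have sL := smooth_lie_torsion b i j ss0 sX.
  rewrite wpartial0 (wpartialD _ _ sL); last exact: smooth_at_taylor.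
  rewrite wpartial_taylor => /eqP.
  by rewrite eq_sym addr_eq0 => /eqP.
Unshelve. all: by end_near.
Qed.

Definition field_of x (C : 'I_n -> multi_index n mo.+1 -> R) (l : 'I_n) := taylor x (C l).

Lemma read_id (M : topologicalType) (c : chart R n M) x :
  (coord c @` dom c) x -> {near x, read c c id =1 id}.
Proof.
move=> Ix; apply: filterS (open_near (@image_open _ _ _ c) Ix) => y Iy.
exact: coordKr.
Qed.

Lemma orbit_tangent_lie (M : manifold R n) (c : chart R n M) x s0 v :
  atlas M c -> smooth_structure x s0 -> orbit_tangent c (jet_at k x s0) v ->
  exists C, v = lie_jet x s0 (field_of x C).
Proof.
move=> Ac ss0 [p [f [gamma [[f0 g0] Hact Hder Dg]]]].
have [_ Dp _ [s1 [s1' [_ _ _ E1 _]]]] := nbhs_singleton Hact.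
have xp : coord c p = x.
  apply/rowP => i; have := congr1 (fun th => jet_base th i) E1.
  by rewrite /= !jet_base_at => ->.
subst x.
have Ip : (coord c @` dom c) (coord c p) by exists p.
(* [acts] provides representatives separately for each t; they are chosen for all t at once, with
   the default [(s0, s0)] where [acts] fails, which does not happen near t = 0. *)
have /boolp.choice[S HS] : forall t, exists S : structure R n * structure R n,
    acts c c (f t) p (jet_at k (coord c p) s0) (gamma t) ->
    [/\ metric_connection_near (coord c p) S.1,
        metric_connection_near (coord c (f t p)) S.2,
        (\forall y \near coord c p, transports (read c c (f t)) y S.1 S.2),
        jet_at k (coord c p) s0 = jet_at k (coord c p) S.1 &
        gamma t = jet_at k (coord c (f t p)) S.2].
  move=> t.
  have [A|nA] := pselect (acts c c (f t) p (jet_at k (coord c p) s0) (gamma t)); last by exists (s0, s0).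
  by have [_ _ _ [s [s' [H1 H2 H3 H4 H5]]]] := A; exists (s, s').
pose F t := read c c (f t).
have Fx t : F t (coord c p) = coord c (f t p) by rewrite /F /read coordK.
have F0 : F 0 (coord c p) = coord c p by rewrite Fx f0.
have sF : \forall t \near (0 : R), forall l, smooth_at (coord c p) (fun y => F t y 0 l).
  apply: filterS Hact => t [[W [oW _ sm _] Wp] _ Dfp _].
  exact: (smooth_map_read oW sm Ac Ac Wp Dp Dfp).
(* The field X is the velocity of f_t: its coefficients are the t-derivatives at 0 of the partial
   derivatives of f_t at the base point, which exist by definition of the orbit tangent. *)
pose C l (a : multi_index n mo.+1) :=
  'D_1 (fun t : R => mpartial (mi_val a) (fun y => F t y 0 l) (coord c p)) 0.
exists C; apply: (@lie_jet_of_transport _ _ _ F (fun t => (S t).1) (fun t => (S t).2)) => //.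
- move=> l; apply: jderiv_of_jets.
  + by apply: filterS sF => t; apply.
  + exact: smooth_at_coord.
  + exact: smooth_at_taylor.
  + move=> a; rewrite mpartial_taylor; split.
      by apply: derivableP; exact: Hder.
    rewrite !mpartialE; apply: wpartial_near; rewrite /F f0.
    by apply: filterS (read_id Ip) => y ->.
- apply: filterS Hact => t /HS[H1 H2 H3 H4 H5]; split=> //.
  + exact: metric_connection_smooth.
  + by rewrite Fx; exact: metric_connection_smooth.
- have [_ _ _ _] := HS 0 (nbhs_singleton Hact).
  by rewrite f0 g0 => ->.
- apply: near_eq_is_derive Dg.
  by apply: filterS Hact => t /HS[_ _ _ _ ->]; rewrite Fx.
Qed.

End OrbitTangent.

(** * Lie derivatives are tangent to the orbits *)

Section JetDerivability.
Variables (R : realType) (n : nat).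
Implicit Types (x y : 'rV[R]_n) (xs : R -> 'rV[R]_n).
Implicit Types (phi psi : R -> 'rV[R]_n -> R).

(** Counterpart of [jderiv] that asserts existence of the derivatives without giving their values.
    Inverse Jacobians can be handled in it without any formula for their variation. *)
Definition jderivable xs m phi :=
  (\forall t \near (0 : R), smooth_at (xs t) (phi t)) /\
  forall w, (size w <= m)%N ->
    derivable (fun t : R => wpartial w (phi t) (xs t) : R) 0 1.

Lemma jderivableW xs m m' phi : (m' <= m)%N -> jderivable xs m phi -> jderivable xs m' phi.
Proof. by move=> mm [sp H]; split=> // w wm; apply: H; exact: leq_trans mm. Qed.

Lemma jderiv_jderivable xs m phi f g : jderiv xs m phi f g -> jderivable xs m phi.
Proof. by move=> [sp _ _ H]; split=> // w /H[[]]. Qed.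

Lemma near_derivable (u v : R -> R) : {near 0, u =1 v} ->
  derivable u 0 1 -> derivable v 0 1.
Proof. exact: near_eq_derivable. Qed.

Lemma jderivable_partial xs m phi i : jderivable xs m.+1 phi ->
  jderivable xs m (fun t => partial i (phi t)).
Proof.
move=> [sp H]; split; first by apply: filterS sp => t; exact: smooth_at_partial.
move=> w wm; have := H (rcons w i); rewrite size_rcons wpartial_rcons_fun.
by apply.
Qed.

Lemma jderivableS xs m phi : jderivable xs 0 phi ->
  (forall i, jderivable xs m (fun t => partial i (phi t))) -> jderivable xs m.+1 phi.
Proof.
move=> [sp H0] H; split=> // w; case/lastP: w => [_|w i]; first exact: H0.
rewrite size_rcons ltnS => wm; have [_ /(_ w wm)] := H i.
by rewrite wpartial_rcons_fun.
Qed.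

Lemma jderivable_ext xs m phi psi :
  (\forall t \near (0 : R), {near xs t, phi t =1 psi t}) ->
  jderivable xs m phi -> jderivable xs m psi.
Proof.
move=> E [sp H]; split.
  by near=> t; apply: (@smooth_at_ext _ _ _ (phi t)); near: t.
move=> w /H; apply: near_derivable; near=> t.
by apply: wpartial_near; near: t.
Unshelve. all: by end_near.
Qed.

Lemma jderivable_const x m f : smooth_at x f -> jderivable (fun=> x) m (fun=> f).
Proof.
move=> sf; split; first by exists 1 => //=.
by move=> w _; exact: derivable_cst.
Qed.

Lemma jderivableD xs m phi psi : jderivable xs m phi -> jderivable xs m psi ->
  jderivable xs m (fun t y => phi t y + psi t y).
Proof.
move=> [sp H] [sp' H']; split; first by near=> t; apply: smooth_atD; near: t.
move=> w wm; apply: near_derivable (derivableD (H w wm) (H' w wm)).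
by near=> t; rewrite wpartialD //; near: t.
Unshelve. all: by end_near.
Qed.

Lemma jderivableM xs m phi psi : jderivable xs m phi -> jderivable xs m psi ->
  jderivable xs m (fun t y => phi t y * psi t y).
Proof.
elim: m phi psi => [|m IH] phi psi Hp Hq.
  have [sp H] := Hp; have [sp' H'] := Hq; split.
    by near=> t; apply: smooth_atM; near: t.
  by case=> // _; exact: (derivableM (H [::] isT) (H' [::] isT)).
have Wp := jderivableW (leqnSn m) Hp; have Wq := jderivableW (leqnSn m) Hq.
apply: jderivableS; first exact: jderivableW (IH _ _ Wp Wq).
move=> i.
apply: jderivable_ext (jderivableD (IH _ _ (jderivable_partial i Hp) Wq)
                                   (IH _ _ Wp (jderivable_partial i Hq))).
have [sp _] := Hp; have [sp' _] := Hq.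
near=> t.
have s1 : smooth_at (xs t) (phi t) by near: t.
have s2 : smooth_at (xs t) (psi t) by near: t.
by apply: filterS (partialM_near i s1 s2) => y ->.
Unshelve. all: by end_near.
Qed.

Lemma partialV_near x (f : 'rV[R]_n -> R) i : smooth_at x f -> f x != 0 ->
  {near x, partial i (fun y => (f y)^-1) =1
     (fun y => -1 * (partial i f y * ((f y)^-1 * (f y)^-1)))}.
Proof.
move=> sf f0.
have nf : \forall y \near x, f y != 0 by exact: (cvgr_neq0 _ (smooth_at_cont sf) f0).
have ns := smooth_at_near sf.
near=> y.
have fy : f y != 0 by near: y.
have sy : smooth_at y f by near: y.
rewrite /partial (deriveV fy (smooth_at_derivable sy)) mulN1r expr2 invfM scaleNr.
by congr (- _); exact: mulrC.
Unshelve. all: by end_near.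
Qed.

Lemma jderivableV xs m phi : phi 0 (xs 0) != 0 -> jderivable xs m phi ->
  jderivable xs m (fun t y => (phi t y)^-1).
Proof.
move=> p0.
have n0 m' : jderivable xs m' phi -> \forall t \near (0 : R), phi t (xs t) != 0.
  move=> [_ /(_ [::] isT) /= d].
  have c := differentiable_continuous ((derivable1_diffP _ _).1 d).
  exact: (cvgr_neq0 _ c p0).
elim: m => [|m IH] Hp.
  have [sp H] := Hp; have np := n0 _ Hp; split.
    by near=> t; apply: smooth_atV; near: t.
  by case=> // _; exact: (derivableV p0 (H [::] isT)).
have Wp := jderivableW (leqnSn m) Hp; have IV := IH Wp.
apply: jderivableS; first exact: jderivableW IV.
move=> i.
have [sp _] := Hp; have np := n0 _ Hp.
have HM := jderivableM (jderivable_partial i Hp) (jderivableM IV IV).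
have HN : jderivable xs m (fun t y => -1 * (partial i (phi t) y * ((phi t y)^-1 * (phi t y)^-1))).
  have [s H] := HM; split.
    by apply: filterS s => t; exact: smooth_atZ.
  move=> w wm; apply: near_derivable (derivableZ (k := -1) (H w wm)).
  by near=> t; rewrite wpartialZ //; near: t.
apply: jderivable_ext HN; near=> t.
have s1 : smooth_at (xs t) (phi t) by near: t.
have s2 : phi t (xs t) != 0 by near: t.
by apply: filterS (partialV_near i s1 s2) => y ->.
Unshelve. all: by end_near.
Qed.

Lemma jderivable_sum xs m (I : Type) (r : seq I) (phi : I -> R -> 'rV[R]_n -> R) :
  (\forall t \near (0 : R), smooth_at (xs t) (cst (0 : R))) ->
  (forall i, jderivable xs m (phi i)) ->
  jderivable xs m (fun t y => \sum_(i <- r) phi i t y).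
Proof.
move=> s0 H; elim: r => [|i r IH].
  have -> : (fun (t : R) (y : 'rV[R]_n) => \sum_(i <- [::]) phi i t y) = (fun _ => cst 0).
    by apply/funext => t; apply/funext => y; rewrite big_nil.
  split=> // w _; have -> : (fun t => wpartial w (cst 0) (xs t)) = cst (0 : R).
    by apply/funext => t; rewrite wpartial0.
  exact: derivable_cst.
have -> : (fun (t : R) (y : 'rV[R]_n) => \sum_(j <- i :: r) phi j t y) =
          (fun t y => phi i t y + \sum_(j <- r) phi j t y).
  by apply/funext => t; apply/funext => y; rewrite big_cons.
exact: jderivableD.
Qed.

(* Chain rule read backwards: the jets of [phi t] at the moving point are
   recovered from those of [phi t \o F t] at [x]. *)
Lemma jderivable_comp_inv x m (F : R -> 'rV[R]_n -> 'rV[R]_n)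
    (K : 'I_n -> 'I_n -> R -> 'rV[R]_n -> R) phi :
  (\forall t \near (0 : R), forall l, smooth_at x (fun y => F t y 0 l)) ->
  (\forall t \near (0 : R), \forall y \near x, forall l k,
     \sum_i partial i (fun z => F t z 0 l) y * K i k t y = (l == k)%:R) ->
  (forall i k, jderivable (fun=> x) m (K i k)) ->
  (\forall t \near (0 : R), smooth_at (F t x) (phi t)) ->
  jderivable (fun=> x) m (fun t y => phi t (F t y)) ->
  jderivable (fun t => F t x) m phi.
Proof.
move=> sF HK; elim: m phi => [|m IH] phi JK sp Hc.
  by split=> // -[|//] _; have [_ /(_ [::] isT)] := Hc.
apply: jderivableS.
  by split=> // -[|//] _; have [_ /(_ [::] isT)] := Hc.
move=> k; have JK' i l := jderivableW (leqnSn m) (JK i l).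
apply: IH => //; first by apply: filterS sp => t; exact: smooth_at_partial.
(* K inverts the Jacobian of F, so (d_k phi) o F is the sum over i of d_i(phi o F) times K_ik, a
   combination known to order m; the induction then applies to d_k phi. *)
have HS : jderivable (fun=> x) m (fun t y => \sum_i partial i (fun z => phi t (F t z)) y * K i k t y).
  apply: jderivable_sum; first by exists 1 => //= t _; exact: smooth_at_cst.
  by move=> i; apply: jderivableM => //; exact: (jderivable_partial i Hc).
apply: jderivable_ext HS; near=> t.
have s1 : forall l, smooth_at x (fun y => F t y 0 l) by near: t.
have s2 : smooth_at (F t x) (phi t) by near: t.
have hk : \forall y \near x, forall l k,
     \sum_i partial i (fun z => F t z 0 l) y * K i k t y = (l == k)%:R by near: t.
have hp : \forall y \near x, forall i, partial i (fun z => phi t (F t z)) y =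
    \sum_l partial l (phi t) (F t y) * partial i (fun z => F t z 0 l) y.
  apply: (@filter_forall 'rV[R]_n 'I_n (fun i y => partial i (fun z => phi t (F t z)) y =
    \sum_l partial l (phi t) (F t y) * partial i (fun z => F t z 0 l) y) (nbhs x) (nbhs_filter _)) => i.
  exact: partial_comp_near.
near=> y.
have hky := near hk y; have hpy := near hp y.
under eq_bigr do rewrite (near hp y) // mulr_suml.
rewrite exchange_big /=.
under eq_bigr do under eq_bigr do rewrite -mulrA.
under eq_bigr do rewrite -mulr_sumr (near hk y) //.
rewrite (bigD1 k) //= eqxx mulr1 big1 ?addr0 // => l /negbTE ->.
by rewrite mulr0.
Unshelve. all: by end_near.
Qed.

Lemma jderivable_cramer x m p (A : R -> 'rV[R]_n -> 'M[R]_p) :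
  \det (A 0 x) != 0 ->
  (forall i j, jderivable (fun=> x) m (fun t y => A t y i j)) ->
  forall i j, jderivable (fun=> x) m (fun t y => cramer_inv (A t y) i j).
Proof.
move=> A0 JA i j.
(* The families are seen as functions of the pair (t, y), so that the closure of such classes under
   determinants and cofactors applies. *)
pose P (f : R * 'rV[R]_n -> R) := jderivable (fun=> x) m (fun t y => f (t, y)).
have Pc c : P (cst c) by exact: (@jderivable_const x m (cst c) (smooth_at_cst x c)).
have PD f g : P f -> P g -> P (fun u => f u + g u) by exact: jderivableD.
have PM f g : P f -> P g -> P (fun u => f u * g u) by exact: jderivableM.
have PA k l : P (fun u => A u.1 u.2 k l) by exact: JA.
have Pdet := closed_det Pc PD PM PA.
have Padj := closed_adj Pc PD PM PA.
rewrite /cramer_inv.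
have -> : (fun (t : R) (y : 'rV[R]_n) => ((\det (A t y))^-1 *: \adj (A t y)) i j) =
  (fun t y => (\det (A t y))^-1 * (\adj (A t y)) i j).
  by apply/funext => t; apply/funext => y; rewrite mxE.
by apply: jderivableM; [exact: jderivableV|exact: Padj].
Qed.

Lemma smooth_at_cramer x p (A : 'rV[R]_n -> 'M[R]_p) : A x \in unitmx ->
  (forall i j, smooth_at x (fun y => A y i j)) ->
  forall i j, smooth_at x (fun y => cramer_inv (A y) i j).
Proof.
move=> A0 sA i j.
have D f g := @smooth_atD R n x f g; have M f g := @smooth_atM R n x f g.
rewrite /cramer_inv; under eq_fun do rewrite mxE.
apply: smooth_atM; last exact: (closed_adj (@smooth_at_cst R n x) D M).
apply: smooth_atV; first by rewrite -unitfE -unitmxE.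
exact: (closed_det (@smooth_at_cst R n x) D M).
Qed.

End JetDerivability.

(** * Pushing a structure forward along a local diffeomorphism *)

Section Pushforward.
Variables (R : realType) (n : nat).
Implicit Types (x y z : 'rV[R]_n) (s : structure R n) (F H : 'rV[R]_n -> 'rV[R]_n).

Definition connection_on (U : set 'rV[R]_n) s :=
  [/\ (forall y, U y -> smooth_structure y s) &
      forall y, U y ->
        [/\ (metric s y)^T = metric s y,
            metric s y \in unitmx &
            forall a i j, torsion s y a i j = - torsion s y a j i]].

Lemma connection_on_near U x s : open U -> U x -> connection_on U s -> metric_connection_near x s.
Proof.
move=> oU Ux [ss H]; exists U; split=> // *; apply: smooth_on_near => y Uy;
  by have [] := ss y Uy.
Qed.

Lemma near_connection_on x s : metric_connection_near x s ->
  exists U, [/\ open U, U x & connection_on U s].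
Proof.
move=> [U [oU Ux sg sT H]]; exists U; split=> //; split=> // y Uy.
by split=> *; exists U.
Qed.

(** Here H is meant to invert F. The inverse of the Jacobian of F, taken at H(z), stands in for the
    Jacobian of H, so that only F is differentiated. *)
Definition pushforward F H s : structure R n :=
  Structure
    (fun z => (cramer_inv (Defs.jacobian F (H z)))^T *m metric s (H z)
              *m cramer_inv (Defs.jacobian F (H z)))
    (fun z a i j => \sum_c \sum_e \sum_f
       Defs.jacobian F (H z) a c * torsion s (H z) c e f
       * cramer_inv (Defs.jacobian F (H z)) e i * cramer_inv (Defs.jacobian F (H z)) f j).

Lemma pushforward_transports F H s y : H (F y) = y -> Defs.jacobian F y \in unitmx ->
  transports F y s (pushforward F H s).
Proof.
move=> HF Ju; rewrite /transports /= HF cramer_invE //.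
set J := Defs.jacobian F y; split.
  by rewrite !mulmxA -trmx_mul mulVmx // trmx1 mul1mx -mulmxA mulVmx // mulmx1.
move=> a i j.
have KJ e l : \sum_b invmx J e b * J b l = (e == l)%:R.
  by have := congr1 (fun A : 'M[R]_n => A e l) (mulVmx Ju); rewrite !mxE.
(* Kronecker deltas are inserted for the two lower indices, and each is then expanded as an entry of
   the product of the inverse Jacobian with the Jacobian. *)
transitivity (\sum_c \sum_e \sum_f J a c * torsion s y c e f * (e == i)%:R * (f == j)%:R).
  apply: eq_bigr => c _; rewrite (bigD1 i) //= (bigD1 j) //= !eqxx !mulr1 !big1 ?addr0 //.
    by move=> e /negbTE ->; rewrite big1 // => f _; rewrite mulr0 mul0r.
  by move=> f /negbTE ->; rewrite mulr0.
transitivity (\sum_c \sum_e \sum_f \sum_b \sum_d J a c * torsion s y c e f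
    * (invmx J e b * J b i) * (invmx J f d * J d j)).
  apply: eq_bigr => c _; apply: eq_bigr => e _; apply: eq_bigr => f _.
  rewrite -(KJ e i) mulr_sumr mulr_suml; apply: eq_bigr => b _.
  by rewrite -(KJ f j) mulr_sumr.
have exch (G : 'I_n -> 'I_n -> 'I_n -> 'I_n -> R) :
    \sum_c \sum_e \sum_f \sum_b G c e f b = \sum_b \sum_c \sum_e \sum_f G c e f b.
  rewrite [RHS]exchange_big; apply: eq_bigr => c _.
  rewrite [RHS]exchange_big; apply: eq_bigr => e _.
  exact: exchange_big.
rewrite exch; apply: eq_bigr => b _.
rewrite exch; apply: eq_bigr => d _.
rewrite !mulr_suml; apply: eq_bigr => c _.
rewrite !mulr_suml; apply: eq_bigr => e _.
rewrite !mulr_suml; apply: eq_bigr => f _.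
ring.
Qed.

Lemma smooth_jacobian F y i j : (forall l, smooth_at y (fun z => F z 0 l)) ->
  smooth_at y (fun z => Defs.jacobian F z i j).
Proof. by move=> sF; under eq_fun do rewrite mxE; exact: smooth_at_partial. Qed.

Lemma pushforward_connection (B : set 'rV[R]_n) F H s :
  open B -> open (F @` B) -> connection_on B s ->
  (forall l, smooth_on B (fun y => F y 0 l)) ->
  (forall l, smooth_on (F @` B) (fun y => H y 0 l)) ->
  (forall y, B y -> H (F y) = y) ->
  (forall y, B y -> Defs.jacobian F y \in unitmx) ->
  connection_on (F @` B) (pushforward F H s).
Proof.
move=> oB oFB [ss Hs] sF sH HF Ju.
split=> _ [y By <-]; have HFy := HF y By; have Juy := Ju y By; last first.
  have [g1 g2 T1] := Hs y By; rewrite /= HFy; split.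
  - by rewrite !trmx_mul trmxK g1 mulmxA.
  - by rewrite !unitmx_mul unitmx_tr g2 cramer_invE // unitmx_inv Juy.
  - move=> a i j; rewrite -sumrN; apply: eq_bigr => c _.
    rewrite exchange_big -sumrN; apply: eq_bigr => e _.
    rewrite -sumrN; apply: eq_bigr => f _ /=.
    by rewrite T1 mulrN !mulNr mulrAC.
have sFy l : smooth_at y (fun z => F z 0 l) by exists B.
have sHy l : smooth_at (F y) (fun z => H z 0 l).
  by exists (F @` B); split=> //; exists y.
have comp h : smooth_at y h -> smooth_at (F y) (fun z => h (H z)).
  by move=> sh; apply: smooth_at_comp => //; rewrite HFy.
have sJ i j : smooth_at y (fun z => Defs.jacobian F z i j) by exact: smooth_jacobian.
have sK i j : smooth_at y (fun z => cramer_inv (Defs.jacobian F z) i j).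
  exact: smooth_at_cramer.
have [sg sT] := ss y By.
split=> [i j|a i j] /=.
  apply: (comp (fun y => ((cramer_inv (Defs.jacobian F y))^T *m metric s y
              *m cramer_inv (Defs.jacobian F y)) i j)).
  under eq_fun do rewrite mxE; apply: smooth_at_sum => b; apply: smooth_atM => //.
  under eq_fun do rewrite mxE; apply: smooth_at_sum => c; apply: smooth_atM => //.
  by under eq_fun do rewrite mxE.
apply: (comp (fun y => \sum_c \sum_e \sum_f
       Defs.jacobian F y a c * torsion s y c e f
       * cramer_inv (Defs.jacobian F y) e i * cramer_inv (Defs.jacobian F y) f j)).
apply: smooth_at_sum => c; apply: smooth_at_sum => e; apply: smooth_at_sum => f.
by do 3 (apply: smooth_atM => //).
Qed.

End Pushforward.

(** * The maps id + t X *)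

Section Flow.
Variables (R : realType) (n : nat).
Implicit Types (x y z : 'rV[R]_n) (X : 'I_n -> 'rV[R]_n -> R).

(** It has the same velocity at t = 0 as the flow of X, which is all that matters here, and its
    derivatives are affine in t; no differential equation has to be solved. *)
Definition shift_map X (t : R) y : 'rV[R]_n := \row_l (y 0 l + t * X l y).

Lemma shift_mapE X t y l : shift_map X t y 0 l = y 0 l + t * X l y.
Proof. by rewrite mxE. Qed.

Variable X : 'I_n -> 'rV[R]_n -> R.
Hypothesis sX : forall l y, smooth_at y (X l).

Lemma smooth_shift_map t y l : smooth_at y (fun z => shift_map X t z 0 l).
Proof.
under eq_fun do rewrite shift_mapE.
apply: smooth_atD; [exact: smooth_at_coord|exact: smooth_atZ].
Qed.

Lemma wpartial_shift_map w t y l : wpartial w (fun z => shift_map X t z 0 l) y =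
  wpartial w (fun z => z 0 l) y + t * wpartial w (X l) y.
Proof.
under eq_fun do rewrite shift_mapE.
rewrite wpartialD; [|exact: smooth_at_coord|exact: smooth_atZ].
by rewrite wpartialZ.
Qed.

Lemma affine_is_derive (a b : R) : is_derive (0 : R) (1 : R) (fun t => a + t * b) b.
Proof.
have D1 := is_deriveM (is_derive_id (0 : R) (1 : R)) (is_derive_cst b (0 : R) (1 : R)).
have := is_deriveD (is_derive_cst a (0 : R) (1 : R)) D1.
by rewrite scaler0 !add0r [_%:A]mulr1.
Qed.

Lemma jderiv_shift_map x m l :
  jderiv (fun=> x) m (fun t y => shift_map X t y 0 l) (fun y => y 0 l) (X l).
Proof.
split.
- by exists 1 => //= t _; exact: smooth_shift_map.
- exact: smooth_at_coord.
- exact: sX.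
- move=> w _; under eq_fun do rewrite wpartial_shift_map.
  split; first exact: affine_is_derive.
  by rewrite wpartial_shift_map mul0r addr0.
Qed.

Lemma field_lipschitz x (V : set 'rV[R]_n) : open V -> V x ->
  exists r L : R, [/\ 0 < r, 0 <= L, ball x r `<=` V &
    forall l y z, ball x r y -> ball x r z -> `|X l y - X l z| <= L * `|y - z|].
Proof.
move=> oV Vx.
(* C exceeds by at least 1 the absolute value of every partial derivative at x, hence bounds all of
   them near x by continuity. *)
pose C : R := 1 + \sum_l \sum_i `|partial i (X l) x|.
have C0 : 0 <= C by rewrite addr_ge0 // sumr_ge0 // => l _; rewrite sumr_ge0.
have nC : \forall y \near x, forall l i, `|partial i (X l) y| <= C.
  apply: (@filter_forall 'rV[R]_n 'I_n (fun l y => forall i, `|partial i (X l) y| <= C) (nbhs x) (nbhs_filter _)) => l.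
  apply: (@filter_forall 'rV[R]_n 'I_n (fun i y => `|partial i (X l) y| <= C) (nbhs x) (nbhs_filter _)) => i.
  have /cvgrPdist_le /(_ 1 ltr01) := smooth_at_cont (smooth_at_partial i (sX l x)).
  apply: filterS => y Hy.
  apply: (@le_trans _ _ (1 + `|partial i (X l) x|)).
    have := ler_normB (partial i (X l) x) (partial i (X l) x - partial i (X l) y).
    rewrite opprB addrC subrK; lra.
  rewrite lerD2l (bigD1 l) //= (bigD1 i) //= -addrA lerDl addr_ge0 // ?sumr_ge0 //.
  by move=> k _; rewrite sumr_ge0.
have nVC : \forall y \near x, V y /\ forall l i, `|partial i (X l) y| <= C.
  exact: filterI (open_near oV Vx) nC.
move/nbhs_ballP: nVC => [r /= r0 Hr].
exists r, (n%:R * C); split=> //.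
- by rewrite mulr_ge0.
- by move=> y /Hr[].
- move=> l y z By Bz; apply: (lipschitz_ball C0 _ Bz By) => w /Hr[_ Hw] i.
  by split=> //; exact: smooth_at_derivable.
Qed.

(** If L is a Lipschitz constant of X near x, then t X is 1/2-Lipschitz as soon as |t| L <= 1/2, and
    the inverse function theorem applies. The ball depends on t: it is shrunk so that its image also
    stays in V. *)
Lemma shift_map_diffeo x (V : set 'rV[R]_n) : open V -> V x ->
  \forall t \near (0 : R), exists r H, let B := ball x r in
    [/\ 0 < r /\ B `<=` V, shift_map X t @` B `<=` V /\ open (shift_map X t @` B),
        forall y, B y -> H (shift_map X t y) = y,
        forall l, smooth_on (shift_map X t @` B) (fun z => H z 0 l) &
        forall y, B y -> Defs.jacobian (shift_map X t) y \in unitmx].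
Proof.
move=> oV Vx; have [r0 [L [r00 L0 r0V HL]]] := field_lipschitz oV Vx.
have nV : \forall t \near (0 : R), V (shift_map X t x).
  have c : shift_map X t x @[t --> (0 : R)] --> x.
    have -> : shift_map X ^~ x = (fun t => x + t *: (\row_l X l x)).
      by apply/funext => t; apply/rowP => l; rewrite !mxE.
    rewrite -[X in _ --> X]addr0 -(scale0r (\row_l X l x)).
    apply: cvgD; first exact: cvg_cst.
    exact: scalel_continuous.
  by apply: c; exact: open_near.
have nt : \forall t \near (0 : R), `|t| * L <= 2^-1.
  apply/nbhs_ballP; exists (2^-1 / (1 + L)) => /=.
    by rewrite divr_gt0 ?invr_gt0 // ltr_pwDl.
  move=> t; rewrite -ball_normE /= sub0r normrN ltr_pdivlMr ?ltr_pwDl // => /ltW.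
  by apply: le_trans; rewrite ler_wpM2l // lerDr.
near=> t.
have Vt : V (shift_map X t x) by near: t.
have tL : `|t| * L <= 2^-1 by near: t.
have cF : {for x, continuous (shift_map X t)}.
  by apply: continuous_coords => l; exact: smooth_at_cont (smooth_shift_map t x l).
have : \forall y \near x, V (shift_map X t y) by apply: cF; exact: open_near.
move=> /nbhs_ballP[r1 /= r10 Hr1].
pose r := Num.min r0 r1.
have rp : 0 < r by rewrite lt_min r00 r10.
have B0 : ball x r `<=` ball x r0 by apply: le_ball; rewrite ge_min lexx.
have B1 : ball x r `<=` ball x r1 by apply: le_ball; rewrite ge_min lexx orbT.
have sF l : smooth_on (ball x r) (fun y => shift_map X t y 0 l).
  by apply: smooth_on_all => y; exact: smooth_shift_map.
have FB y z : ball x r y -> ball x r z ->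
    `|shift_map X t y - y - (shift_map X t z - z)| <= 2^-1 * `|y - z|.
  move=> By Bz; apply: rV_norm_le; first by rewrite mulr_ge0 ?invr_ge0.
  move=> l; rewrite !mxE.
  have -> : y 0 l + t * X l y - y 0 l - (z 0 l + t * X l z - z 0 l) = t * (X l y - X l z) by ring.
  rewrite normrM; apply: (@le_trans _ _ (`|t| * (L * `|y - z|))).
    by rewrite ler_wpM2l // HL //; exact: B0.
  by rewrite mulrA ler_wpM2r.
have [H [HF sH]] := inverse_function sF FB.
exists r, H; split=> //.
- by split=> // y /B0/r0V.
- split; last exact: (open_image FB).
  by move=> _ [y /B1/Hr1 ? <-].
- by move=> y By; exact: (jacobian_unit sF FB By).
Unshelve. all: by end_near.
Qed.

End Flow.

(** * Curves of local diffeomorphisms with prescribed velocity *)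

Section OrbitTangentConverse.
Variables (R : realType) (n k : nat).
Local Notation mo := (metric_order k).
Implicit Types (x y : 'rV[R]_n) (s : structure R n) (X : 'I_n -> 'rV[R]_n -> R).

Lemma local_diffeo_id (M : manifold R n) (c : chart R n M) :
  local_diffeo (dom c) (id : M -> M).
Proof.
have sm W : smooth_map W (id : M -> M).
  split=> [p _|c1 c2 A1 A2 j]; first exact: cvg_id.
  move=> m; apply: Cm_on_sub (atlas_compatible A1 A2 j m).
  by move=> _ [q [[_ q1] q2] <-]; exists q.
split; [exact: dom_open| |exact: sm|].
  by rewrite image_id; exact: dom_open.
by exists id => // p.
Qed.

Lemma jacobian_near (F G : 'rV[R]_n -> 'rV[R]_n) y : {near y, F =1 G} ->
  Defs.jacobian F y = Defs.jacobian G y.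
Proof.
move=> E; apply/matrixP => a i; rewrite !mxE; apply: partial_near.
by apply: filterS E => z ->.
Qed.

Lemma transports_near (F G : 'rV[R]_n -> 'rV[R]_n) y s s' : {near y, F =1 G} ->
  transports F y s s' -> transports G y s s'.
Proof.
move=> E; rewrite /transports (jacobian_near E).
by rewrite (nbhs_singleton E).
Qed.

Lemma jacobian_id y : Defs.jacobian (id : 'rV[R]_n -> 'rV[R]_n) y = 1%:M.
Proof. by apply/matrixP => a i; rewrite !mxE partial_coord. Qed.

Lemma transports_id y s : transports (id : 'rV[R]_n -> 'rV[R]_n) y s s.
Proof.
rewrite /transports jacobian_id trmx1 mul1mx mulmx1; split=> // a i j.
rewrite (bigD1 a) //= mxE eqxx mul1r big1 => [|c /negbTE ca]; last first.
  by rewrite mxE eq_sym ca mul0r.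
rewrite addr0 (bigD1 i) //= (bigD1 j) //= !mxE !eqxx !mulr1 !big1 ?addr0 //.
  by move=> b /negbTE bi; rewrite big1 // => d _; rewrite mxE bi mulr0 mul0r.
by move=> d /negbTE dj; rewrite mxE dj mulr0.
Qed.

(** What [acts] will require of f and s' at a single time, phrased with the explicit map F, of which
    f is a realization on the manifold. *)
Definition pushes (M : manifold R n) (c : chart R n M) x (F : 'rV[R]_n -> 'rV[R]_n)
    s (f : M -> M) s' :=
  [/\ (exists2 W, local_diffeo W f & W (point c x)),
      dom c (f (point c x)) /\ coord c (f (point c x)) = F x,
      metric_connection_near (F x) s',
      (\forall y \near x, read c c f y = F y) &
      \forall y \near x, transports F y s s'].

(** Multiplying the transport identities by inverse Jacobians expresses s' o F through s0 and the
    Jacobian, so its jets at x are differentiable in t; [jderivable_comp_inv] transfers this to the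
    jets of s' at the moving point. *)
Lemma jderivable_transport x s0 X (s' : R -> structure R n) m :
  (forall l y, smooth_at y (X l)) -> smooth_structure x s0 ->
  (\forall t \near (0 : R), smooth_structure (shift_map X t x) (s' t)) ->
  (\forall t \near (0 : R), \forall y \near x, transports (shift_map X t) y s0 (s' t)) ->
  (forall i j, jderivable (fun t => shift_map X t x) m (fun t y => metric (s' t) y i j)) /\
  (forall a i j, jderivable (fun t => shift_map X t x) m (fun t y => torsion (s' t) y a i j)).
Proof.
move=> sX [sg sT] ss' tr.
pose F := shift_map X.
have JJ a i : jderivable (fun=> x) m (fun t y => Defs.jacobian (F t) y a i).
  have := jderiv_jderivable (jderiv_partial i (jderiv_shift_map sX x m.+1 a)).
  congr (jderivable _ _ _); apply/funext => t; apply/funext => y; by rewrite mxE.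
have F0 : F 0 = id.
  by apply/funext => y; apply/rowP => l; rewrite mxE mul0r addr0.
pose K t y := cramer_inv (Defs.jacobian (F t) y).
have JK e i : jderivable (fun=> x) m (fun t y => K t y e i).
  apply: jderivable_cramer => //.
  by rewrite F0 jacobian_id det1 oner_neq0.
have cJ : \forall t \near (0 : R), \forall y \near x, Defs.jacobian (F t) y \in unitmx.
  have := shift_map_diffeo sX openT (I : setT x).
  apply: filterS => t [r [H [[r0 _] _ _ _ HJ]]].
  by apply/nbhs_ballP; exists r => // y /HJ.
have JKE t y : Defs.jacobian (F t) y \in unitmx -> Defs.jacobian (F t) y *m K t y = 1%:M.
  by move=> u; rewrite /K cramer_invE // mulmxV.
have sF : \forall t \near (0 : R), forall l, smooth_at x (fun y => F t y 0 l).
  by exists 1 => //= t _ l; exact: smooth_shift_map.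
have HK : \forall t \near (0 : R), \forall y \near x, forall l k,
     \sum_i partial i (fun z => F t z 0 l) y * K t y i k = (l == k)%:R.
  apply: filterS cJ => t; apply: filterS => y /JKE E l k'.
  have := congr1 (fun A : 'M[R]_n => A l k') E; rewrite !mxE => <-.
  by apply: eq_bigr => i _; rewrite [Defs.jacobian _ _ _ _]mxE.
have s0c : \forall t \near (0 : R), smooth_at x (cst (0 : R)).
  by exists 1 => //= t _; exact: smooth_at_cst.
split=> [i j|a i j].
- apply: (jderivable_comp_inv (K := fun i k t y => K t y i k) sF HK) => //.
    by apply: filterS ss' => t [].
  have JS : jderivable (fun=> x) m (fun t y => \sum_b (\sum_c K t y c i * metric s0 y c b) * K t y b j).
    apply: jderivable_sum => // b; apply: jderivableM => //.
    apply: jderivable_sum => // c; apply: jderivableM => //.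
    exact: jderivable_const.
  apply: jderivable_ext JS; near=> t.
  have nJ : \forall y \near x, Defs.jacobian (F t) y \in unitmx by near: t.
  have nT : \forall y \near x, transports (F t) y s0 (s' t) by near: t.
  near=> y.
  have Ju : Defs.jacobian (F t) y \in unitmx by near: y.
  have [Eg _] : transports (F t) y s0 (s' t) by near: y.
  transitivity (((K t y)^T *m metric s0 y *m K t y) i j).
    rewrite mxE; apply: eq_bigr => b _; congr (_ * _); rewrite mxE.
    by apply: eq_bigr => c _; rewrite [(K t y)^T _ _]mxE.
  by rewrite Eg !mulmxA -trmx_mul JKE // trmx1 mul1mx -mulmxA JKE // mulmx1.
- apply: (jderivable_comp_inv (K := fun i k t y => K t y i k) sF HK) => //.
    by apply: filterS ss' => t [].
  have JS : jderivable (fun=> x) m (fun t y => \sum_e \sum_f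
      (\sum_c Defs.jacobian (F t) y a c * torsion s0 y c e f) * (K t y e i * K t y f j)).
    apply: jderivable_sum => // e; apply: jderivable_sum => // f; apply: jderivableM; last exact: jderivableM.
    apply: jderivable_sum => // c; apply: jderivableM => //.
    exact: jderivable_const.
  apply: jderivable_ext JS; near=> t.
  have nJ : \forall y \near x, Defs.jacobian (F t) y \in unitmx by near: t.
  have nT : \forall y \near x, transports (F t) y s0 (s' t) by near: t.
  near=> y.
  have Ju : Defs.jacobian (F t) y \in unitmx by near: y.
  have [_ ET] : transports (F t) y s0 (s' t) by near: y.
  have KJ b i' : \sum_e Defs.jacobian (F t) y b e * K t y e i' = (b == i')%:R.
    by have := congr1 (fun A : 'M[R]_n => A b i') (JKE _ _ Ju); rewrite !mxE.
  under eq_bigr do under eq_bigr do rewrite ET.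
  transitivity (\sum_b \sum_d torsion (s' t) (F t y) a b d * (b == i)%:R * (d == j)%:R); last first.
    rewrite (bigD1 i) //= (bigD1 j) //= !eqxx !mulr1 !big1 ?addr0 //.
      by move=> b /negbTE ->; rewrite big1 // => d _; rewrite mulr0 mul0r.
    by move=> d /negbTE ->; rewrite mulr0.
  transitivity (\sum_e \sum_f \sum_b \sum_d torsion (s' t) (F t y) a b d *
     (Defs.jacobian (F t) y b e * K t y e i) * (Defs.jacobian (F t) y d f * K t y f j)).
    apply: eq_bigr => e _; apply: eq_bigr => f _.
    rewrite mulr_suml; apply: eq_bigr => b _; rewrite mulr_suml; apply: eq_bigr => d _.
    ring.
  have exch (G : 'I_n -> 'I_n -> 'I_n -> R) :
      \sum_e \sum_f \sum_b G e f b = \sum_b \sum_e \sum_f G e f b.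
    rewrite [RHS]exchange_big; apply: eq_bigr => e _; exact: exchange_big.
  rewrite exch; apply: eq_bigr => b _.
  rewrite exch; apply: eq_bigr => d _.
  rewrite -(KJ b i) mulr_sumr mulr_suml; apply: eq_bigr => e _.
  by rewrite -(KJ d j) mulr_sumr.
Unshelve. all: by end_near.
Qed.

Lemma lie_orbit_tangent (M : manifold R n) (c : chart R n M) x s0 X :
  atlas M c -> (coord c @` dom c) x -> metric_connection_near x s0 ->
  (forall l y, smooth_at y (X l)) ->
  orbit_tangent c (jet_at k x s0) (lie_jet k x s0 X).
Proof.
move=> Ac Ix ms0 sX; have ss0 := metric_connection_smooth ms0.
have [U [oU Ux cU]] := near_connection_on ms0.
pose V := U `&` (coord c @` dom c).
have oV : open V by apply: openI => //; exact: image_open.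
have Vx : V x by [].
have VI : V `<=` coord c @` dom c by move=> y [].
pose F := shift_map X.
have F0 : F 0 = id.
  by apply/funext => y; apply/rowP => l; rewrite mxE mul0r addr0.
have push0 : pushes c x (F 0) s0 id s0.
  split; rewrite ?F0 //.
  - exists (dom c); first exact: local_diffeo_id.
    exact: dom_point.
  - by split; [exact: dom_point|exact: coordKr].
  - exact: read_id.
  - by near=> y; exact: transports_id.
have pusht : \forall t \near (0 : R), exists fs : (M -> M) * structure R n, pushes c x (F t) s0 fs.1 fs.2.
  apply: filterS (shift_map_diffeo sX oV Vx) => t [r [H [[r0 BV] [FBV oFB] HF sH HJ]]].
  have Bx : ball x r x by exact: ballxx.
  have oB : open (ball x r) by exact: ball_open.
  have sF l : smooth_on (ball x r) (fun y => F t y 0 l).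
    by apply: smooth_on_all => y; exact: smooth_shift_map.
  have IB : ball x r `<=` coord c @` dom c by move=> y /BV/VI.
  have IFB : F t @` ball x r `<=` coord c @` dom c by move=> y /FBV/VI.
  have IFx : (coord c @` dom c) (F t x) by apply: IFB; exists x.
  exists (fun q => point c (F t (coord c q)), pushforward (F t) H s0); split=> /=.
  - exists (dom c `&` coord c @^-1` ball x r).
      exact: (local_diffeo_chart Ac oB oFB IB IFB sF sH HF).
    by split; [exact: dom_point|rewrite /preimage /= coordKr].
  - by rewrite !coordKr //; split=> //; exact: dom_point.
  - apply: (@connection_on_near _ _ (F t @` ball x r)) => //.
    apply: pushforward_connection => //.
    have [sU HU] := cU; split=> y /BV[Uy _]; [exact: sU|exact: HU].
  - apply: filterS (open_near oB Bx) => y By.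
    have Iy := IB _ By.
    have IFy : (coord c @` dom c) (F t y) by apply: IFB; exists y.
    by rewrite /read !coordKr.
  - apply: filterS (open_near oB Bx) => y By.
    by apply: pushforward_transports; [exact: HF|exact: HJ].
(* A curve is chosen pointwise in t. Its value at t = 0 is imposed separately, because the curve
   must start at the identity map of M itself and not merely at a map that reads as the identity
   near x. *)
have [fs [fs0 Hfs]] : exists fs : R -> (M -> M) * structure R n, fs 0 = (id, s0) /\
    \forall t \near (0 : R), pushes c x (F t) s0 (fs t).1 (fs t).2.
  have /boolp.choice[g Hg] : forall t : R, exists fs : (M -> M) * structure R n,
      (exists fs' : (M -> M) * structure R n, pushes c x (F t) s0 fs'.1 fs'.2) ->
      pushes c x (F t) s0 fs.1 fs.2.
    move=> t; have [[fs Hfs]|nE] := pselect (exists fs' : (M -> M) * structure R n, pushes c x (F t) s0 fs'.1 fs'.2).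
      by exists fs.
    by exists (id, s0).
  exists (fun t => if t == 0 then (id, s0) else g t); split; first by rewrite eqxx.
  apply: filterS pusht => t Ht; have [->|t0] := eqVneq t 0; first exact: push0.
  exact: Hg.
pose s' t := (fs t).2.
pose gamma t := jet_at k (F t x) (s' t).
have s'0 : s' 0 = s0 by rewrite /s' fs0.
have [Jg JT] : (forall i j, jderivable (fun t => F t x) mo (fun t y => metric (s' t) y i j)) /\
  (forall a i j, jderivable (fun t => F t x) mo (fun t y => torsion (s' t) y a i j)).
  apply: (jderivable_transport (s0 := s0)) => //.
    by apply: filterS Hfs => t [_ _ /metric_connection_smooth].
  by apply: filterS Hfs => t [].
(* Only the existence of a velocity is established here; its value is then given by
   [lie_jet_of_transport], with constant source s0. *)
have Dgam : exists v, is_derive (0 : R) (1 : R) gamma v.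
  exists (mkjet (fun i => 'D_1 (fun t => jet_base (gamma t) i) 0)
    (fun a i j => 'D_1 (fun t => jet_metric (gamma t) a i j) 0)
    (fun a b i j => 'D_1 (fun t => jet_torsion (gamma t) a b i j) 0)).
  apply/is_derive_jet; split=> [i|a i j|a b i j].
  - rewrite mkjet_base; apply: derivableP; under eq_fun do rewrite jet_base_at shift_mapE.
    by have [] := affine_is_derive (x 0 i) (X i x).
  - rewrite mkjet_metric; apply: derivableP; under eq_fun do rewrite jet_metric_at mpartialE.
    by have [_] := Jg i j; apply; exact: size_mi_word.
  - rewrite mkjet_torsion; apply: derivableP; under eq_fun do rewrite jet_torsion_at mpartialE.
    have [_] := JT b i j; apply; exact: leq_trans (size_mi_word a) (leq_metric_order k).
have [v Dv] := Dgam.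
have vE : v = lie_jet k x s0 X.
  apply: (@lie_jet_of_transport _ _ _ _ _ _ F (fun=> s0) s') => //.
  - by rewrite F0.
  - by move=> l; exact: jderiv_shift_map.
  - by apply: filterS Hfs => t [_ _ /metric_connection_smooth ? _ ?].
  - by rewrite s'0.
rewrite -vE; exists (point c x), (fun t => (fs t).1), gamma; split=> //.
- by split; [rewrite fs0|rewrite /gamma F0 s'0].
- have cpx : coord c (point c x) = x by exact: coordKr.
  apply: filterS Hfs => t [H1 [H2 H3] H4 H5 H6]; split=> //; first exact: dom_point.
  exists s0, (s' t); rewrite cpx H3; split=> //.
  apply: filterS2 (near_join H5) H6 => y E.
  by apply: transports_near; apply: filterS E => z ->.
- move=> a j; rewrite coordKr //.
  have [D _] : is_derive (0 : R) (1 : R) (fun t : R => mpartial a (fun y => F t y 0 j) x) (mpartial a (X j) x).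
    have := affine_is_derive (mpartial a (fun y : 'rV[R]_n => y 0 j) x) (mpartial a (X j) x).
    by under [X in _ -> is_derive _ _ X _]eq_fun do rewrite mpartialE wpartial_shift_map // -!mpartialE.
  apply: near_derivable D; apply: filterS Hfs => t [_ _ _ E _].
  by rewrite !mpartialE; apply: wpartial_near; apply: filterS E => y ->.
Unshelve. all: by end_near.
Qed.

End OrbitTangentConverse.

(** * Infinitesimal freeness *)

Section Injectivity.
Variables (R : realType) (n k : nat).
Local Notation mo := (metric_order k).
Implicit Types (x y : 'rV[R]_n) (s : structure R n) (X : 'I_n -> 'rV[R]_n -> R).

Definition flat x p (u : 'rV[R]_n -> R) := forall w, (size w < p)%N -> wpartial w u x = 0.

Lemma flat_partial x p u i : flat x p.+1 u -> flat x p (partial i u).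
Proof. by move=> fu w wp; rewrite -wpartial_rcons; apply: fu; rewrite size_rcons. Qed.

(** In Leibniz's formula at order at most p, any term with fewer than p letters on u vanishes, which
    leaves at most the term where the whole word falls on u. *)
Lemma wpartial_flatM x p u h w : smooth_at x u -> smooth_at x h -> flat x p u ->
  (size w <= p)%N -> wpartial w (fun y => u y * h y) x = wpartial w u x * h x.
Proof.
elim: p w u h => [|p IH] w u h su sh fu wp; first by move: wp; case: w.
case/lastP: w wp => [//|w i]; rewrite size_rcons ltnS => wp.
rewrite !wpartial_rcons (wpartial_near w (partialM_near i su sh)).
have su' := smooth_at_partial i su; have sh' := smooth_at_partial i sh.
rewrite wpartialD; [|exact: smooth_atM..].
rewrite (IH _ _ _ su' sh) //; last exact: flat_partial.
rewrite (IH _ _ _ su sh') //; last by move=> v vp; apply: fu; apply: leq_trans vp _.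
by rewrite (fu w) ?mul0r ?addr0.
Qed.

Definition infinitesimally_free x s :=
  forall A : 'M[R]_n,
    (forall i j, \sum_a A a i * metric s x a j + \sum_b metric s x i b * A b j = 0) ->
    (forall a i j, \sum_b A b i * torsion s x a b j + \sum_d torsion s x a i d * A d j
                   - \sum_c A a c * torsion s x c i j = 0) ->
    A = 0.

Lemma sum_eq0 (V : nmodType) (F : 'I_n -> V) : (forall i, F i = 0) -> \sum_i F i = 0.
Proof. by move=> F0; rewrite big1. Qed.

Lemma flatB_cst x p X l : flat x p (X l) -> smooth_at x (X l) ->
  flat x p (fun y => X l y - X l x).
Proof.
move=> fX sX w wp; rewrite wpartialD //; last by apply: smooth_atN; exact: smooth_at_cst.
rewrite fX // add0r.
case: p fX wp => // p fX _.
have -> : (fun=> - X l x) = cst (0 : R) :> ('rV[R]_n -> R).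
  by apply/funext => y; have /= -> := fX [::] isT; rewrite oppr0.
exact: wpartial0.
Qed.

(** In a derivative of order p + 1 of the Lie derivative of g, flatness leaves only the terms where
    X is differentiated p + 2 times. The term along X - X(x) disappears since there X is
    differentiated at most p + 1 times. What remains is antisymmetric in the lowered index of X and
    the last letter, while symmetric in the letters. *)
Lemma flat_killing x s X p :
  smooth_structure x s -> (forall l, smooth_at x (X l)) ->
  (metric s x)^T = metric s x -> metric s x \in unitmx ->
  (forall w i j, size w = p.+1 -> wpartial w (lie_metric x s X i j) x = 0) ->
  (forall l, flat x p.+2 (X l)) -> forall l, flat x p.+3 (X l).
Proof.
move=> [sg sT] sX gsym gu Hw fX l w; rewrite ltnS leq_eqVlt => /orP[/eqP wp|]; last exact: fX.
have sXx a : smooth_at x (fun y => X a y - X a x).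
  by apply: smooth_atB => //; exact: smooth_at_cst.
have sdX i a : smooth_at x (partial i (X a)) by exact: smooth_at_partial.
have key v i j : size v = p.+1 ->
   \sum_a wpartial (rcons v i) (X a) x * metric s x a j
   + \sum_a wpartial (rcons v j) (X a) x * metric s x a i = 0.
  move=> vp; rewrite -[RHS](Hw v i j vp) /lie_metric.
  have s1 : smooth_at x (fun y => \sum_l0 (X l0 y - X l0 x) * partial l0 (fun z => metric s z i j) y).
    by apply: smooth_at_sum => a; apply: smooth_atM => //; exact: smooth_at_partial.
  have s2 : smooth_at x (fun y => \sum_a partial i (X a) y * metric s y a j).
    by apply: smooth_at_sum => a; exact: smooth_atM.
  have s3 : smooth_at x (fun y => \sum_b metric s y i b * partial j (X b) y).
    by apply: smooth_at_sum => a; exact: smooth_atM.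
  rewrite wpartialD //; last exact: smooth_atD.
  rewrite wpartialD //.
  rewrite wpartial_sum => [|a]; last by apply: smooth_atM => //; exact: smooth_at_partial.
  rewrite [X in _ = X + _ + _]sum_eq0 ?add0r; last first.
    move=> a; rewrite (@wpartial_flatM _ p.+2) ?vp //.
    - by rewrite (flatB_cst (fX a) (sX a)) ?mul0r ?vp.
    - exact: smooth_at_partial.
    - exact: (flatB_cst (fX a) (sX a)).
  congr (_ + _).
    rewrite wpartial_sum => [|a]; last exact: smooth_atM.
    apply: eq_bigr => a _; rewrite wpartial_rcons (@wpartial_flatM _ p.+1) ?vp //.
    exact: flat_partial.
  rewrite wpartial_sum => [|a]; last exact: smooth_atM.
  apply: eq_bigr => a _; rewrite wpartial_rcons.
  have -> : (fun y => metric s y i a * partial j (X a) y) = (fun y => partial j (X a) y * metric s y i a).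
    by apply/funext => y; rewrite mulrC.
  rewrite (@wpartial_flatM _ p.+1) ?vp //; last exact: flat_partial.
  by congr (_ * _); rewrite -{1}gsym mxE.
case/lastP: w wp => [//|w i]; case/lastP: w => [//|w m].
rewrite !size_rcons => -[wp].
pose b l' i' j' := \sum_a wpartial (rcons (rcons w l') i') (X a) x * metric s x a j'.
have bC l' i' j' : b l' i' j' = b i' l' j'.
  apply: eq_bigr => a _; congr (_ * _); apply: wpartial_perm => //.
  by rewrite -!cats1 -!catA perm_cat2l /= (perm_catC [:: l'] [:: i']).
have bA l' i' j' : b l' i' j' = - b l' j' i'.
  by apply/eqP; rewrite -addr_eq0; apply/eqP; apply: key; rewrite size_rcons wp.
(* Exchanging alternately the first two indices (no sign) and the last two (a sign), three times
   each, returns to (m, i, j') with sign -1. *)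
have b0 j' : b m i j' = 0.
  have E : b m i j' = - b m i j'.
    by rewrite {1}bC {1}bA {1}bC {1}bA {1}bC {1}bA opprK.
  by lra.
pose v : 'rV[R]_n := \row_a wpartial (rcons (rcons w m) i) (X a) x.
have vg : v *m metric s x = 0.
  by apply/rowP => j'; rewrite !mxE -[RHS](b0 j'); apply: eq_bigr => a _; rewrite mxE.
have v0 : v = 0 by rewrite -[v]mulmx1 -(mulmxV gu) mulmxA vg mul0mx.
by have := congr1 (fun u : 'rV[R]_n => u 0 l) v0; rewrite !mxE.
Qed.

Lemma lie_jet_flat x s X : metric_connection_near x s -> infinitesimally_free x s ->
  (forall l, smooth_at x (X l)) -> lie_jet k x s X = 0 ->
  forall l, flat x mo.+2 (X l).
Proof.
move=> ms fr sX E0; have ss := metric_connection_smooth ms.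
have [gsym gu _] : [/\ (metric s x)^T = metric s x, metric s x \in unitmx &
    forall a i j, torsion s x a i j = - torsion s x a j i].
  by have [U [oU Ux _ _ H]] := ms; exact: H.
have Xx l : X l x = 0.
  by have := congr1 (fun th => jet_base th l) E0; rewrite /= mkjet_base /jet_base mxE.
have Ew h m : smooth_at x h -> (forall a : multi_index n m, mpartial (mi_val a) h x = 0) ->
    forall w, (size w <= m)%N -> wpartial w h x = 0.
  move=> sh H w wm; rewrite -(@wpartial0 R n x w); apply: (eq_jet_words sh (smooth_at_cst x 0)) wm.
  by move=> a; rewrite H mpartialE wpartial0.
have Eg i j w : (size w <= mo)%N -> wpartial w (lie_metric x s X i j) x = 0.
  apply: Ew; first exact: smooth_lie_metric.
  move=> a; have := congr1 (fun th => jet_metric th a i j) E0.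
  by rewrite /= mkjet_metric /jet_metric mxE => /eqP; rewrite oppr_eq0 => /eqP.
have ET b i j w : (size w <= k)%N -> wpartial w (lie_torsion x s X b i j) x = 0.
  apply: Ew; first exact: smooth_lie_torsion.
  move=> a; have := congr1 (fun th => jet_torsion th a b i j) E0.
  by rewrite /= mkjet_torsion /jet_torsion mxE => /eqP; rewrite oppr_eq0 => /eqP.
have f2 l : flat x 2 (X l).
  pose A : 'M[R]_n := \matrix_(a, i) partial i (X a) x.
  have A0 : A = 0.
    apply: fr => [i j|a i j].
      have /= := Eg i j [::] isT; rewrite /lie_metric.
      rewrite [X in X + _ + _]sum_eq0 ?add0r => [|l']; last by rewrite subrr mul0r.
      by move=> E; rewrite -[RHS]E; congr (_ + _); apply: eq_bigr => a _; rewrite mxE.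
    have /= := ET a i j [::] isT; rewrite /lie_torsion.
    rewrite [X in X + _ + _ - _]sum_eq0 ?add0r => [|l']; last by rewrite subrr mul0r.
    by move=> E; rewrite -[RHS]E; congr (_ + _ - _); apply: eq_bigr => c _; rewrite mxE.
  case=> [|i [|//]] _ /=; first exact: Xx.
  by have := congr1 (fun B : 'M[R]_n => B l i) A0; rewrite !mxE.
(* Order p of the Lie derivative of g controls order p + 1 of X, so the order [mo] present in the
   jet reaches order [mo.+1] of X, exactly the degree of the polynomial fields. *)
suff H p : (p <= mo)%N -> forall l, flat x p.+2 (X l) by exact: H.
elim: p => [_ l|p IH pm]; first exact: f2.
apply: (flat_killing ss sX gsym gu) => [w i j wp|]; last exact: IH (ltnW pm).
by apply: Eg; rewrite wp.
Qed.

Lemma lie_jet_field_inj x s C : metric_connection_near x s -> infinitesimally_free x s ->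
  lie_jet k x s (@field_of R n k x C) = 0 -> forall l a, C l a = 0.
Proof.
move=> ms fr E l a.
have := lie_jet_flat ms fr (fun l => smooth_at_taylor x (C l) x) E.
move=> /(_ l (word (mi_val a))); rewrite ltnS size_mi_word => /(_ isT).
by rewrite wpartial_taylor.
Qed.

End Injectivity.

(** * Stabilizer of the values of (g, T) in gl(n) *)

Section Symbol.
Variables (R : realType) (n : nat).
Implicit Types (g : 'I_n -> 'I_n -> R) (T : 'I_n -> 'I_n -> 'I_n -> R).
Local Notation P := ('I_n * 'I_n)%type.
Local Notation Q := ('I_n * 'I_n + 'I_n * 'I_n * 'I_n)%type.

(** Coefficient of the entry [A p.1 p.2] in the q-th scalar equation of [infinitesimally_free]. *)
Definition symbol_entry g T (p : P) (q : Q) : R :=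
  match q with
  | inl (i, j) => (p.2 == i)%:R * g p.1 j + (p.2 == j)%:R * g i p.1
  | inr (a, i, j) => (p.2 == i)%:R * T a p.1 j + (p.2 == j)%:R * T a i p.1
                     - (a == p.1)%:R * T p.2 i j
  end.

(* Matrix of the infinitesimal action of gl(n) on the values of (g, T). *)
Definition symbol g T : 'M[R]_(#|{: P}|, #|{: Q}|) :=
  \matrix_(u, v) symbol_entry g T (enum_val u) (enum_val v).

Lemma sum_deltar (F : 'I_n -> R) i : \sum_c F c * (c == i)%:R = F i.
Proof. by rewrite (bigD1 i) //= eqxx mulr1 big1 ?addr0 // => c /negbTE ->; rewrite mulr0. Qed.

Lemma row_symbol (A : 'M[R]_n) g T :
  (\row_u A (enum_val u).1 (enum_val u).2) *m symbol g T =
  \row_v match enum_val v with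
    | inl (i, j) => \sum_a A a i * g a j + \sum_b g i b * A b j
    | inr (a, i, j) => \sum_b A b i * T a b j + \sum_d T a i d * A d j
                       - \sum_c A a c * T c i j
    end.
Proof.
apply/rowP => v; rewrite !mxE.
transitivity (\sum_(p : P) A p.1 p.2 * symbol_entry g T p (enum_val v)).
  rewrite [RHS](reindex (@enum_val _ {: P})); last first.
    by apply: onW_bij; exact: enum_val_bij.
  by apply: eq_bigr => u _; rewrite !mxE.
rewrite -(pair_bigA _ (fun a c => A a c * symbol_entry g T (a, c) (enum_val v))) /=.
case: (enum_val v) => [[i j]|[[a i] j]] /=.
- transitivity (\sum_a (A a i * g a j + A a j * g i a)).
    apply: eq_bigr => a _; under eq_bigr do rewrite mulrDr !mulrA.
    rewrite big_split /= -!mulr_suml !sum_deltar; ring.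
  by rewrite big_split /=; congr (_ + _); apply: eq_bigr => b _; rewrite mulrC.
- transitivity (\sum_b (A b i * T a b j + T a i b * A b j) - \sum_b (b == a)%:R * \sum_c A b c * T c i j).
    rewrite -sumrB; apply: eq_bigr => b _.
    under eq_bigr do rewrite mulrBr mulrDr !mulrA.
    rewrite sumrB big_split /= -!mulr_suml !sum_deltar [T a i b * _]mulrC; congr (_ - _).
    rewrite mulr_sumr; apply: eq_bigr => c _.
    by rewrite eq_sym -mulrA mulrCA.
  rewrite big_split /=; congr (_ + _ - _).
  by under eq_bigr do rewrite mulrC; rewrite sum_deltar.
Qed.

Definition free_symbol g T := forall A : 'M[R]_n,
  (forall i j, \sum_a A a i * g a j + \sum_b g i b * A b j = 0) ->
  (forall a i j, \sum_b A b i * T a b j + \sum_d T a i d * A d j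
                 - \sum_c A a c * T c i j = 0) ->
  A = 0.

Definition gram g T : R := \det (symbol g T *m (symbol g T)^T).

Lemma row_of_mx (v : 'rV[R]_#|{: P}|) : exists A : 'M[R]_n,
  v = \row_u A (enum_val u).1 (enum_val u).2.
Proof.
exists (\matrix_(a, c) v 0 (enum_rank (a, c))); apply/rowP => u.
by rewrite !mxE -surjective_pairing enum_valK.
Qed.

Lemma gram_free g T : gram g T != 0 -> free_symbol g T.
Proof.
move=> G0 A H1 H2.
have v0 : (\row_u A (enum_val u).1 (enum_val u).2) *m symbol g T = 0.
  rewrite row_symbol; apply/rowP => v; rewrite !mxE.
  by case: (enum_val v) => [[i j]|[[a i] j]].
have u : symbol g T *m (symbol g T)^T \in unitmx by rewrite unitmxE unitfE.
have r0 : (\row_u A (enum_val u).1 (enum_val u).2) = 0 :> 'rV[R]_#|{: P}|.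
  by rewrite -[LHS]mulmx1 -(mulmxV u) !mulmxA v0 !mul0mx.
apply/matrixP => a c; have := congr1 (fun w : 'rV[R]_#|{: P}| => w 0 (enum_rank (a, c))) r0.
by rewrite !mxE enum_rankK.
Qed.

(** Over the reals, v S S^T = 0 forces v S = 0, because v S S^T v^T is a sum of squares; freeness
    then gives v = 0. *)
Lemma free_gram g T : free_symbol g T -> gram g T != 0.
Proof.
move=> fr; rewrite /gram -unitfE -unitmxE -row_free_unit -kermx_eq0.
apply/eqP/row_matrixP => k; rewrite row0.
set v := row k _.
have vS : v *m (symbol g T *m (symbol g T)^T) = 0 by apply/sub_kermxP; exact: row_sub.
clearbody v.
have vS0 : v *m symbol g T = 0.
  set w := v *m symbol g T.
  have w2 : \sum_q w 0 q ^+ 2 = 0.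
    have := congr1 (fun B : 'M[R]_1 => B 0 0) (congr1 (fun B => B *m v^T) vS).
    rewrite mul0mx [RHS]mxE mulmxA -mulmxA -trmx_mul -/w mxE => E.
    by rewrite -[RHS]E; apply: eq_bigr => q _; rewrite [w^T _ _]mxE expr2.
  apply/rowP => q; rewrite [RHS]mxE; apply/eqP; rewrite -sqrf_eq0.
  by have /psumr_eq0P := w2; move=> -> // q' _; exact: sqr_ge0.
have [A vA] := row_of_mx v; rewrite vA in vS0 *.
suff -> : A = 0 by apply/rowP => u; rewrite !mxE.
rewrite row_symbol in vS0.
apply: fr => [i j|a i j].
  by have := congr1 (fun w : 'rV[R]_#|{: Q}| => w 0 (enum_rank (inl (i, j) : Q))) vS0; rewrite !mxE enum_rankK.
by have := congr1 (fun w : 'rV[R]_#|{: Q}| => w 0 (enum_rank (inr (a, i, j) : Q))) vS0; rewrite !mxE enum_rankK.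
Qed.

(* T(u, v) = phi(u) S v - phi(v) S u with phi the first coordinate and
   S = diag(0, 1, .., n - 1). *)
Definition model_torsion (a i j : 'I_n) : R :=
  ((i == 0 :> nat) && (a == j))%:R * j%:R - ((j == 0 :> nat) && (a == i))%:R * i%:R.

(** The Euclidean metric makes A antisymmetric. With 0 as first lower index, j != 0 as second and a
    != j as upper one, the torsion equation reduces to (a - j) A_aj = 0, so the distinct eigenvalues
    of S kill every off-diagonal entry outside column 0; antisymmetry handles that column and the
    diagonal. *)
Lemma model_free : free_symbol (fun i j => (1%:M : 'M[R]_n) i j) model_torsion.
Proof.
move=> A Hg HT.
have anti i j : A j i = - A i j.
  apply/eqP; rewrite -addr_eq0; apply/eqP; rewrite -[RHS](Hg i j).
  congr (_ + _).
    by under eq_bigr do rewrite mxE; rewrite sum_deltar.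
  under eq_bigr do rewrite mxE mulrC eq_sym; by rewrite sum_deltar.
have diag i : A i i = 0 by have := anti i i; lra.
have offd (a j : 'I_n) : (j != 0 :> nat) -> a != j -> A a j = 0.
  move=> j0 aj.
  have n0 : (0 < n)%N by case: (n) j {j0 aj} => // -[].
  have := HT a (Ordinal n0) j; rewrite /model_torsion /=.
  have -> : \sum_b A b (Ordinal n0) * (((b == 0 :> nat) && (a == j))%:R * j%:R
     - ((j == 0 :> nat) && (a == b))%:R * b%:R) = 0.
    by rewrite big1 // => b _; rewrite (negbTE j0) (negbTE aj) andbF !mul0r subr0 mulr0.
  have -> : \sum_d ((a == d)%:R * d%:R - ((d == 0 :> nat) && (a == Ordinal n0))%:R * 0) * A d j
     = a%:R * A a j.
    under eq_bigr do rewrite mulr0 subr0 -mulrA mulrC eq_sym.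
    by rewrite (sum_deltar (fun d => d%:R * A d j)).
  have -> : \sum_c A a c * ((c == j)%:R * j%:R - ((j == 0 :> nat) && (c == Ordinal n0))%:R * 0)
     = A a j * j%:R.
    under eq_bigr do rewrite mulr0 subr0 mulrCA mulrC.
    by rewrite (sum_deltar (fun c => A a c * j%:R)).
  move=> /eqP; rewrite add0r [A a j * _]mulrC -mulrBl mulf_eq0 subr_eq0 eqr_nat.
  by move: aj; rewrite -val_eqE => /negbTE -> /eqP.
apply/matrixP => a j; rewrite [RHS]mxE.
have [->|aj] := eqVneq a j; first exact: diag.
have [j0|j0] := boolP (j == 0 :> nat); last exact: offd.
rewrite anti offd ?oppr0 //; last by rewrite eq_sym.
by move: aj; rewrite -val_eqE /= (eqP j0).
Qed.

End Symbol.

(** The [size p] points d/(i+2) lie in ]0, d[ and outnumber the possible roots by one, the size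
    being the degree plus one. *)
Lemma nonroot_near (R : realType) (p : {poly R}) (d : R) : p != 0 -> 0 < d ->
  exists2 e, 0 < e < d & p.[e] != 0.
Proof.
move=> p0 d0.
pose e (i : nat) := d / i.+2%:R.
pose rs := [seq e i | i <- iota 0 (size p)].
have urs : uniq rs.
  rewrite map_inj_uniq ?iota_uniq // => i j /(mulfI (lt0r_neq0 d0)) /invr_inj /eqP.
  by rewrite eqr_nat => /eqP [].
have : ~~ all (root p) rs.
  apply/negP => /(max_poly_roots p0)/(_ urs).
  by rewrite size_map size_iota ltnn.
move=> /allPn[_ /mapP[i _ ->] nr]; exists (e i) => //.
rewrite /e divr_gt0 //= ltr_pdivrMr // ltr_pMr // ltr1n.
by [].
Qed.

(** * Free jets are open and dense *)

Section Density.
Variables (R : realType) (n k : nat).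
Local Notation mo := (metric_order k).
Implicit Types (x y : 'rV[R]_n) (s : structure R n) (th : jet R n k).

Fact zero_mi_subproof m : (\sum_i ([ffun=> ord0] : {ffun 'I_n -> 'I_m.+1}) i <= m)%N.
Proof. by rewrite big1 // => i _; rewrite ffunE. Qed.

Definition zero_mi m : multi_index n m := Sub [ffun=> ord0] (zero_mi_subproof m).

Lemma mpartial_zero_mi m (f : 'rV[R]_n -> R) x : mpartial (mi_val (zero_mi m)) f x = f x.
Proof.
rewrite mpartialE; have -> // : word (mi_val (zero_mi m)) = [::].
apply/nilP; rewrite /nilp size_word big1 // => i _.
by rewrite /mi_val SubK ffunE.
Qed.

Definition jet_gram th : R :=
  gram (jet_metric th (zero_mi mo)) (jet_torsion th (zero_mi k)).

Definition free_jets : set (jet R n k) := [set th | jet_gram th != 0].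

Lemma free_jets_free x s : free_jets (jet_at k x s) -> infinitesimally_free x s.
Proof.
move=> /gram_free fr A H1 H2; apply: fr => [i j|a i j].
  rewrite -[RHS](H1 i j); congr (_ + _); apply: eq_bigr => a _;
  by rewrite jet_metric_at mpartial_zero_mi.
rewrite -[RHS](H2 a i j); congr (_ + _ - _); apply: eq_bigr => b _;
  by rewrite jet_torsion_at mpartial_zero_mi.
Qed.

Lemma continuous_jet_gram : continuous jet_gram.
Proof.
pose P (f : jet R n k -> R) := continuous f.
have Pc c : P (cst c) by move=> th; exact: cst_continuous.
have PD f g : P f -> P g -> P (fun u => f u + g u).
  by move=> cf cg th; exact: (cvgD (cf th) (cg th)).
have PM f g : P f -> P g -> P (fun u => f u * g u).
  by move=> cf cg th; exact: (cvgM (cf th) (cg th)).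
have Pu u : P (fun th => th 0 u) by exact: matrix_normedtype.coord_continuous.
have PN f : P f -> P (fun u => - f u).
  by move=> cf th; exact: (cvgN (cf th)).
apply: (closed_det Pc PD PM) => i j.
under eq_fun do rewrite mxE.
apply: (closed_sum Pc PD) => l.
have PS u v : P (fun th => symbol (jet_metric th (zero_mi mo)) (jet_torsion th (zero_mi k)) u v).
  under eq_fun do rewrite mxE.
  case: (enum_val v) => [[i' j']|[[a i'] j']] /=.
    by apply: (PD _ _ (PM _ _ (Pc _) (Pu _)) (PM _ _ (Pc _) (Pu _))).
  by apply: (PD _ _ (PD _ _ (PM _ _ (Pc _) (Pu _)) (PM _ _ (Pc _) (Pu _))) (PN _ (PM _ _ (Pc _) (Pu _)))).
apply: PM; first exact: PS.
by under eq_fun do rewrite [(symbol _ _)^T _ _]mxE; exact: PS.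
Qed.

Lemma open_free_jets : open free_jets.
Proof.
rewrite openE => th /= th0.
have H : \forall u \near th, jet_gram u != 0.
  exact: (cvgr_neq0 _ (@continuous_jet_gram th) th0).
exact: H.
Qed.

Definition mix_structure (e : R) s s' : structure R n :=
  Structure (fun y => (1 - e) *: metric s y + e *: metric s' y)
            (fun y a i j => (1 - e) * torsion s y a i j + e * torsion s' y a i j).

Lemma jet_at_mix x e s s' : smooth_structure x s -> smooth_structure x s' ->
  jet_at k x (mix_structure e s s') = (1 - e) *: jet_at k x s + e *: jet_at k x s'.
Proof.
move=> [sg sT] [sg' sT']; apply/rowP => u; rewrite !mxE.
case: (enum_val u) => [i|[[a [i j]]|[a [[b i] j]]]] /=.
- by rewrite -mulrDl subrK mul1r.
- rewrite !mpartialE; under eq_fun do rewrite !mxE.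
  by rewrite wpartialD ?wpartialZ //; exact: smooth_atZ.
- by rewrite !mpartialE wpartialD ?wpartialZ //; exact: smooth_atZ.
Qed.

Lemma smooth_mix x e s s' : smooth_structure x s -> smooth_structure x s' ->
  smooth_structure x (mix_structure e s s').
Proof.
move=> [sg sT] [sg' sT']; split=> [i j|a i j] /=.
  by under eq_fun do rewrite !mxE; apply: smooth_atD; exact: smooth_atZ.
by apply: smooth_atD; exact: smooth_atZ.
Qed.

Definition model_structure : structure R n :=
  Structure (fun=> 1%:M) (fun _ a i j => model_torsion R a i j).

Lemma smooth_model x : smooth_structure x model_structure.
Proof. by split=> *; exact: smooth_at_cst. Qed.

Definition symbol_pencil x s : 'M[{poly R}]_(_, _) := \matrix_(u, v)
  ((1 - 'X) * (symbol (metric s x) (torsion s x) u v)%:P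
   + 'X * (symbol (fun i j => (1%:M : 'M[R]_n) i j) (@model_torsion R n) u v)%:P).

Definition gram_poly x s : {poly R} := \det (symbol_pencil x s *m (symbol_pencil x s)^T).

Lemma gram_polyE x s e : (gram_poly x s).[e] =
  gram (metric (mix_structure e s model_structure) x)
       (torsion (mix_structure e s model_structure) x).
Proof.
have E : map_mx (horner_eval e) (symbol_pencil x s) =
   symbol (metric (mix_structure e s model_structure) x)
          (torsion (mix_structure e s model_structure) x).
  apply/matrixP => u v; rewrite !mxE /= /horner_eval !hornerE.
  case: (enum_val v) => [[i j]|[[a i] j]] /=; rewrite ?mxE; ring.
rewrite /gram_poly /gram -horner_evalE -det_map_mx; congr (\det _).
by rewrite map_mxM -map_trmx E.
Qed.

(** The given metric may be indefinite, so the pencil joining it to the Euclidean one can meet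
    degenerate metrics; this polynomial, equal to 1 at e = 1, confines them to finitely many e. *)
Definition metric_det_poly x s : {poly R} := \det (\matrix_(u, v)
  ((1 - 'X) * (metric s x u v)%:P + 'X * ((1%:M : 'M[R]_n) u v)%:P)).

Lemma metric_det_polyE x s e :
  (metric_det_poly x s).[e] = \det (metric (mix_structure e s model_structure) x).
Proof.
rewrite /metric_det_poly -horner_evalE -det_map_mx; congr (\det _).
by apply/matrixP => u v; rewrite !mxE /= /horner_eval !hornerE.
Qed.

(** Nondegeneracy is an open condition through the determinant, so it only has to be checked at
    x. *)
Lemma connection_of_smooth (U : set 'rV[R]_n) x s : open U -> U x ->
  (forall y, U y -> smooth_structure y s) ->
  (forall y, U y -> (metric s y)^T = metric s y) ->
  (forall y, U y -> forall a i j, torsion s y a i j = - torsion s y a j i) ->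
  metric s x \in unitmx -> metric_connection_near x s.
Proof.
move=> oU Ux ss sym anti gu.
have sdet y : U y -> smooth_at y (fun y => \det (metric s y)).
  move=> Uy; have D f g := @smooth_atD R n y f g; have M f g := @smooth_atM R n y f g.
  by apply: (closed_det (@smooth_at_cst R n y) D M) => i j; have [] := ss y Uy.
pose V := U `&` (fun y => \det (metric s y)) @^-1` [set u | u != 0].
have oV : open V.
  apply: open_preimage_on => //.
  by move=> y Uy; exact: smooth_at_cont (sdet y Uy).
apply: (@connection_on_near _ _ V) => //.
  by split=> //; rewrite /preimage /= -unitfE -unitmxE.
split=> [y [Uy _]|y [Uy d0]]; first exact: ss.
split; [exact: sym|by rewrite unitmxE unitfE|exact: anti].
Qed.

(** Freeness and nondegeneracy along the pencil are each the nonvanishing of a polynomial in e that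
    is nonzero at e = 1, the model. Arbitrarily small e > 0 thus satisfy both, and the jet is affine
    in e, hence converges to the given one as e tends to 0. *)
Lemma dense_free_jets (M : topologicalType) (c : chart R n M) :
  jet_space c k `<=` closure (jet_space c k `&` free_jets).
Proof.
move=> _ [x [s [Ix ms ->]]] B nB.
have ss := metric_connection_smooth ms.
pose p := gram_poly x s; pose q := metric_det_poly x s.
have p0 : p != 0.
  apply/eqP => pE; have := gram_polyE x s 1; rewrite -/p pE horner0 => /esym/eqP.
  apply/negP; have := free_gram (@model_free R n); congr (gram _ _ != 0).
    by apply/funext => i; apply/funext => j; rewrite /= subrr scale0r add0r scale1r.
  by apply/funext => a; apply/funext => i; apply/funext => j; rewrite /= subrr mul0r add0r mul1r.
have q0 : q != 0.
  apply/eqP => qE; have := metric_det_polyE x s 1; rewrite -/q qE horner0 => /esym/eqP.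
  by rewrite /= subrr scale0r add0r scale1r det1 oner_eq0.
have pq0 : p * q != 0 by rewrite mulf_neq0.
pose th (e : R) := jet_at k x (mix_structure e s model_structure).
have cth : th e @[e --> (0 : R)] --> jet_at k x s.
  have -> : th = (fun e => jet_at k x s + e *: (jet_at k x model_structure - jet_at k x s)).
    apply/funext => e; rewrite /th jet_at_mix //; last exact: smooth_model.
    by rewrite scalerBl scale1r scalerBr addrA addrAC.
  rewrite -[X in _ --> X]addr0 -(scale0r (jet_at k x model_structure - jet_at k x s)).
  apply: cvgD; first exact: cvg_cst.
  exact: scalel_continuous.
have /nbhs_ballP[d /= d0 dB] : \forall e \near (0 : R), B (th e) := cth _ nB.
have [e /andP[e0 ed]] := nonroot_near pq0 d0.
rewrite hornerM mulf_eq0 negb_or => /andP[pe qe].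
have gu : metric (mix_structure e s model_structure) x \in unitmx.
  by rewrite unitmxE unitfE -metric_det_polyE.
exists (th e); split; last first.
  by apply: dB; rewrite -ball_normE /= sub0r normrN gtr0_norm.
split.
- exists x, (mix_structure e s model_structure); split=> //.
  have [U [oU Ux [sU HU]]] := near_connection_on ms.
  apply: (@connection_of_smooth U) => //.
  + by move=> y Uy; apply: smooth_mix; [exact: sU|exact: smooth_model].
  + by move=> y /HU[g1 _ _]; rewrite /= linearD !linearZ /= g1 trmx1.
  + move=> y /HU[_ _ T1] a i j; rewrite /= T1 /model_torsion; ring.
- rewrite /free_jets /jet_gram /=.
  have E1 : jet_metric (th e) (zero_mi mo) = metric (mix_structure e s model_structure) x.
    by apply/funext => i; apply/funext => j; rewrite jet_metric_at mpartial_zero_mi.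
  have E2 : jet_torsion (th e) (zero_mi k) = torsion (mix_structure e s model_structure) x.
    by apply/funext => a; apply/funext => i; apply/funext => j; rewrite jet_torsion_at mpartial_zero_mi.
  by rewrite E1 E2 -gram_polyE.
Qed.

End Density.

(** * Dimensions *)

Lemma linear_image (R : realType) (p q : nat) (f : 'rV[R]_p -> 'rV[R]_q) :
  linear f -> (forall u, f u = 0 -> u = 0) ->
  exists W : {vspace 'rV[R]_q}, (forall v, (v \in W) <-> exists u, v = f u) /\ \dim W = p.
Proof.
move=> lf inj.
pose fM := GRing.isLinear.Build _ _ _ _ f lf.
pose fL : {linear 'rV[R]_p -> 'rV[R]_q} := HB.pack f fM.
exists (limg (linfun fL)); split=> [v|].
  split=> [/memv_imgP[u _ ->]|[u ->]]; first by exists u; rewrite lfunE.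
  have -> : f u = linfun fL u by rewrite lfunE.
  exact: memv_img (memvf u).
have k0 : lker (linfun fL) == 0%VS.
  apply/lker0P => u u'; rewrite !lfunE /= => E; apply/eqP; rewrite -subr_eq0.
  apply/eqP; apply: inj; have -> : f (u - u') = f u - f u' := linearB fL u u'.
  by rewrite E subrr.
rewrite limg_dim_eq; first by rewrite dimvf /dim /= mul1n.
by rewrite (eqP k0) capv0.
Qed.

(** * Tangent space of the space of jets, and linearity of the Lie velocity *)

Section TangentSpace.
Variables (R : realType) (n k : nat).
Local Notation mo := (metric_order k).
Implicit Types (x y : 'rV[R]_n) (s : structure R n) (th v : jet R n k).

Lemma jet_base_lin th t v i : jet_base (th + t *: v) i = jet_base th i + t * jet_base v i.
Proof. by rewrite /jet_base !mxE. Qed.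
Lemma jet_metric_lin th t v a i j :
  jet_metric (th + t *: v) a i j = jet_metric th a i j + t * jet_metric v a i j.
Proof. by rewrite /jet_metric !mxE. Qed.
Lemma jet_torsion_lin th t v a b i j :
  jet_torsion (th + t *: v) a b i j = jet_torsion th a b i j + t * jet_torsion v a b i j.
Proof. by rewrite /jet_torsion !mxE. Qed.

Lemma jet_base_scaleD t v th i : jet_base (t *: v + th) i = t * jet_base v i + jet_base th i.
Proof. by rewrite /jet_base !mxE. Qed.
Lemma jet_metric_scaleD t v th a i j :
  jet_metric (t *: v + th) a i j = t * jet_metric v a i j + jet_metric th a i j.
Proof. by rewrite /jet_metric !mxE. Qed.
Lemma jet_torsion_scaleD t v th a b i j :
  jet_torsion (t *: v + th) a b i j = t * jet_torsion v a b i j + jet_torsion th a b i j.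
Proof. by rewrite /jet_torsion !mxE. Qed.

Definition jet_symmetric v :=
  (forall a i j, jet_metric v a i j = jet_metric v a j i) /\
  (forall a b i j, jet_torsion v a b i j = - jet_torsion v a b j i).

Lemma connection_jet_symmetric x s : metric_connection_near x s -> jet_symmetric (jet_at k x s).
Proof.
move=> ms; have [sg sT] := metric_connection_smooth ms.
have [U [oU Ux [_ HU]]] := near_connection_on ms.
split=> [a i j|a b i j]; rewrite ?jet_metric_at ?jet_torsion_at !mpartialE.
  apply: wpartial_near; apply: filterS (open_near oU Ux) => y /HU[E _ _].
  by rewrite -{1}E mxE.
rewrite -wpartialN //; apply: wpartial_near.
by apply: filterS (open_near oU Ux) => y /HU[_ _ E].
Qed.

Lemma jet_space_tangent_symmetric (M : topologicalType) (c : chart R n M) th v :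
  jet_space_tangent c th v -> jet_symmetric v.
Proof.
move=> [gamma [_ ng /is_derive_jet[_ Dg DT]]].
have ns : \forall t \near (0 : R), jet_symmetric (gamma t).
  by apply: filterS ng => t [x [s [_ ms ->]]]; exact: connection_jet_symmetric.
split=> [a i j|a b i j].
- have D : is_derive (0 : R) (1 : R) (fun t => jet_metric (gamma t) a i j) (jet_metric v a j i).
    by apply: near_is_derive (Dg a j i); apply: filterS ns => t [E _].
  by rewrite -(@derive_val _ _ _ _ _ _ _ D) (@derive_val _ _ _ _ _ _ _ (Dg a i j)).
- have D : is_derive (0 : R) (1 : R) (fun t => jet_torsion (gamma t) a b i j) (- jet_torsion v a b j i).
    apply: near_is_derive (is_deriveN (DT a b j i)).
    by apply: filterS ns => t [_ E]; rewrite [RHS]E.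
  by rewrite -(@derive_val _ _ _ _ _ _ _ D) (@derive_val _ _ _ _ _ _ _ (DT a b i j)).
Qed.

Definition jet_point th : 'rV[R]_n := \row_i jet_base th i.

Definition taylor_structure th : structure R n :=
  Structure
    (fun y => \matrix_(i, j) taylor (jet_point th) (fun a => jet_metric th a i j) y)
    (fun y b i j => taylor (jet_point th) (fun a => jet_torsion th a b i j) y).

Lemma jet_at_taylor th : jet_at k (jet_point th) (taylor_structure th) = th.
Proof.
apply: jetP => [i|a i j|a b i j].
- by rewrite jet_base_at mxE.
- rewrite jet_metric_at; under eq_fun do rewrite mxE; exact: mpartial_taylor.
- by rewrite jet_torsion_at; exact: mpartial_taylor.
Qed.

Lemma taylor_at_point m x (d : multi_index n m -> R) : taylor x d x = d (zero_mi n m).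
Proof. by rewrite -(mpartial_zero_mi m) mpartial_taylor. Qed.

Lemma jet_space_intro (M : topologicalType) (c : chart R n M) th :
  (coord c @` dom c) (jet_point th) -> jet_symmetric th ->
  \matrix_(i, j) jet_metric th (zero_mi n mo) i j \in unitmx -> jet_space c k th.
Proof.
move=> Ix [sg sT] gu; exists (jet_point th), (taylor_structure th); split=> //; last first.
  by rewrite jet_at_taylor.
apply: (@connection_of_smooth _ _ setT) => //; first exact: openT.
- by move=> y _; split=> *; [under eq_fun do rewrite mxE|]; exact: smooth_at_taylor.
- move=> y _; apply/matrixP => i j; rewrite !mxE; apply: eq_bigr => a _.
  by rewrite sg.
- move=> y _ a i j; rewrite /= /taylor -sumrN; apply: eq_bigr => b _.
  by rewrite sT mulNr.
- congr (_ \in unitmx): gu; apply/matrixP => i j; by rewrite !mxE taylor_at_point.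
Qed.

(** The straight line through the jet in direction v stays in the jet space for small t: symmetry is
    linear, while a base point in the chart image and an invertible metric are open conditions.
    Taylor polynomials realize each of its points. *)
Lemma symmetric_jet_space_tangent (M : topologicalType) (c : chart R n M) th v :
  jet_space c k th -> jet_symmetric v -> jet_space_tangent c th v.
Proof.
move=> [x [s [Ix ms ->]]] [vg vT]; set th0 := jet_at k x s.
have [tg tT] := connection_jet_symmetric ms.
have gu : metric s x \in unitmx.
  by have [U [oU Ux _ _ H]] := ms; have [] := H x Ux.
exists (fun t => th0 + t *: v); split.
- by rewrite scale0r addr0.
- pose g t := \matrix_(i, j) jet_metric (th0 + t *: v) (zero_mi n mo) i j.
  have nI : \forall t \near (0 : R), (coord c @` dom c) (jet_point (th0 + t *: v)).
    have cx : jet_point (th0 + t *: v) @[t --> (0 : R)] --> x.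
      have -> : (fun t => jet_point (th0 + t *: v)) = (fun t => x + t *: jet_point v).
        by apply/funext => t; apply/rowP => i; rewrite !mxE jet_base_lin jet_base_at.
      rewrite -[X in _ --> X]addr0 -(scale0r (jet_point v)).
      apply: cvgD; first exact: cvg_cst.
      exact: scalel_continuous.
    by apply: cx; exact: open_near (@image_open _ _ _ c) Ix.
  have ng : \forall t \near (0 : R), g t \in unitmx.
    have cg : {for 0, continuous (fun t => \det (g t))}.
      pose P (f : R -> R) := {for 0, continuous f}.
      have Pc d : P (cst d) by exact: cst_continuous.
      have PD f h : P f -> P h -> P (fun u => f u + h u) by move=> cf ch; exact: (cvgD cf ch).
      have PM f h : P f -> P h -> P (fun u => f u * h u) by move=> cf ch; exact: (cvgM cf ch).
      apply: (closed_det Pc PD PM) => i j.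
      have := PD _ _ (Pc (jet_metric th0 (zero_mi n mo) i j))
        (PM _ _ cvg_id (Pc (jet_metric v (zero_mi n mo) i j))).
      congr (P _); apply/funext => t; by rewrite mxE jet_metric_lin.
    have g0 : \det (g 0) != 0.
      rewrite -unitfE -unitmxE; congr (_ \in unitmx): gu.
      apply/matrixP => i j; rewrite mxE scale0r addr0 /th0 jet_metric_at.
      by rewrite mpartial_zero_mi.
    have H : \forall t \near (0 : R), \det (g t) != 0 by exact: (cvgr_neq0 _ cg g0).
    by apply: filterS H => t; rewrite unitmxE unitfE.
  apply: filterS2 nI ng => t It gt; apply: jet_space_intro => //.
  split=> *; first by rewrite !jet_metric_lin tg vg.
  by rewrite !jet_torsion_lin tT vT mulrN opprD.
- apply/is_derive_jet; split=> [i|a i j|a b i j].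
  + by under eq_fun do rewrite jet_base_lin; exact: affine_is_derive.
  + by under eq_fun do rewrite jet_metric_lin; exact: affine_is_derive.
  + by under eq_fun do rewrite jet_torsion_lin; exact: affine_is_derive.
Qed.

Definition sym_index := {p : 'I_n * 'I_n | (p.1 <= p.2)%N}.
Definition alt_index := {p : 'I_n * 'I_n | (p.1 < p.2)%N}.

(** The final default 0 is never reached, as one of the two orders of the pair is always an
    index. *)
Definition sym_ext (h : sym_index -> R) (i j : 'I_n) : R :=
  if insub (i, j) is Some p then h p else if insub (j, i) is Some p then h p else 0.

(** The final default 0 is the value on the diagonal. *)
Definition alt_ext (h : alt_index -> R) (i j : 'I_n) : R :=
  if insub (i, j) is Some p then h p else if insub (j, i) is Some p then - h p else 0.

Lemma sym_extC h i j : sym_ext h i j = sym_ext h j i.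
Proof.
rewrite /sym_ext; case: insubP => [p /= ij Ep|/= ij]; case: insubP => [q /= ji Eq|/= ji] //.
  have E : i = j by apply/ord_inj/anti_leq; rewrite ij.
  by congr (h _); apply: val_inj; rewrite [LHS]Ep [RHS]Eq E.
Qed.

Lemma alt_extN h i j : alt_ext h i j = - alt_ext h j i.
Proof.
rewrite /alt_ext; case: insubP => [p /= ij Ep|/= ij]; case: insubP => [q /= ji Eq|/= ji];
  rewrite ?opprK ?oppr0 //.
by have := ltn_trans ij ji; rewrite ltnn.
Qed.

Lemma sym_ext_val h (p : sym_index) : sym_ext h (val p).1 (val p).2 = h p.
Proof. by rewrite /sym_ext -surjective_pairing valK. Qed.

Lemma alt_ext_val h (p : alt_index) : alt_ext h (val p).1 (val p).2 = h p.
Proof. by rewrite /alt_ext -surjective_pairing valK. Qed.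

Lemma sym_extE (G : 'I_n -> 'I_n -> R) i j : (forall i j, G i j = G j i) ->
  sym_ext (fun p => G (val p).1 (val p).2) i j = G i j.
Proof.
move=> sG; rewrite /sym_ext; case: insubP => [p _ -> //|/= ij].
case: insubP => [p _ ->|/= ji]; first exact: sG.
by move: ij ji; rewrite -!ltnNge => ij /(ltn_trans ij); rewrite ltnn.
Qed.

Lemma alt_extE (G : 'I_n -> 'I_n -> R) i j : (forall i j, G i j = - G j i) ->
  alt_ext (fun p => G (val p).1 (val p).2) i j = G i j.
Proof.
move=> sG; rewrite /alt_ext; case: insubP => [p _ -> //|/= ij].
case: insubP => [p _ ->|/= ji]; first by rewrite -sG.
have -> : i = j by apply/ord_inj/anti_leq; move: ij ji; rewrite -!leqNgt => -> ->.
by have := sG j j; lra.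
Qed.

Lemma sym_ext_lin a h h' i j :
  sym_ext (fun p => a * h p + h' p) i j = a * sym_ext h i j + sym_ext h' i j.
Proof.
rewrite /sym_ext; case: insubP => // _; case: insubP => // _.
by rewrite mulr0 addr0.
Qed.

Lemma alt_ext_lin a h h' i j :
  alt_ext (fun p => a * h p + h' p) i j = a * alt_ext h i j + alt_ext h' i j.
Proof.
rewrite /alt_ext; case: insubP => // _; case: insubP => [p _ _|_]; first by rewrite opprD mulrN.
by rewrite mulr0 addr0.
Qed.

(** Labels independent coordinates on the subspace cut out by [jet_symmetric]; its cardinality is
    the dimension of the jet space. *)
Definition free_index : finType :=
  ('I_n + (multi_index n mo * sym_index + multi_index n k * ('I_n * alt_index)))%type.

Definition symmetric_jet (u : 'rV[R]_#|free_index|) : jet R n k :=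
  mkjet (fun i => u 0 (enum_rank (inl i : free_index)))
    (fun a i j => sym_ext (fun p => u 0 (enum_rank (inr (inl (a, p)) : free_index))) i j)
    (fun a b i j => alt_ext (fun p => u 0 (enum_rank (inr (inr (a, (b, p))) : free_index))) i j).

Lemma symmetric_jet_linear : linear symmetric_jet.
Proof.
move=> a u v; apply: jetP => [i|c i j|c b i j].
- by rewrite jet_base_scaleD !mkjet_base !mxE.
- rewrite jet_metric_scaleD !mkjet_metric -sym_ext_lin; congr (sym_ext _ i j).
  by apply/funext => p; rewrite !mxE.
- rewrite jet_torsion_scaleD !mkjet_torsion -alt_ext_lin; congr (alt_ext _ i j).
  by apply/funext => p; rewrite !mxE.
Qed.

Lemma symmetric_jet_inj u : symmetric_jet u = 0 -> u = 0.
Proof.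
move=> E; apply/rowP => f; rewrite [RHS]mxE -(enum_valK f).
case: (enum_val f) => [i|[[a p]|[a [b p]]]].
- by have := congr1 (fun th => jet_base th i) E; rewrite /= mkjet_base => ->; rewrite /jet_base mxE.
- have := congr1 (fun th => jet_metric th a (val p).1 (val p).2) E.
  by rewrite /= mkjet_metric sym_ext_val => ->; rewrite /jet_metric mxE.
- have := congr1 (fun th => jet_torsion th a b (val p).1 (val p).2) E.
  by rewrite /= mkjet_torsion alt_ext_val => ->; rewrite /jet_torsion mxE.
Qed.

Lemma symmetric_jetP v : jet_symmetric v <-> exists u, v = symmetric_jet u.
Proof.
split=> [[sg sT]|[u ->]]; last first.
  split=> *; rewrite ?mkjet_metric ?mkjet_torsion; [exact: sym_extC|exact: alt_extN].
exists (\row_f match enum_val f with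
  | inl i => jet_base v i
  | inr (inl (a, p)) => jet_metric v a (val p).1 (val p).2
  | inr (inr (a, (b, p))) => jet_torsion v a b (val p).1 (val p).2 end).
apply: jetP => [i|a i j|a b i j].
- by rewrite mkjet_base mxE enum_rankK.
- rewrite mkjet_metric -(sym_extE i j (sg a)); congr (sym_ext _ i j).
  by apply/funext => p; rewrite mxE enum_rankK.
- rewrite mkjet_torsion -(alt_extE i j (sT a b)); congr (alt_ext _ i j).
  by apply/funext => p; rewrite mxE enum_rankK.
Qed.

Definition field_index : finType := ('I_n * multi_index n mo.+1)%type.

Definition field_row x (u : 'rV[R]_#|field_index|) : 'I_n -> 'rV[R]_n -> R :=
  @field_of R n k x (fun l a => u 0 (enum_rank ((l, a) : field_index))).

Lemma smooth_field_row x u l y : smooth_at y (field_row x u l).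
Proof. exact: smooth_at_taylor. Qed.

Lemma field_row_scaleD x a (u v : 'rV[R]_#|field_index|) :
  field_row x (a *: u + v) = fun l y => a * field_row x u l y + field_row x v l y.
Proof.
apply/funext => l; apply/funext => y.
rewrite /field_row /field_of /taylor mulr_sumr -big_split; apply: eq_bigr => b _ /=.
by rewrite !mxE mulrDl mulrA.
Qed.

Lemma partial_scaleD a (f h : 'rV[R]_n -> R) i y : smooth_at y f -> smooth_at y h ->
  partial i (fun z => a * f z + h z) y = a * partial i f y + partial i h y.
Proof.
move=> sf sh; have := wpartialD [:: i] (smooth_atZ a sf) sh.
by have := wpartialZ a [:: i] sf; rewrite /= => -> ->.
Qed.

Lemma lie_metric_scaleD x s a (X Y : 'I_n -> 'rV[R]_n -> R) i j y :
  (forall l, smooth_at y (X l)) -> (forall l, smooth_at y (Y l)) ->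
  lie_metric x s (fun l z => a * X l z + Y l z) i j y =
  a * lie_metric x s X i j y + lie_metric x s Y i j y.
Proof.
move=> sX sY; rewrite /lie_metric !mulrDr !mulr_sumr.
rewrite [RHS](addrACA (_ + _)) [X in _ = X + _]addrACA -!big_split /=.
apply: eq_bigr => l _; rewrite ?partial_scaleD //; ring.
Qed.

Lemma lie_torsion_scaleD x s a (X Y : 'I_n -> 'rV[R]_n -> R) b i j y :
  (forall l, smooth_at y (X l)) -> (forall l, smooth_at y (Y l)) ->
  lie_torsion x s (fun l z => a * X l z + Y l z) b i j y =
  a * lie_torsion x s X b i j y + lie_torsion x s Y b i j y.
Proof.
move=> sX sY; rewrite /lie_torsion !mulrBr !mulrDr !mulr_sumr.
rewrite [RHS](addrACA (_ + _)) -opprD [X in _ = X - _]addrACA.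
rewrite [X in _ = X + _ - _]addrACA -!big_split /=.
congr (_ - _); apply: eq_bigr => l _; rewrite ?partial_scaleD //; ring.
Qed.

Lemma lie_jet_linear x s : smooth_structure x s ->
  linear (fun u => lie_jet k x s (field_row x u)).
Proof.
move=> ss a u v /=; rewrite field_row_scaleD.
have sX w l y : smooth_at y (field_row x w l) by exact: smooth_field_row.
move: (field_row x u) (field_row x v) (sX u) (sX v) => X Y {}sX sY.
apply: jetP => [i|c i j|c b i j].
- by rewrite jet_base_scaleD !mkjet_base.
- rewrite jet_metric_scaleD !mkjet_metric !mpartialE mulrN -opprD; congr (- _).
  rewrite -wpartialZ; last exact: smooth_lie_metric.
  rewrite -wpartialD; [|apply: smooth_atZ; exact: smooth_lie_metric|exact: smooth_lie_metric].
  by congr (wpartial _ _ x); apply/funext => y; exact: lie_metric_scaleD.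
- rewrite jet_torsion_scaleD !mkjet_torsion !mpartialE mulrN -opprD; congr (- _).
  rewrite -wpartialZ; last exact: smooth_lie_torsion.
  rewrite -wpartialD; [|apply: smooth_atZ; exact: smooth_lie_torsion|exact: smooth_lie_torsion].
  by congr (wpartial _ _ x); apply/funext => y; exact: lie_torsion_scaleD.
Qed.

End TangentSpace.

(** * Cardinalities of the index sets *)

Lemma card_multi_index n m : #|multi_index n m| = 'C(n + m, m).
Proof.
rewrite card_sig -bin_sub ?leq_addl // addnK -card_partial_ord_partitions.
rewrite -(card_imset _ (can_inj (@finfun_of_tupleK 'I_m.+1 n))).
have sumE (t : n.-tuple 'I_m.+1) : (\sum_i finfun_of_tuple t i = \sum_(i <- t) i)%N.
  by rewrite big_tuple; apply: eq_bigr => i _; rewrite ffunE.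
apply: eq_card => a; rewrite inE; apply/idP/imsetP => [am|[t tm ->]].
  exists (tuple_of_finfun a); last by rewrite tuple_of_finfunK.
  by rewrite inE -sumE tuple_of_finfunK.
by rewrite sumE; move: tm; rewrite inE.
Qed.

Lemma card_sym_index n : #|{: {p : 'I_n * 'I_n | (p.1 <= p.2)%N}}| = 'C(n.+1, 2).
Proof.
rewrite card_sig -sum1_card.
rewrite -(pair_big_dep xpredT (fun i j : 'I_n => (i <= j)%N) (fun _ _ => 1%N)) /=.
rewrite (exchange_big_dep xpredT) //= -bin2_sum big_mkord big_ord_recl add0n.
apply: eq_bigr => j _; rewrite -(big_ord_widen n (fun=> 1%N) (ltn_ord j)).
by rewrite sum1_card card_ord.
Qed.

Lemma card_alt_index n : #|{: {p : 'I_n * 'I_n | (p.1 < p.2)%N}}| = 'C(n, 2).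
Proof.
rewrite card_sig -sum1_card.
rewrite -(pair_big_dep xpredT (fun i j : 'I_n => (i < j)%N) (fun _ _ => 1%N)) /=.
rewrite (exchange_big_dep xpredT) //= -bin2_sum big_mkord.
apply: eq_bigr => j _; rewrite -(big_ord_widen n (fun=> 1%N) (ltnW (ltn_ord j))).
by rewrite sum1_card card_ord.
Qed.

Lemma card_free_index n k : #|free_index n k| =
  (n + ('C(n + metric_order k, metric_order k) * 'C(n.+1, 2)
        + 'C(n + k, k) * (n * 'C(n, 2))))%N.
Proof.
rewrite card_sum card_ord card_sum !card_prod card_ord.
by rewrite !card_multi_index card_sym_index card_alt_index.
Qed.

Lemma card_field_index n k :
  #|field_index n k| = (n * 'C(n + (metric_order k).+1, (metric_order k).+1))%N.
Proof. by rewrite card_prod card_ord card_multi_index. Qed.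

(** * Codimension of the orbits of free jets *)

Section OrbitCodim.
Variables (R : realType) (n k : nat) (M : manifold R n) (c : chart R n M).
Hypothesis Ac : atlas M c.

Lemma orbit_tangent_sub (theta v : jet R n k) :
  orbit_tangent c theta v -> jet_space_tangent c theta v.
Proof.
move=> [p [f [gamma [[_ g0] Hact _ Dg]]]]; exists gamma; split=> //.
apply: filterS Hact => t [_ _ dfp [s [s' [_ ms' _ _ ->]]]].
by exists (coord c (f t p)), s'; split=> //; exists (f t p).
Qed.

(** Both tangent spaces are injective linear images of coordinate spaces, so their dimensions are
    cardinalities. The inclusion of one in the other also yields the inequality that makes the
    truncated subtraction exact. *)
Lemma free_orbit_codim theta : jet_space c k theta -> free_jets theta ->
  (#|field_index n k| <= #|free_index n k|)%N /\
  orbit_codim c theta (#|free_index n k| - #|field_index n k|).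
Proof.
move=> Jth fth; have [x [s [Ix ms Eth]]] := Jth.
have ss := metric_connection_smooth ms.
have fr : infinitesimally_free x s by apply: (@free_jets_free R n k); rewrite -Eth.
have [E [HE dE]] := linear_image (@symmetric_jet_linear R n k) (@symmetric_jet_inj R n k).
have injL (u : 'rV[R]_#|field_index n k|) : lie_jet k x s (field_row x u) = 0 -> u = 0.
  move=> /(lie_jet_field_inj ms fr) H; apply/rowP => f.
  rewrite [RHS]mxE -(enum_valK f); case: (enum_val f) => l a; exact: H.
have [W [HW dW]] := linear_image (lie_jet_linear (k := k) ss) injL.
have PE v : jet_space_tangent c theta v <-> v \in E.
  rewrite HE -symmetric_jetP; split; first exact: jet_space_tangent_symmetric.
  exact: symmetric_jet_space_tangent.
have PO v : orbit_tangent c theta v <-> v \in W.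
  rewrite HW Eth; split=> [/(orbit_tangent_lie Ac ss)[C ->]|[u ->]].
    exists (\row_f (let: (l, a) := enum_val f in C l a)).
    congr (lie_jet k x s _); apply/funext => l; rewrite /field_row.
    congr (taylor x _); apply/funext => a.
    by rewrite mxE enum_rankK.
  by apply: lie_orbit_tangent => // l y; exact: smooth_field_row.
have OE : (W <= E)%VS by apply/subvP => v /PO /orbit_tangent_sub /PE.
have le : (#|field_index n k| <= #|free_index n k|)%N by rewrite -dW -dE dimvS.
by split=> //; exists E, W; split=> //; rewrite dW dE subnKC.
Qed.

End OrbitCodim.

Lemma generic_orbit_codim_free (R : realType) n (M : manifold R n) k :
  generic_orbit_codim M k (#|free_index n k| - #|field_index n k|).
Proof.
move=> c Ac; exists (@free_jets R n k); split; first exact: open_free_jets.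
  exact: dense_free_jets.
by move=> theta [Jth fth]; have [] := free_orbit_codim Ac Jth fth.
Qed.

(** A purely combinatorial inequality obtained geometrically: a point of M gives a chart with the
    model jet in its jet space, density gives a free jet there, and the tangent spaces at that jet
    compare the dimensions. *)
Lemma leq_field_free_index (R : realType) n (M : manifold R n) k :
  ([set: M] !=set0)%classic -> (#|field_index n k| <= #|free_index n k|)%N.
Proof.
move=> [p _]; have [c Ac dp] := atlas_cover p.
have J : jet_space c k (jet_at k (coord c p) (model_structure R n)).
  exists (coord c p), (model_structure R n); split=> //.
  apply: (@connection_of_smooth _ _ setT) => //; first exact: openT.
  - by move=> *; exact: smooth_model.
  - by move=> y _ /=; rewrite trmx1.
  - by move=> y _ a i j /=; rewrite /model_torsion; lra.
  - by rewrite unitmx1.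
have [theta [[Jth fth] _]] := dense_free_jets J (@filterT _ _ _).
by have [] := free_orbit_codim Ac Jth fth.
Qed.

(** * Counting invariants of pure order *)

Lemma natr_bin2 n : 'C(n.+1, 2)%:R = n.+1%:R * n%:R / 2 :> rat.
Proof.
have := congr1 (fun m => m%:R : rat) (mul_bin_diag n.+1 1).
by rewrite /= bin1 !natrM => ->; field.
Qed.

Lemma pure_order_card n (s : nat -> nat) k :
  (forall k, (#|field_index n k| <= #|free_index n k|)%N) ->
  (forall k, s k = #|free_index n k| - #|field_index n k|)%N ->
  (pure_order s k)%:~R = (#|free_index n k|%:R - #|field_index n k|%:R)
    - (if k is j.+1 then #|free_index n j|%:R - #|field_index n j|%:R else 0) :> rat.
Proof.
move=> le sE; rewrite /pure_order rmorphB /= -pmulrn sE natrB //; congr (_ - _).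
by case: k => [//|j]; rewrite -pmulrn sE natrB.
Qed.
Theorem proposition8 (R : realType) (n : nat) (hn : (2 <= n)%N)
    (M : manifold R n) (hM : ([set: M] !=set0)%classic) :
  exists s : nat -> nat,
    [/\ forall k : nat, generic_orbit_codim M k (s k),
        (pure_order s 0)%:~R = n%:R / 2 * (n%:R - 1) ^+ 2 :> rat &
        forall k : nat, (0 < k)%N ->
          (pure_order s k)%:~R =
            n%:R * (n%:R + 1) / 2 * 'C(n + k, k + 1)%:R
            + n%:R ^+ 2 * (n%:R - 1) / 2 * 'C(n + k - 1, k)%:R
            - n%:R * 'C(n + k + 1, k + 2)%:R :> rat].
Proof.
pose s k := (#|free_index n k| - #|field_index n k|)%N.
have le k := leq_field_free_index k hM.
exists s; split=> [k||[//|k] _]; first exact: generic_orbit_codim_free.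
- rewrite (pure_order_card 0 le (fun=> erefl)) card_free_index card_field_index /=.
  rewrite !addn0 !bin0 !mul1n addn1 bin1.
  case: n hn {le s M hM} => // m _; have := natr_bin2 m; have := natr_bin2 m.+1.
  move: 'C(m.+1, 2) 'C(m.+2, 2) => a b Ea Eb.
  by rewrite !(natrD, natrM) Ea Eb -!natr1; field.
- rewrite (pure_order_card k.+1 le (fun=> erefl)) !card_free_index !card_field_index /=.
  rewrite !addnS !subn1 !addn0 /= ?addn0.
  case: n hn {le s M hM} => // m _.
  (* Order 1 is apart, since [metric_order] jumps there from 0 to 2. The additional first
     derivatives of g and second derivatives of X both number n 'C(n+1, 2) and cancel, so the
     general formula persists. *)
  case: k => [|k] /=; rewrite ?(addn0, bin0, bin1, addn1, addnS) /=.
    have := natr_bin2 m; have := natr_bin2 m.+1.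
    rewrite (binS m.+3 2) (binS m.+2 1) bin1.
    move: 'C(m.+1, 2) 'C(m.+2, 2) 'C(m.+3, 3) => a b e Ea Eb.
    by rewrite !(natrD, natrM) Ea Eb -!natr1; field.
  have := natr_bin2 m; have := natr_bin2 m.+1; set p := (m.+1 + k)%N.
  (* Pascal's rule exposes the differences of consecutive dimensions as the binomials of exact
     order; the remaining binomials are then generalized, and the identity is one of rational
     functions. *)
  rewrite (binS p.+3 k.+3) (binS p.+2 k.+2) (binS p.+1 k.+1).
  move: 'C(m.+1, 2) 'C(m.+2, 2) 'C(p.+3, k.+4) 'C(p.+2, k.+3) => a b e f Ea Eb.
  move: 'C(p.+1, k.+1) 'C(p.+1, k.+2) => u v.
  by rewrite !(natrD, natrM) Ea Eb -!natr1; field.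
Qed.
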